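(* Suppose that $p>1$ and $p-2<\alpha\le p-1$, and let $\mu$ be a finite positive Borel measure on $[0,1)$. The operator $\mathcal H_\mu$ is well defined on $\mathcal D^p_\alpha$ and it is a bounded operator from $\mathcal D^p_\alpha$ into itself if and only if $\mu$ is a Carleson measure.
   Context: $\mathbb D$ is the open unit disc in $\mathbb C$ and $dA=\frac1\pi\,dx\,dy$ is normalized area measure on $\mathbb D$. For $0<p<\infty$ and $\alpha>-1$, the space of Dirichlet type $\mathcal D^p_\alpha$ consists of all analytic $f$ in $\mathbb D$ with $$\|f\|_{\mathcal D^p_\alpha}=|f(0)|+\left((\alpha+1)\int_{\mathbb D}(1-|z|^2)^\alpha|f'(z)|^p\,dA(z)\right)^{1/p}<\infty.$$ For a finite positive Borel measure $\mu$ on $[0,1)$ and $n\ge 0$, let $\mu_n=\int_{[0,1)}t^n\,d\mu(t)$. For $f(z)=\sum_{k\ge0}a_kz^k$ analytic in $\mathbb D$, define formally $$\mathcal H_\mu f(z)=\sum_{n=0}^\infty\Big(\sum_{k=0}^\infty \mu_{n+k}a_k\Big)z^n,\quad z\in\mathbb D;$$ $\mathcal H_\mu f$ is well defined if the inner series converge and the resulting power series defines an analytic function in $\mathbb D$. $\mu$ is a Carleson measure if there is a constant $C>0$ such that $\mu([t,1))\le C(1-t)$ for all $0\le t<1$. The equivalence asserted is: ($\mathcal H_\mu$ is well defined on $\mathcal D^p_\alpha$ and bounded from $\mathcal D^p_\alpha$ into itself) if and only if ($\mu$ is a Carleson measure). *)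

(* Defs.v *)
From mathcomp Require Import all_boot all_order all_algebra.
From mathcomp Require Import complex.
From mathcomp Require Import all_classical all_reals all_analysis.

Set Implicit Arguments.
Unset Strict Implicit.
Unset Printing Implicit Defensive.

Import Order.TTheory GRing.Theory Num.Theory.
Import numFieldNormedType.Exports.

Local Open Scope classical_set_scope.
Local Open Scope complex_scope.
Local Open Scope ring_scope.

(* The regular module [R[i]^o] carries the topology of the modulus and is a
   normed space over [R[i]], so [derivable] and [derive1] below are complex
   differentiability and the complex derivative. *)
Notation Cplx R := (R[i]^o).

Section DirichletHankel.
Variable R : realType.

Definition unit_disc : set (Cplx R) := [set z | `|z| < 1].

Definition analytic_disc (f : Cplx R -> Cplx R) : Prop :=
  forall z, unit_disc z -> derivable f z 1.

(* [`|z|] is an element of [R[i]] with zero imaginary part. *)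
Definition modulus (z : Cplx R) : R := complex.Re `|z|.

(* Integration of a nonnegative function over the disc against
   dA = dx dy / pi, the disc being seen as a subset of the plane R * R. *)
Definition disc_integral (h : Cplx R -> R) : \bar R :=
  ((pi^-1)%:E *
   \int[lebesgue_measure \x lebesgue_measure]_(w in
       [set w : R * R | unit_disc (w.1 +i* w.2)]) (h (w.1 +i* w.2)%C)%:E)%E.

Definition dirichlet_norm (p alpha : R) (f : Cplx R -> Cplx R) : \bar R :=
  ((modulus (f 0))%:E +
   ((alpha + 1)%:E *
    disc_integral (fun z => (1 - modulus z ^+ 2) `^ alpha *
                           modulus (derive1 f z) `^ p)%R) `^ p^-1)%E.

Definition dirichlet_space (p alpha : R) (f : Cplx R -> Cplx R) : Prop :=
  analytic_disc f /\ (dirichlet_norm p alpha f < +oo)%E.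

Definition power_series (a : nat -> Cplx R) (z : Cplx R) : nat -> Cplx R :=
  series (fun n => a n * z ^+ n).

(* f(z) = \sum_k a_k z^k on the disc *)
Definition taylor_disc (f : Cplx R -> Cplx R) (a : nat -> Cplx R) : Prop :=
  forall z, unit_disc z -> power_series a z n @[n --> \oo] --> f z.

Section Hankel.
Variable mu : {finite_measure set (measurableTypeR R) -> \bar R}.

Definition moment (n : nat) : R := Rintegral mu `[0, 1[ (fun t => t ^+ n).

Definition hankel_series (a : nat -> Cplx R) (n : nat) : nat -> Cplx R :=
  series (fun k => (moment (n + k))%:C * a k).

Definition hankel_coef (a : nat -> Cplx R) (n : nat) : Cplx R :=
  limn (hankel_series a n).

(* The function H_mu f, for f(z) = \sum_k a_k z^k; the limits are
   meaningful under [hankel_well_defined]. *)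
Definition hankel_op (a : nat -> Cplx R) (z : Cplx R) : Cplx R :=
  limn (power_series (hankel_coef a) z).

Definition hankel_well_defined (a : nat -> Cplx R) : Prop :=
  [/\ forall n, cvgn (hankel_series a n),
      forall z, unit_disc z -> cvgn (power_series (hankel_coef a) z) &
      analytic_disc (hankel_op a)].

Definition hankel_well_defined_on (p alpha : R) : Prop :=
  forall f a, dirichlet_space p alpha f -> taylor_disc f a ->
    hankel_well_defined a.

(* Linearity of f |-> H_mu f is built into the formula for [hankel_op]. *)
Definition hankel_bounded_on (p alpha : R) : Prop :=
  exists2 C : R, 0 < C &
    forall f a, dirichlet_space p alpha f -> taylor_disc f a ->
      dirichlet_space p alpha (hankel_op a) /\
      (dirichlet_norm p alpha (hankel_op a) <=
       C%:E * dirichlet_norm p alpha f)%E.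

Definition carleson_measure : Prop :=
  exists2 C : R, 0 < C &
    forall t : R, 0 <= t < 1 -> (mu [set` `[t, 1%R[] <= (C * (1 - t))%:E)%E.

End Hankel.
End DirichletHankel.

(* Main.v *)
From HB Require Import structures.
Require Import Defs.
From mathcomp Require Import all_boot all_order all_algebra.
From mathcomp Require Import complex ring lra separable cyclic cyclotomic.
From mathcomp Require Import all_classical all_reals all_analysis.
From mathcomp Require Import measurable_realfun.
Import Order.TTheory GRing.Theory Num.Theory.
Import numFieldNormedType.Exports.
Local Open Scope classical_set_scope.
Local Open Scope ring_scope.
Set Implicit Arguments.
Unset Strict Implicit.
Unset Printing Implicit Defensive.

(** Write beta = (alpha + 2) / p; the hypotheses on alpha give 1 < beta < 2.

    If mu is a Carleson measure, then g = H_mu f satisfies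
    |g'(z)| <= 2 \int |f(t)| / |1 - tz|^2 dmu(t).  Cutting [0, 1) where
    1 - t ~ 2^-j and the disc where |1 - z| ~ 2^-m, the right-hand side is at
    most a constant times \sum_j 2^-j F_j min(4^j, 4^m), with F_j a bound of
    |f(t)| for 1 - t ~ 2^-j.  The sub-mean value property bounds f' at radius
    1 - 2^-j by the L^p mass of f' near that radius, hence F_j by a discrete
    Hardy sum of these masses.  Since 1 < beta < 2 all the kernels involved are
    dominated by theta^|j - m| with theta < 1, and the discrete Young inequality
    concludes.  The moment series converge absolutely because Bessel's
    inequality for f' on the discs of radius 1 - 2^-j gives
    \sum_k |a_k| t^k <= |a_0| + C (j + 4) v^j for 1 - t >= 2^-(j+1), with v < 2.

    Conversely, f(z) = 1 / (1 - bz) has norm at most C (1 - b)^(beta - 2), so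
    the pointwise estimate |g'(b)| <= C (1 - b)^(-beta) ||g|| gives
    |g'(b)| <= C (1 - b)^-2, whereas the Taylor coefficients of g give
    g'(b) >= c mu([b, 1)) (1 - b)^-3. *)

(** * Power series *)

(** Every function under study comes with a Taylor series, so the complex analysis is done on
    absolutely convergent power series, without contour integrals. Area means are taken without
    polar coordinates: plane Lebesgue measure is invariant under rotations, and averaging over
    rotations by roots of unity isolates the constant coefficient of a polynomial, or the diagonal
    of its squared modulus. The two bounds on beta act at different places: beta > 1 makes the Hardy
    sum for F_j decay, beta < 2 makes the kernel decay for j > m. The coefficient bound has to
    precede every norm estimate. Since v < 2, the sum over j of 2^-j (j + 4) v^j is finite, so the
    sum of |a_k| t^k is integrable against a Carleson measure; this is the majorant in the dominated
    convergence that puts g and g' under the integral sign. *)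

Section Modulus.
Variable R : realType.
Implicit Types z w : Cplx R.

Lemma normc_modulus z : `|z| = (modulus z)%:C%C.
Proof. by rewrite /modulus normc_def. Qed.

Lemma modulus_def z :
  modulus z = Num.sqrt (complex.Re z ^+ 2 + complex.Im z ^+ 2).
Proof. by rewrite /modulus normc_def. Qed.

Lemma modulus_ge0 z : 0 <= modulus z.
Proof. by rewrite modulus_def sqrtr_ge0. Qed.

Lemma modulus_sqr z : modulus z ^+ 2 = complex.Re z ^+ 2 + complex.Im z ^+ 2.
Proof. by rewrite modulus_def sqr_sqrtr// addr_ge0// sqr_ge0. Qed.

Lemma modulus0 : modulus (0 : Cplx R) = 0.
Proof. by rewrite /modulus normr0. Qed.

Lemma modulus1 : modulus (1 : Cplx R) = 1.
Proof. by rewrite /modulus normr1. Qed.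

Lemma modulusN z : modulus (- z) = modulus z.
Proof. by rewrite /modulus normrN. Qed.

Lemma modulusM z w : modulus (z * w) = modulus z * modulus w.
Proof.
by apply/complexI; rewrite rmorphM/= -!normc_modulus; exact: normrM.
Qed.

Lemma modulusX z n : modulus (z ^+ n) = modulus z ^+ n.
Proof.
by elim: n => [|n IH]; [rewrite !expr0 modulus1|rewrite !exprS modulusM IH].
Qed.

Lemma modulusD z w : modulus (z + w) <= modulus z + modulus w.
Proof.
have := ler_normD z w; rewrite !normc_modulus -rmorphD/=.
by rewrite lecR.
Qed.

Lemma modulusBC z w : modulus (z - w) = modulus (w - z).
Proof. by rewrite -modulusN opprB. Qed.

Lemma modulusB z w : modulus z - modulus w <= modulus (z - w).
Proof. by rewrite lerBlDr -{1}(subrK w z) modulusD. Qed.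

Lemma modulus_sum (I : Type) (s : seq I) (P : pred I) (u : I -> Cplx R) :
  modulus (\sum_(i <- s | P i) u i) <= \sum_(i <- s | P i) modulus (u i).
Proof.
elim/big_rec2: _ => [|i y x _ h]; first by rewrite modulus0.
by rewrite (le_trans (modulusD _ _))// lerD2l.
Qed.

Lemma modulus_real (x : R) : modulus (x%:C%C : Cplx R) = `|x|.
Proof. by rewrite modulus_def /= expr0n/= addr0 sqrtr_sqr. Qed.

Lemma modulus_nat n : modulus (n%:R : Cplx R) = n%:R.
Proof.
have -> : (n%:R : Cplx R) = (n%:R : R)%:C%C by rewrite rmorph_nat.
by rewrite modulus_real ger0_norm.
Qed.

Lemma Re_le_modulus z : `|complex.Re z| <= modulus z.
Proof.
rewrite -(ler_pXn2r (n:=2)) ?nnegrE ?modulus_ge0//.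
by rewrite modulus_sqr real_normK ?num_real// lerDl sqr_ge0.
Qed.

Lemma Im_le_modulus z : `|complex.Im z| <= modulus z.
Proof.
rewrite -(ler_pXn2r (n:=2)) ?nnegrE ?modulus_ge0//.
by rewrite modulus_sqr real_normK ?num_real// lerDr sqr_ge0.
Qed.

Lemma modulus_le_ReIm z : modulus z <= `|complex.Re z| + `|complex.Im z|.
Proof.
rewrite -(ler_pXn2r (n:=2)) ?nnegrE ?modulus_ge0 ?addr_ge0//.
rewrite modulus_sqr sqrrD !real_normK ?num_real//.
rewrite -addrA lerD2l lerDr mulrn_wge0// mulr_ge0//.
Qed.

Lemma unit_discE z : unit_disc z = (modulus z < 1) :> Prop.
Proof. by rewrite /unit_disc/= normc_modulus -ltcR. Qed.

Lemma cvg_modulusP {T : Type} {F : set_system T} {FF : Filter F}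
    (u : T -> Cplx R) (l : Cplx R) :
  (u @ F --> l) <-> (modulus (u x - l) @[x --> F] --> (0 : R)).
Proof.
split.
  move/cvgrPdist_lt => h; apply/cvgrPdist_lt => e e0.
  have e0' : 0 < (e%:C%C : Cplx R) by rewrite ltcR.
  apply: filterS (h _ e0') => x; rewrite normc_modulus ltcR.
  by rewrite sub0r normrN ger0_norm ?modulus_ge0// modulusBC.
move/cvgrPdist_lt => h; apply/cvgrPdist_lt => e e0.
have eE : e = (complex.Re e)%:C%C by rewrite RRe_real// gtr0_real.
have e0' : 0 < complex.Re e by rewrite eE ltcR in e0.
apply: filterS (h _ e0') => x.
rewrite sub0r normrN ger0_norm ?modulus_ge0// => ?.
by rewrite normc_modulus eE ltcR modulusBC.
Qed.

Lemma cvg_modulus {T : Type} {F : set_system T} {FF : Filter F}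
    (u : T -> Cplx R) (l : Cplx R) :
  u @ F --> l -> modulus (u x) @[x --> F] --> modulus l.
Proof.
move/cvg_modulusP/cvgrPdist_lt => h; apply/cvgrPdist_lt => e e0.
apply: filterS (h _ e0) => x; rewrite sub0r normrN ger0_norm ?modulus_ge0//.
apply: le_lt_trans; rewrite ler_norml lerNl opprB (modulusBC (u x)) modulusB.
by rewrite modulusBC modulusB.
Qed.

Lemma cvg_Re {T : Type} {F : set_system T} {FF : Filter F}
    (u : T -> Cplx R) (l : Cplx R) :
  u @ F --> l -> complex.Re (u x) @[x --> F] --> complex.Re l.
Proof.
move/cvg_modulusP/cvgrPdist_lt => h; apply/cvgrPdist_lt => e e0.
apply: filterS (h _ e0) => x; rewrite sub0r normrN ger0_norm ?modulus_ge0//.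
apply: le_lt_trans; rewrite distrC.
by rewrite (le_trans _ (Re_le_modulus _))//; case: (u x); case: l {h}.
Qed.

Lemma cvg_Im {T : Type} {F : set_system T} {FF : Filter F}
    (u : T -> Cplx R) (l : Cplx R) :
  u @ F --> l -> complex.Im (u x) @[x --> F] --> complex.Im l.
Proof.
move/cvg_modulusP/cvgrPdist_lt => h; apply/cvgrPdist_lt => e e0.
apply: filterS (h _ e0) => x; rewrite sub0r normrN ger0_norm ?modulus_ge0//.
apply: le_lt_trans; rewrite distrC.
by rewrite (le_trans _ (Im_le_modulus _))//; case: (u x); case: l {h}.
Qed.

Lemma cvg_ReIm {T : Type} {F : set_system T} {FF : Filter F}
    (u : T -> Cplx R) (a b : R) :
  complex.Re (u x) @[x --> F] --> a -> complex.Im (u x) @[x --> F] --> b ->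
  u @ F --> ((a +i* b)%C : Cplx R).
Proof.
move=> ha hb; apply/cvg_modulusP.
have h : `|complex.Re (u x) - a| + `|complex.Im (u x) - b| @[x --> F] --> (0:R).
  rewrite -(addr0 0) -{1}(@normr0 _ R) -{2}(@normr0 _ R) -{1}(subrr a) -{1}(subrr b).
  apply: cvgD; apply: cvg_norm; apply: cvgB => //; exact: cvg_cst.
move/cvgrPdist_lt : h => h; apply/cvgrPdist_lt => e e0.
apply: filterS (h _ e0) => x; rewrite !sub0r !normrN.
apply: le_lt_trans; rewrite ger0_norm ?modulus_ge0//.
rewrite [leRHS]ger0_norm ?addr_ge0//.
by rewrite (le_trans (modulus_le_ReIm _))//; case: (u x).
Qed.

Lemma cvgC_lim (u : nat -> Cplx R) (l : Cplx R) : u @ \oo --> l -> limn u = l.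
Proof. by move=> h; apply: cvg_lim => //; exact: norm_hausdorff. Qed.

Lemma modulus_lim_le (u : nat -> Cplx R) (l : Cplx R) (B : R) :
  u @ \oo --> l -> (\forall n \near \oo, modulus (u n) <= B) -> modulus l <= B.
Proof.
move=> /cvg_modulus ul h.
have <- : limn (fun n => modulus (u n)) = modulus l by apply/cvg_lim.
by apply: limr_le => //; apply/cvg_ex; exists (modulus l).
Qed.

End Modulus.

(** A remainder of order |h|^2 leaves an error C |h| in the difference quotient. The field is
    general because the lemma serves both the complex derivative in [taylor_derive] and a real one
    in [modulus_increment]. *)
Lemma is_derive_quadratic (K : numFieldType) (f : K^o -> K^o) (z d C e : K) :
  0 < e -> 0 <= C ->
  (forall h : K, `|h| < e -> `|f (h + z) - f z - h * d| <= C * `|h| ^+ 2) ->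
  is_derive (z : K^o) (1 : K^o) f (d : K^o).
Proof.
move=> e0 C0 H.
have key : (h^-1 *: ((f (h *: (1 : K^o) + z)) - f z)) @[h --> (0 : K^o)^'] --> (d : K^o).
  apply/cvgrPdist_lt => eps eps0.
  have C1 : 0 < C + 1 by rewrite ltr_wpDl.
  near=> h.
  have he : `|h| < e by near: h; exact: dnbhs0_lt.
  have heps : `|h| < eps / (C + 1) by near: h; apply: dnbhs0_lt; rewrite divr_gt0.
  have h0 : h != 0 by near: h; exact: nbhs_dnbhs_neq.
  rewrite /GRing.scale/= mulr1.
  have -> : d - h^-1 * (f (h + z) - f z) = - h^-1 * (f (h + z) - f z - h * d).
    have E (x y : K) : d - h^-1 * (x - y) = - h^-1 * (x - y - h * d) by field.
    exact: E.
  rewrite normrM normrN normfV.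
  apply: (@le_lt_trans _ _ (C * `|h|)).
    rewrite mulrC ler_pdivrMr ?normr_gt0// -mulrA -expr2; exact: H.
  rewrite (le_lt_trans (y := (C + 1) * `|h|))//.
    by rewrite ler_wpM2r// lerDl.
  by rewrite mulrC -ltr_pdivlMr.
split; first by apply/cvg_ex; exists d.
by apply: cvg_lim => //; exact: norm_hausdorff.
Unshelve. all: by end_near. Qed.

Section PowerSeries.
Variable R : realType.
Implicit Types (a : nat -> Cplx R) (z : Cplx R) (r : R).

(** Real and imaginary parts are dominated by the modulus, so completeness of the reals suffices. *)
Lemma series_abs_cvg (u : nat -> Cplx R) :
  cvgn (series (fun k => modulus (u k))) -> cvgn (series u).
Proof.
move=> cu.
have hRe : cvgn (series (fun k => complex.Re (u k))).
  apply: normed_cvg; apply: series_le_cvg cu => n //=.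
  - exact: modulus_ge0.
  - exact: Re_le_modulus.
have hIm : cvgn (series (fun k => complex.Im (u k))).
  apply: normed_cvg; apply: series_le_cvg cu => n //=.
  - exact: modulus_ge0.
  - exact: Im_le_modulus.
have [x hx] := (cvg_ex _).1 hRe.
have [y hy] := (cvg_ex _).1 hIm.
apply/cvg_ex; exists ((x +i* y)%C : Cplx R).
apply: cvg_ReIm.
- suff -> : (fun n => complex.Re (series u n)) = series (fun k => complex.Re (u k)) by [].
  by apply/funext => n; rewrite !seriesEnat/= raddf_sum.
- suff -> : (fun n => complex.Im (series u n)) = series (fun k => complex.Im (u k)) by [].
  by apply/funext => n; rewrite !seriesEnat/= raddf_sum.
Qed.

(** Condition on the coefficients alone that characterises Taylor series on the disc
    ([taylor_abs_conv], [taylor_ps]); it passes to [dcoef], hence to derivatives. *)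
Definition abs_conv a : Prop :=
  forall r, 0 <= r < 1 -> cvgn (series (fun k => modulus (a k) * r ^+ k)).

Definition ps a z : Cplx R := limn (power_series a z).

Definition majorant a r : R := limn (series (fun k => modulus (a k) * r ^+ k)).

Definition dcoef a (k : nat) : Cplx R := k.+1%:R * a k.+1.

Lemma taylor_abs_conv f a : taylor_disc f a -> abs_conv a.
Proof.
move=> fa r /andP[r0 r1].
(* Convergence at a radius s strictly between r and 1 bounds |a_k| s^k, and the powers of r / s then
   give a geometric majorant. *)
pose s := (1 + r) / 2.
have s0 : 0 < s by rewrite /s; lra.
have s1 : s < 1 by rewrite /s; lra.
have rs : r < s by rewrite /s; lra.
have /fa cs : unit_disc (s%:C%C : Cplx R).
  by rewrite unit_discE modulus_real gtr0_norm.
have t0 : a k * (s%:C%C : Cplx R) ^+ k @[k --> \oo] --> (0 : Cplx R).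
  by apply: cvg_series_cvg_0; apply/cvg_ex; exists (f (s%:C%C : Cplx R)).
have b0 : bounded_fun (fun k => modulus (a k) * s ^+ k).
  apply: cvg_seq_bounded; apply/cvg_ex; exists (modulus (0 : Cplx R)).
  have t1 : modulus (a k * (s%:C%C : Cplx R) ^+ k) @[k --> \oo] --> modulus (0 : Cplx R).
    exact: cvg_modulus.
  move: t1.
  suff -> : (fun x => modulus (a x * (s%:C%C : Cplx R) ^+ x)) = (fun k => modulus (a k) * s ^+ k) by [].
  by apply/funext => k; rewrite modulusM modulusX modulus_real gtr0_norm.
have [M [_ hM]] := b0.
have hM1 : forall k, modulus (a k) * s ^+ k <= `|M| + 1.
  move=> k; have := hM (`|M| + 1).
  rewrite (le_lt_trans (ler_norm M)) ?ltrDl// => /(_ isT k I) /=.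
  by apply: le_trans; exact: ler_norm.
apply: (@series_le_cvg _ _ (fun k => (`|M| + 1) * (r / s) ^+ k)).
- by move=> n; rewrite mulr_ge0 ?modulus_ge0 ?exprn_ge0.
- move=> n; apply: mulr_ge0; first exact: addr_ge0.
  by apply: exprn_ge0; apply: divr_ge0 => //; exact: ltW.
- move=> n; rewrite expr_div_n mulrA ler_pdivlMr ?exprn_gt0//.
  by rewrite mulrAC ler_wpM2r ?exprn_ge0.
- apply: is_cvg_geometric_series.
  have /andP[x0 x1] : 0 <= r / s < 1.
    by rewrite divr_ge0 ?(ltW s0)// ltr_pdivrMr// mul1r.
  by rewrite ger0_norm.
Qed.

Lemma modulus_psterm a z n :
  modulus (a n * z ^+ n) = modulus (a n) * modulus z ^+ n.
Proof. by rewrite modulusM modulusX. Qed.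

Lemma cvg_ps a z : abs_conv a -> modulus z < 1 ->
  power_series a z n @[n --> \oo] --> ps a z.
Proof.
move=> ha z1; apply: series_abs_cvg.
have := ha (modulus z); rewrite modulus_ge0 z1 => /(_ isT).
suff -> : (fun k => modulus (a k) * modulus z ^+ k) =
          (fun k => modulus (a k * z ^+ k)) by [].
by apply/funext => k; rewrite modulus_psterm.
Qed.

Lemma taylor_ps a : abs_conv a -> taylor_disc (ps a) a.
Proof. by move=> ha z; rewrite unit_discE => z1; exact: cvg_ps. Qed.

Lemma taylorE f a z : taylor_disc f a -> modulus z < 1 -> f z = ps a z.
Proof.
by move=> fa z1; rewrite /ps (cvgC_lim (fa _ _))// unit_discE.
Qed.

Lemma partial_le_majorant a r n : abs_conv a -> 0 <= r < 1 ->
  \sum_(0 <= k < n) modulus (a k) * r ^+ k <= majorant a r.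
Proof.
move=> ha hr; have cr := ha _ hr; case/andP: hr => r0 r1.
apply: (nondecreasing_cvgn_le _ cr n).
apply/nondecreasing_seqP => m.
by rewrite !seriesEnat/= big_nat_recr//= lerDl mulr_ge0 ?modulus_ge0 ?exprn_ge0.
Qed.

Lemma majorant_ge0 a r : abs_conv a -> 0 <= r < 1 -> 0 <= majorant a r.
Proof. by move=> ha hr; have := partial_le_majorant 0 ha hr; rewrite big_nil. Qed.

(** The bound does not depend on z in |z| <= r; this yields the uniform polynomial approximation in
    [ps_unif]. *)
Lemma ps_tail a z r n : abs_conv a -> r < 1 -> modulus z <= r ->
  modulus (ps a z - \sum_(0 <= k < n) a k * z ^+ k) <=
  majorant a r - \sum_(0 <= k < n) modulus (a k) * r ^+ k.
Proof.
move=> ha r1 zr.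
have r0 : 0 <= r by apply: le_trans zr; exact: modulus_ge0.
have hr : 0 <= r < 1 by rewrite r0.
have cz : (fun m => power_series a z m - \sum_(0 <= k < n) a k * z ^+ k) @ \oo -->
   ps a z - \sum_(0 <= k < n) a k * z ^+ k.
  by apply: cvgB; [apply: cvg_ps => //; exact: le_lt_trans r1|exact: cvg_cst].
apply: (modulus_lim_le cz).
exists n => // m /= nm.
rewrite /power_series seriesEnat /= (big_cat_nat (leq0n n) nm)//= addrAC subrr add0r.
rewrite (le_trans (modulus_sum _ _ _))// lerBrDl.
apply: le_trans (partial_le_majorant m ha hr).
rewrite [leRHS](big_cat_nat (leq0n n) nm)//= lerD2l.
apply: ler_sum => k _; rewrite modulus_psterm ler_wpM2l ?modulus_ge0//.
by rewrite lerXn2r ?nnegrE ?modulus_ge0.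
Qed.

Lemma ps_le_majorant a z r : abs_conv a -> r < 1 -> modulus z <= r ->
  modulus (ps a z) <= majorant a r.
Proof.
by move=> ha r1 zr; have := ps_tail 0 ha r1 zr; rewrite !big_nil !subr0.
Qed.

(** k + 1 copies of x^k are at most 1 + x + ... + x^k, a partial geometric sum. *)
Lemma mulrn_exp_le (x : R) k : 0 <= x < 1 -> k.+1%:R * x ^+ k <= (1 - x)^-1.
Proof.
move=> /andP[x0 x1]; rewrite -[leRHS]mul1r ler_pdivlMr ?subr_gt0//.
have h : k.+1%:R * x ^+ k <= \sum_(i < k.+1) x ^+ i.
  rewrite -[k.+1 in leLHS]card_ord -sumr_const mulr_suml ler_sum// => i _.
  by rewrite mul1r ler_wiXn2l ?(ltW x1)// -ltnS.
apply: (@le_trans _ _ ((\sum_(i < k.+1) x ^+ i) * (1 - x))).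
  by rewrite ler_wpM2r// subr_ge0 ltW.
by rewrite mulrC -opprB mulNr -subrX1 opprB gerBl exprn_ge0.
Qed.

(** Passing from r to a larger radius s < 1 gains (r / s)^n, which absorbs the factor n + 1 by
    [mulrn_exp_le]. *)
Lemma abs_conv_dcoef a : abs_conv a -> abs_conv (dcoef a).
Proof.
move=> ha r /andP[r0 r1].
pose s := (1 + r) / 2.
have s0 : 0 < s by rewrite /s; lra.
have s1 : s < 1 by rewrite /s; lra.
have rs : r < s by rewrite /s; lra.
have x01 : 0 <= r / s < 1 by rewrite divr_ge0 ?(ltW s0)// ltr_pdivrMr// mul1r.
have cs : cvgn (series (fun k => ((1 - r / s)^-1 / s) *: (modulus (a k.+1) * s ^+ k.+1) : R^o)).
  apply: is_cvg_seriesZ.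
  have := ha s; rewrite (ltW s0) s1 => /(_ isT) h.
  have [l hl] := (cvg_ex _).1 h; apply/cvg_ex; exists (l - modulus (a 0%N) * s ^+ 0).
  have -> : series (fun k => modulus (a k.+1) * s ^+ k.+1) =
      (fun n => series (fun k => modulus (a k) * s ^+ k) (n + 1)%N - modulus (a 0%N) * s ^+ 0).
    by apply/funext => n; rewrite !seriesEnat/= addn1 big_nat_recl// addrC addKr.
  by apply: cvgB; [rewrite (cvg_shiftn 1 (series (fun k => modulus (a k) * s ^+ k)))|exact: cvg_cst].
apply: series_le_cvg cs.
- by move=> n; rewrite mulr_ge0 ?modulus_ge0 ?exprn_ge0.
- move=> n; rewrite mulr_ge0// ?mulr_ge0 ?modulus_ge0 ?exprn_ge0 ?invr_ge0 ?(ltW s0)//.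
  by case/andP: x01 => _ ?; rewrite subr_ge0 ltW.
- move=> n; have := mulrn_exp_le n x01.
  rewrite /dcoef modulusM modulus_nat => h.
  rewrite /GRing.scale/= exprS.
  have -> : (1 - r / s)^-1 / s * (modulus (a n.+1) * (s * s ^+ n)) =
     (1 - r / s)^-1 * (modulus (a n.+1) * s ^+ n) by move: (_^-1) => q; field; exact: lt0r_neq0.
  have -> : n.+1%:R * modulus (a n.+1) * r ^+ n =
     (n.+1%:R * (r / s) ^+ n) * (modulus (a n.+1) * s ^+ n).
    by rewrite expr_div_n; field; rewrite expf_neq0// lt0r_neq0.
  by rewrite ler_wpM2r// mulr_ge0 ?modulus_ge0 ?exprn_ge0 ?(ltW s0).
Qed.

(** Induction on the remainder: the next one is (h + z) times the previous one plus (n + 2) h^2 z^(n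
    + 1). The coefficient (n + 2)(n + 1) r^n is the one occurring in the majorant of the second
    derivative. *)
Lemma expr_second_order (z h : Cplx R) r n : modulus z <= r -> modulus (h + z) <= r ->
  modulus ((h + z) ^+ n.+2 - z ^+ n.+2 - n.+2%:R * h * z ^+ n.+1) <=
  modulus h ^+ 2 * ((n.+2%:R * n.+1%:R) * r ^+ n).
Proof.
move=> zr hzr; have r0 : 0 <= r by apply: le_trans zr; exact: modulus_ge0.
elim: n => [|n IH].
  have -> : (h + z) ^+ 2 - z ^+ 2 - 2 * h * z ^+ 1 = h ^+ 2 by ring.
  rewrite modulusX expr0 !mulr1 ler_peMr ?exprn_ge0 ?modulus_ge0// ler1n//.
have -> : (h + z) ^+ n.+3 - z ^+ n.+3 - n.+3%:R * h * z ^+ n.+2 =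
   (h + z) * ((h + z) ^+ n.+2 - z ^+ n.+2 - n.+2%:R * h * z ^+ n.+1) +
   n.+2%:R * h ^+ 2 * z ^+ n.+1.
  by rewrite !exprS -[n.+3%:R]natr1; ring.
rewrite (le_trans (modulusD _ _))// !modulusM modulus_nat !modulusX.
have h1 : modulus (h + z) * modulus ((h + z) ^+ n.+2 - z ^+ n.+2 - n.+2%:R * h * z ^+ n.+1) <=
   r * (modulus h ^+ 2 * ((n.+2%:R * n.+1%:R) * r ^+ n)).
  by rewrite ler_pM ?modulus_ge0.
have h2 : n.+2%:R * modulus h ^+ 2 * modulus z ^+ n.+1 <= n.+2%:R * modulus h ^+ 2 * r ^+ n.+1.
  by rewrite ler_wpM2l ?mulr_ge0 ?exprn_ge0 ?modulus_ge0// lerXn2r ?nnegrE ?modulus_ge0.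
apply: le_trans (lerD h1 h2) _.
have -> : r * (modulus h ^+ 2 * (n.+2%:R * n.+1%:R * r ^+ n)) + n.+2%:R * modulus h ^+ 2 * r ^+ n.+1 =
  modulus h ^+ 2 * (n.+2%:R * n.+2%:R * r ^+ n.+1).
  by rewrite -(natr1 n.+1) (exprS r n); ring.
rewrite ler_wpM2l ?exprn_ge0 ?modulus_ge0// ler_wpM2r ?exprn_ge0//.
by rewrite ler_wpM2r// ler_nat.
Qed.

Lemma taylor_second_order f a z : taylor_disc f a -> modulus z < 1 ->
  exists e C : R, [/\ 0 < e, 0 <= C & forall h : Cplx R, modulus h < e ->
   modulus (h + z) < 1 /\
   modulus (f (h + z) - f z - h * ps (dcoef a) z) <= C * modulus h ^+ 2].
Proof.
move=> fa z1; have ha := taylor_abs_conv fa.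
have hd := abs_conv_dcoef ha; have hdd := abs_conv_dcoef hd.
pose r := (1 + modulus z) / 2.
have zr : modulus z < r by rewrite /r; lra.
have r1 : r < 1 by rewrite /r; lra.
have r0 : 0 <= r by apply: le_trans (ltW zr); exact: modulus_ge0.
have r01 : 0 <= r < 1 by rewrite r0.
exists (r - modulus z), (majorant (dcoef (dcoef a)) r); split.
- by rewrite subr_gt0.
- exact: majorant_ge0.
move=> h hh.
have hzr : modulus (h + z) <= r.
  by rewrite (le_trans (modulusD _ _))// -lerBrDr ltW.
have hz1 : modulus (h + z) < 1 by exact: le_lt_trans r1.
split=> //.
pose u n := power_series a (h + z) n.+2 - power_series a z n.+2
            - h * power_series (dcoef a) z n.+1.
have cu : u @ \oo --> f (h + z) - f z - h * ps (dcoef a) z.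
  apply: cvgB; first apply: cvgB.
  - have : unit_disc (h + z) by rewrite unit_discE.
    by move/fa; rewrite -(cvg_shiftn 2); under eq_fun do rewrite addn2.
  - have : unit_disc z by rewrite unit_discE.
    by move/fa; rewrite -(cvg_shiftn 2); under eq_fun do rewrite addn2.
  - apply: cvgMr.
    by have := cvg_ps hd z1; rewrite -(cvg_shiftn 1); under eq_fun do rewrite addn1.
apply: (modulus_lim_le cu); near=> n.
(* The terms of degree 0 and 1 cancel, hence the shifts by 2 and by 1 in [u]. *)
have -> : u n = \sum_(0 <= k < n) a k.+2 *
    ((h + z) ^+ k.+2 - z ^+ k.+2 - k.+2%:R * h * z ^+ k.+1).
  rewrite /u /power_series !seriesEnat/=.
  rewrite !(big_nat_recl _ _ _ (leq0n _)) /=.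
  under [in RHS]eq_bigr do rewrite !mulrBr.
  rewrite !sumrB [X in _ - X = _]mulrDr.
  have -> : h * (\sum_(0 <= i < n) dcoef a i.+1 * z ^+ i.+1) =
     \sum_(0 <= i < n) a i.+2 * (i.+2%:R * h * z ^+ i.+1).
    by rewrite mulr_sumr; apply: eq_bigr => i _; rewrite /dcoef; ring.
  by rewrite /dcoef !expr0 !expr1 !mulr1 !mul1r; ring.
rewrite (le_trans (modulus_sum _ _ _))//.
apply: (@le_trans _ _ (modulus h ^+ 2 * \sum_(0 <= k < n) modulus (dcoef (dcoef a) k) * r ^+ k)).
  rewrite mulr_sumr ler_sum// => k _.
  rewrite modulusM /dcoef !modulusM !modulus_nat.
  have := expr_second_order k (ltW zr) hzr.
  move/(ler_wpM2l (modulus_ge0 (a k.+2))) => /le_trans; apply.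
  by rewrite le_eqVlt; apply/orP; left; apply/eqP; ring.
rewrite mulrC ler_wpM2r ?exprn_ge0 ?modulus_ge0//.
exact: partial_le_majorant.
Unshelve. all: by end_near. Qed.

Lemma taylor_derive f a z : taylor_disc f a -> modulus z < 1 ->
  derivable f z 1 /\ derive1 f z = ps (dcoef a) z.
Proof.
move=> fa z1; have [e [C [e0 C0 H]]] := taylor_second_order fa z1.
have D : is_derive z (1 : Cplx R) f (ps (dcoef a) z).
  apply: (@is_derive_quadratic _ f z _ C%:C%C e%:C%C).
  - by rewrite ltcR.
  - by rewrite lecR.
  - move=> h; rewrite !normc_modulus ltcR => /H[_].
    by rewrite -rmorphXn/= -rmorphM/= lecR.
by split; [exact: ex_derive|rewrite derive1E; exact: derive_val].
Qed.

(** Mean value inequality for a complex-valued function. The scalar product with the increment D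
    gives a real function phi with phi y - phi x = |D|^2, and the real mean value theorem bounds
    this by |D| M (y - x). *)
Lemma modulus_increment f a (x y M : R) : taylor_disc f a -> 0 <= x -> x <= y -> y < 1 ->
  (forall t, x <= t <= y -> modulus (ps (dcoef a) t%:C%C) <= M) ->
  modulus (f y%:C%C - f x%:C%C) <= M * (y - x).
Proof.
move=> fa x0 xy y1 HM.
set D : Cplx R := f y%:C%C - f x%:C%C.
pose phi (t : R) : R := complex.Re (conjc D * f t%:C%C).
pose dphi (t : R) : R := complex.Re (conjc D * ps (dcoef a) t%:C%C).
have dD (t : R) : x <= t <= y -> is_derive t 1 phi (dphi t).
  move=> /andP[xt ty].
  have t1 : modulus (t%:C%C : Cplx R) < 1.
    by rewrite modulus_real ger0_norm ?(le_trans x0)// (le_lt_trans ty).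
  have [e [C [e0 C0 H]]] := taylor_second_order fa t1.
  apply: (@is_derive_quadratic _ phi t _ (modulus (conjc D : Cplx R) * C) e) => //.
    by rewrite mulr_ge0 ?modulus_ge0.
  move=> h he; have /H[_] : modulus (h%:C%C : Cplx R) < e by rewrite modulus_real.
  rewrite modulus_real => hq.
  have -> : phi (h + t) - phi t - h * dphi t =
    complex.Re (conjc D * (f (h%:C%C + t%:C%C) - f t%:C%C - h%:C%C * ps (dcoef a) t%:C%C)).
    rewrite /phi /dphi; move: (conjc D : Cplx R) => D'.
    rewrite !mulrBr !raddfB/= rmorphD/=; congr (_ - _).
    by rewrite mulrCA; case: (D' * ps _ _) => u v; simpc.
  rewrite (le_trans (Re_le_modulus _))// modulusM -mulrA.
  by rewrite ler_wpM2l ?modulus_ge0.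
have [c cxy] : exists2 c, c \in `[x, y] & phi y - phi x = dphi c * (y - x).
  apply: MVT_segment => //.
    by move=> t; rewrite in_itv/= => /andP[/ltW xt /ltW ty]; apply: dD; rewrite xt.
  apply: derivable_within_continuous => t; rewrite in_itv/= => tt.
  by have [] := dD t tt.
have ReJ (w : Cplx R) : complex.Re (conjc w * w) = complex.Re w ^+ 2 + complex.Im w ^+ 2.
  by case: w => u v /=; rewrite mulNr opprK -!expr2.
have mJ (w : Cplx R) : modulus (conjc w : Cplx R) = modulus w.
  by rewrite !modulus_def; case: w => u v /=; rewrite sqrrN.
have -> : phi y - phi x = modulus D ^+ 2.
  rewrite /phi -raddfB/= -mulrBr -/D modulus_sqr ReJ//.
move=> E.
have [D0|D0] := eqVneq (modulus D) 0.
  rewrite D0 mulr_ge0 ?subr_ge0// (le_trans _ (HM x _))// ?modulus_ge0//.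
  by rewrite lexx.
have Dp : 0 < modulus D by rewrite lt_def D0 modulus_ge0.
rewrite -(ler_pM2l Dp) -expr2 E mulrA ler_wpM2r ?subr_ge0//.
rewrite /dphi (le_trans (ler_norm _))// (le_trans (Re_le_modulus _))//.
rewrite modulusM mJ ler_wpM2l ?modulus_ge0// HM//.
Qed.

End PowerSeries.

(** * Plane measure and sub-mean value estimates *)

Section MeasurePreserving.
Context d (T : measurableType d) (R : realType) (m : {measure set T -> \bar R}).

(** Names the pushforward together with its measure structure, so that uniqueness theorems for
    measures apply to it. *)
Definition image_measure (f : T -> T) (mf : measurable_fun setT f) :
    {measure set T -> \bar R} :=
  measure_function_pushforward__canonical__measure_function_Measure m mf.

Definition mpreserving (phi : T -> T) : Prop :=
  measurable_fun setT phi /\ forall A, measurable A -> m (phi @^-1` A) = m A.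

Lemma mpreserving_comp phi psi : mpreserving phi -> mpreserving psi ->
  mpreserving (phi \o psi).
Proof.
move=> [m1 h1] [m2 h2]; split; first exact: measurableT_comp.
move=> A mA; rewrite comp_preimage h2 ?h1//.
by rewrite -[X in measurable X]setTI; exact: m1.
Qed.

Lemma mpreserving_integral phi (D : set T) (f : T -> \bar R) :
  mpreserving phi -> measurable D -> measurable_fun D f ->
  (forall x, D x -> 0 <= f x)%E ->
  (\int[m]_(x in phi @^-1` D) f (phi x) = \int[m]_(x in D) f x)%E.
Proof.
move=> [mphi h] mD mf f0.
transitivity (\int[image_measure mphi]_(x in D) f x)%E.
  apply/esym; apply: ge0_integral_pushforward => //.
  by move=> x /set_mem; exact: f0.
by apply: eq_measure_integral => A mA _; exact: h.
Qed.

End MeasurePreserving.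

Definition plane (R : realType) : measurableType _ :=
  (measurableTypeR R * measurableTypeR R)%type.

(* Locked, since unification otherwise unfolds the product measure. *)
HB.lock Definition lam2 (R : realType) : {measure set (plane R) -> \bar R} :=
  (@lebesgue_measure R \x @lebesgue_measure R)%E.

Section PlaneMeasure.
Variable R : realType.
Local Notation leb := (@lebesgue_measure R).
Local Notation leb2 := (@lam2 R).
Local Notation line := (measurableTypeR R).
Local Notation plane := (plane R).
Local Open Scope ereal_scope.

Lemma lam2E (A : set plane) : leb2 A = (leb \x leb) A.
Proof. by rewrite unlock. Qed.

(** The image measure takes the right values on half-open intervals, and these determine Lebesgue
    measure; [lebesgue_measure_scale] follows the same way. *)
Lemma lebesgue_measure_shift (c : R) (A : set line) : measurable A ->
  leb ((fun x : line => x + c : line)%R @^-1` A) = leb A.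
Proof.
have mf : measurable_fun [set: line] (fun x : line => x + c : line)%R.
  exact: measurable_funD.
move=> mA; rewrite -[LHS]/(image_measure leb mf A).
apply/esym/lebesgue_measure_unique => //= _ [[a b]] _ <-.
rewrite /pushforward.
have -> : (fun x : line => x + c : line)%R @^-1` `](a, b).1, (a, b).2]%classic =
   `](a - c)%R, (b - c)%R]%classic.
  by apply/seteqP; split => x; rewrite /= !in_itv/= ltrBlDr lerBrDr.
rewrite !lebesgue_measure_itv/= !lte_fin ltrD2r.
by case: ifPn => // _; rewrite -!EFinD; congr EFin; ring.
Qed.

Lemma lebesgue_measure_scale (s : R) (A : set line) : (0 < s)%R -> measurable A ->
  s%:E * leb ((fun x : line => s * x : line)%R @^-1` A) = leb A.
Proof.
move=> s0.
have mf : measurable_fun [set: line] (fun x : line => s * x : line)%R.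
  exact: measurable_funM.
move=> mA.
rewrite -[LHS]/(mscale (NngNum (ltW s0)) (image_measure leb mf) A).
apply/esym/lebesgue_measure_unique => //= _ [[a b]] _ <-.
rewrite /mscale/= /pushforward.
have -> : (fun x : line => s * x : line)%R @^-1` `](a, b).1, (a, b).2]%classic =
   `](a / s)%R, (b / s)%R]%classic.
  apply/seteqP; split => x; rewrite /= !in_itv/=.
    by rewrite ltr_pdivrMr// ler_pdivlMr// mulrC.
  by rewrite ltr_pdivrMr// ler_pdivlMr// mulrC.
rewrite !lebesgue_measure_itv/= !lte_fin ltr_pM2r ?invr_gt0//.
case: ifPn => [_|_]; last by rewrite mule0.
by rewrite -!EFinD -EFinM; congr EFin; field; rewrite gt_eqF.
Qed.

Lemma mpreserving_translation (c d : R) :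
  mpreserving leb2 (fun x : plane => ((x.1 + c)%R, (x.2 + d)%R) : plane).
Proof.
have mf : measurable_fun [set: plane] (fun x : plane => ((x.1 + c)%R, (x.2 + d)%R) : plane).
  apply/measurable_fun_pairP; split => /=.
  - by apply: measurable_funD => //; exact: measurable_fst.
  - by apply: measurable_funD => //; exact: measurable_snd.
split=> // A mA.
rewrite -[LHS]/(image_measure leb2 mf A) [RHS]lam2E.
apply/esym; apply: product_measure_unique => // B C mB mC.
rewrite /= /pushforward.
rewrite -(lebesgue_measure_shift c mB) -(lebesgue_measure_shift d mC).
have -> : (fun x : plane => ((x.1 + c)%R, (x.2 + d)%R) : plane) @^-1` (B `*` C) =
  ((fun x : line => x + c : line)%R @^-1` B) `*` ((fun x : line => x + d : line)%R @^-1` C).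
  by [].
have mp (e : R) (E : set line) : measurable E -> measurable ((fun x : line => x + e : line)%R @^-1` E).
  move=> mE; rewrite -[X in measurable X]setTI.
  have mfe : measurable_fun [set: line] (fun x : line => x + e : line)%R by exact: measurable_funD.
  exact: mfe.
by rewrite lam2E product_measure1E//; exact: mp.
Qed.

Lemma mpreserving_swap : mpreserving leb2 (fun x : plane => (x.2, x.1) : plane).
Proof.
have mf : measurable_fun [set: plane] (fun x : plane => (x.2, x.1) : plane).
  by apply/measurable_fun_pairP; split => /=; [exact: measurable_snd|exact: measurable_fst].
split=> // A mA.
rewrite -[LHS]/(image_measure leb2 mf A) [RHS]lam2E.
apply/esym; apply: product_measure_unique => // B C mB mC.
rewrite /= /pushforward.
have -> : (fun x : plane => (x.2, x.1) : plane) @^-1` (B `*` C) = C `*` B.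
  by apply/seteqP; split => -[x y] [].
by rewrite lam2E product_measure1E// muleC.
Qed.

(** Shears do not preserve rectangles, so the argument goes through sections: each vertical section
    is translated by t x, and the integrand of the product measure is unchanged. *)
Lemma mpreserving_vshear (t : R) :
  mpreserving leb2 (fun x : plane => (x.1, (x.2 + t * x.1)%R) : plane).
Proof.
have mf : measurable_fun [set: plane] (fun x : plane => (x.1, (x.2 + t * x.1)%R) : plane).
  apply/measurable_fun_pairP; split => /=; first exact: measurable_fst.
  apply: measurable_funD; first exact: measurable_snd.
  by apply: measurable_funM => //; exact: measurable_fst.
split=> // A mA.
rewrite !lam2E /product_measure1; apply: eq_integral => x _ /=.
rewrite -[RHS](lebesgue_measure_shift (t * x)); last exact: measurable_xsection.
congr (leb _); apply/seteqP; split => y; rewrite /xsection/= !inE//.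
Qed.

Lemma mpreserving_hshear (t : R) :
  mpreserving leb2 (fun x : plane => ((x.1 + t * x.2)%R, x.2) : plane).
Proof.
exact: (mpreserving_comp mpreserving_swap (mpreserving_comp (mpreserving_vshear t) mpreserving_swap)).
Qed.

(* A rotation is a product of three shears; the half-turn is excluded because
   the shears involve s / (1 + c). *)
Lemma mpreserving_rotation (c s : R) : (c ^+ 2 + s ^+ 2 = 1)%R -> c != (- 1)%R ->
  mpreserving leb2 (fun x : plane => ((c * x.1 - s * x.2)%R, (c * x.2 + s * x.1)%R) : plane).
Proof.
move=> cs c1; have c10 : (1 + c)%R != 0%R.
  by apply: contra c1 => /eqP h; apply/eqP; lra.
(* The tangent of half the rotation angle. *)
pose t := (s / (1 + c))%R.
have st : (s * t = 1 - c)%R.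
  have -> : (s * t = s ^+ 2 / (1 + c))%R by rewrite /t; field.
  have -> : (s ^+ 2 = (1 - c) * (1 + c))%R by rewrite -subr_sqr expr1n -cs addrAC subrr add0r.
  by rewrite mulfK.
have tc : (t * (1 + c) = s)%R by rewrite /t mulfVK.
have := mpreserving_comp (mpreserving_hshear (- t))
   (mpreserving_comp (mpreserving_vshear s) (mpreserving_hshear (- t))).
suff -> : (fun x : plane => ((c * x.1 - s * x.2)%R, (c * x.2 + s * x.1)%R) : plane) =
  (fun x : plane => ((x.1 + - t * x.2)%R, x.2) : plane) \o
  ((fun x : plane => (x.1, (x.2 + s * x.1)%R) : plane) \o
   (fun x : plane => ((x.1 + - t * x.2)%R, x.2) : plane)) by [].
apply/funext => -[x y] /=.
have E2 : (y + s * (x + - t * y) = c * y + s * x)%R.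
  by rewrite mulrDr mulNr mulrN mulrA st; ring.
rewrite E2; congr pair.
have -> : (x + - t * y + - t * (c * y + s * x) = (1 - s * t) * x - t * (1 + c) * y)%R by ring.
by rewrite st tc; ring.
Qed.

Lemma leb2_scale (s : R) (A : set plane) : (0 < s)%R -> measurable A ->
  (s ^+ 2)%:E * leb2 ((fun x : plane => ((s * x.1)%R, (s * x.2)%R) : plane) @^-1` A) = leb2 A.
Proof.
move=> s0 mA.
have s20 : (0 < s ^+ 2)%R by rewrite exprn_gt0.
have mf : measurable_fun [set: plane] (fun x : plane => ((s * x.1)%R, (s * x.2)%R) : plane).
  apply/measurable_fun_pairP; split => /=.
  - by apply: measurable_funM => //; exact: measurable_fst.
  - by apply: measurable_funM => //; exact: measurable_snd.
rewrite -[LHS]/(mscale (NngNum (ltW s20)) (image_measure leb2 mf) A) [RHS]lam2E.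
apply/esym; apply: product_measure_unique => // B C mB mC.
rewrite -[LHS]/((s ^+ 2)%:E * leb2 ((fun x : plane => ((s * x.1)%R, (s * x.2)%R) : plane) @^-1` (B `*` C))).
have -> : (fun x : plane => ((s * x.1)%R, (s * x.2)%R) : plane) @^-1` (B `*` C) =
  ((fun x : line => s * x : line)%R @^-1` B) `*` ((fun x : line => s * x : line)%R @^-1` C).
  by [].
have mp (E : set line) : measurable E -> measurable ((fun x : line => s * x : line)%R @^-1` E).
  move=> mE; rewrite -[X in measurable X]setTI.
  have mfe : measurable_fun [set: line] (fun x : line => s * x : line)%R by exact: measurable_funM.
  exact: mfe.
rewrite lam2E product_measure1E; [|exact: mp|exact: mp].
transitivity ((s%:E * leb ((fun x : line => s * x : line)%R @^-1` B)) *
              (s%:E * leb ((fun x : line => s * x : line)%R @^-1` C))).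
  by rewrite expr2 EFinM muleACA.
by rewrite !lebesgue_measure_scale.
Qed.

(** A nonempty section lies in [y0 - e, y0 + e] for any of its points y0; this length 2e is
    integrated over an interval of length 2d. *)
Lemma leb2_section_le (A : set plane) (c d e : R) : measurable A -> (0 <= d)%R -> (0 <= e)%R ->
  (forall x y, A (x, y) -> `|x - c| <= d)%R ->
  (forall x y y', A (x, y) -> A (x, y') -> `|y - y'| <= e)%R ->
  leb2 A <= (4 * d * e)%:E.
Proof.
move=> mA d0 e0 hx hy.
rewrite lam2E -[leLHS]/(\int[leb]_x (leb \o xsection A) x).
have -> : \int[leb]_x (leb \o xsection A) x =
   \int[leb]_(x in `[(c - d)%R, (c + d)%R]) (leb \o xsection A) x.
  rewrite [RHS]integral_mkcond; apply: eq_integral => x _.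
  rewrite /patch; case: ifPn => //; rewrite notin_setE/= in_itv/= => hn.
  have -> : xsection A x = set0.
    rewrite -subset0 => y; rewrite /xsection/= inE => /hx.
    by rewrite ler_distl.
  by rewrite measure0.
apply: (@le_trans _ _ (\int[leb]_(x in `[(c - d)%R, (c + d)%R]) (2 * e)%:E)).
  apply: ge0_le_integral => //=.
  - apply: measurable_funTS; exact: measurable_fun_xsection.
  - move=> x _; have [->|/set0P[y0 Ay0]] := eqVneq (xsection A x) set0.
      by rewrite measure0 lee_fin mulr_ge0.
    apply: (@le_trans _ _ (leb `[(y0 - e)%R, (y0 + e)%R])).
      apply: le_measure; rewrite ?inE//; first exact: measurable_xsection.
      move=> y; rewrite /xsection/= in_itv/= -ler_distl !inE => Ay.
      by move: Ay0; rewrite /xsection/= inE => /(hy _ _ _ Ay).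
    rewrite lebesgue_measure_itv/= lte_fin; case: ifPn => _.
      by rewrite -EFinD lee_fin le_eqVlt; apply/orP; left; apply/eqP; ring.
    by rewrite lee_fin mulr_ge0.
rewrite integral_cst//= lebesgue_measure_itv/= lte_fin; case: ifPn => _.
  by rewrite -EFinD -EFinM lee_fin le_eqVlt; apply/orP; left; apply/eqP; ring.
by rewrite mule0 lee_fin !mulr_ge0.
Qed.

End PlaneMeasure.

(** * Roots of unity and discrete orthogonality *)

Section UnitRoots.
Variable R : realType.
Implicit Types (z w : Cplx R).

(** X^n - 1 splits with n distinct roots, and n distinct n-th roots of unity in a field include a
    primitive one. *)
Lemma exists_prim_root n : (0 < n)%N -> exists w : R[i], n.-primitive_root w.
Proof.
move=> n0; pose p : {poly R[i]} := 'X^n - 1.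
have [r Dp] := closed_field_poly_normal p.
rewrite (monicP _) ?monicXnsubC // scale1r in Dp.
have rn1 : all n.-unity_root r by apply/allP=> z; rewrite -root_prod_XsubC -Dp.
have sz_r : (n < (size r).+1)%N.
  by rewrite -(size_prod_XsubC r id) -Dp size_XnsubC.
have [|z] := hasP (has_prim_root n0 rn1 _ sz_r); last by exists z.
by rewrite -separable_prod_XsubC -Dp separable_Xn_sub_1 // pnatr_eq0 -lt0n.
Qed.

Lemma unit_root_modulus z n : (0 < n)%N -> z ^+ n = 1 -> modulus z = 1.
Proof.
move=> n0 zn; have : modulus z ^+ n == 1 by rewrite -modulusX zn modulus1.
by rewrite pexpr_eq1 ?modulus_ge0// => /eqP.
Qed.

Lemma sum_unit_root z n : z ^+ n = 1 -> z != 1 -> \sum_(l < n) z ^+ l = 0.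
Proof.
move=> zn z1; have := subrX1 z n; rewrite zn subrr => /esym/eqP.
by rewrite mulf_eq0 subr_eq0 (negbTE z1)/= => /eqP.
Qed.

(* Averaging over roots of unity replaces integration in polar coordinates. *)
Lemma poly_root_average (p : {poly R[i]}) n (w z : R[i]) : n.-primitive_root w ->
  (size p <= n)%N -> \sum_(l < n) p.[w ^+ l * z] = n%:R * p`_0.
Proof.
move=> wn pn; have n0 := prim_order_gt0 wn.
transitivity (\sum_(l < n) \sum_(k < n) p`_k * z ^+ k * (w ^+ k) ^+ l).
  apply: eq_bigr => l _; rewrite (horner_coef_wide _ pn).
  by apply: eq_bigr => k _; rewrite exprMn -!exprM mulnC -!mulrA (mulrC (z ^+ k)).
rewrite exchange_big/= (bigD1 (Ordinal n0))//= [X in _ + X]big1 ?addr0.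
  rewrite -mulr_sumr expr0 mulr1; under eq_bigr do rewrite expr1n.
  by rewrite sumr_const card_ord mulrC.
move=> k k0; rewrite -mulr_sumr (@sum_unit_root (w ^+ k)) ?mulr0//.
- by rewrite exprAC (prim_expr_order wn) expr1n.
- rewrite -(expr0 w) (eq_prim_root_expr wn) mod0n modn_small//.
Qed.

(** The cross terms j != k are sums over l of (w^(j - k))^l. They vanish because j and k are below
    n, so w^j and w^k differ. *)
Lemma poly_parseval (p : {poly R[i]}) n (w z : R[i]) : n.-primitive_root w ->
  (size p <= n)%N ->
  \sum_(l < n) modulus (p.[w ^+ l * z]) ^+ 2 =
  n%:R * \sum_(k < n) modulus p`_k ^+ 2 * modulus z ^+ k.*2.
Proof.
move=> wn pn; have n0 := prim_order_gt0 wn.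
have w1 := unit_root_modulus n0 (prim_expr_order wn).
have sqrE (x : R[i]) : ((modulus x ^+ 2)%:C)%C = x * conjc x.
  by rewrite rmorphXn/= -normc_modulus sqr_normc.
have wJ k : w ^+ k * conjc (w ^+ k) = 1.
  by rewrite -sqrE modulusX w1 !expr1n.
apply: complexI; rewrite rmorphM/= !rmorph_sum/= rmorph_nat.
transitivity (\sum_(l < n) \sum_(j < n) \sum_(k < n)
   p`_j * conjc p`_k * z ^+ j * conjc (z ^+ k) * (w ^+ j * conjc (w ^+ k)) ^+ l).
  apply: eq_bigr => l _; rewrite sqrE (horner_coef_wide _ pn) rmorph_sum/= mulr_suml.
  apply: eq_bigr => j _; rewrite mulr_sumr; apply: eq_bigr => k _.
  rewrite !exprMn !rmorphM/= -!rmorphXn/= -!exprM [(l * j)%N]mulnC [(l * k)%N]mulnC.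
  ring.
rewrite exchange_big/= mulr_sumr; apply: eq_bigr => j _.
rewrite exchange_big/= (bigD1 j)//= [X in _ + X]big1 ?addr0.
  rewrite -mulr_sumr wJ; under eq_bigr do rewrite expr1n.
  have zE : ((modulus z ^+ j.*2)%:C)%C = z ^+ j * conjc (z ^+ j).
    by rewrite -muln2 exprM -modulusX sqrE.
  by rewrite sumr_const card_ord rmorphM/= sqrE zE; ring.
move=> k kj; rewrite -mulr_sumr (@sum_unit_root (w ^+ j * conjc (w ^+ k))) ?mulr0//.
- rewrite exprMn -rmorphXn/= -!exprM ![(_ * n)%N]mulnC !exprM (prim_expr_order wn).
  by rewrite !expr1n rmorph1 mulr1.
- apply: contra kj => /eqP h.
  have : w ^+ j == w ^+ k.
    by apply/eqP; rewrite -[LHS]mulr1 -(wJ k) mulrCA h mulr1.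
  by rewrite (eq_prim_root_expr wn) !modn_small// => /eqP jk; apply/eqP/val_inj.
Qed.

End UnitRoots.

(** * Measurable complex functions on the plane, rotation of discs *)

Section PlaneComplex.
Variable R : realType.
Local Notation plane := (plane R).
Local Notation lam2 := (@lam2 R).
Implicit Types (z c : Cplx R) (r : R) (D : set plane).

Definition toC (w : plane) : Cplx R := (w.1 +i* w.2)%C.

(** Measurability is stated on the two coordinates, so that products, polynomials and pointwise
    limits reduce to real measurable functions. *)
Definition measC D (h : plane -> Cplx R) : Prop :=
  measurable_fun D (fun w => complex.Re (h w)) /\
  measurable_fun D (fun w => complex.Im (h w)).

Lemma measC_cst D z : measC D (fun=> z).
Proof. by split; exact: measurable_cst. Qed.

Lemma measC_toC D : measC D toC.
Proof.
by split; apply: measurable_funTS; [exact: measurable_fst|exact: measurable_snd].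
Qed.

Lemma measCD D f g : measC D f -> measC D g -> measC D (fun w => f w + g w).
Proof.
move=> [f1 f2] [g1 g2]; split.
- under eq_fun do rewrite raddfD/=; exact: measurable_funD.
- under eq_fun do rewrite raddfD/=; exact: measurable_funD.
Qed.

Lemma measCM D f g : measC D f -> measC D g -> measC D (fun w => f w * g w).
Proof.
move=> [f1 f2] [g1 g2].
have E1 w : complex.Re (f w * g w) = complex.Re (f w) * complex.Re (g w) - complex.Im (f w) * complex.Im (g w).
  by case: (f w) => ? ?; case: (g w).
have E2 w : complex.Im (f w * g w) = complex.Re (f w) * complex.Im (g w) + complex.Im (f w) * complex.Re (g w).
  by case: (f w) => ? ?; case: (g w).
split.
- by under eq_fun do rewrite E1; apply: measurable_funB; exact: measurable_funM.
- by under eq_fun do rewrite E2; apply: measurable_funD; exact: measurable_funM.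
Qed.

Lemma measCX D f n : measC D f -> measC D (fun w => f w ^+ n).
Proof.
move=> mf; elim: n => [|n IH]; first by under eq_fun do rewrite expr0; exact: measC_cst.
by under eq_fun do rewrite exprS; exact: measCM.
Qed.

Lemma measC_sum D (n : nat) (f : nat -> plane -> Cplx R) :
  (forall k, measC D (f k)) -> measC D (fun w => \sum_(0 <= k < n) f k w).
Proof.
move=> mf; elim: n => [|n IH].
  by under eq_fun do rewrite big_nil; exact: measC_cst.
by under eq_fun do rewrite big_nat_recr//=; exact: measCD.
Qed.

Lemma measC_horner D (p : {poly R[i]}) (f : plane -> Cplx R) :
  measC D f -> measC D (fun w => p.[f w]).
Proof.
move=> mf; under eq_fun do rewrite horner_coef -(big_mkord xpredT (fun k => p`_k * f _ ^+ k)).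
by apply: measC_sum => k; apply: measCM; [exact: measC_cst|exact: measCX].
Qed.

Lemma measC_lim D (f : nat -> plane -> Cplx R) (g : plane -> Cplx R) :
  (forall k, measC D (f k)) -> (forall w, D w -> f n w @[n --> \oo] --> g w) -> measC D g.
Proof.
move=> mf fg; split.
- apply: (@measurable_fun_cvg _ _ _ _ (fun n w => complex.Re (f n w))).
    by move=> m; case: (mf m).
  by move=> w Dw; apply: cvg_Re; exact: fg.
- apply: (@measurable_fun_cvg _ _ _ _ (fun n w => complex.Im (f n w))).
    by move=> m; case: (mf m).
  by move=> w Dw; apply: cvg_Im; exact: fg.
Qed.

Lemma measC_modulus D f : measC D f -> measurable_fun D (fun w => modulus (f w)).
Proof.
move=> [f1 f2]; under eq_fun do rewrite modulus_def.
apply: (@measurableT_comp _ _ _ _ _ _ (@Num.sqrt R)).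
  by apply: continuous_measurable_fun; exact: sqrt_continuous.
by apply: measurable_funD; exact: measurable_funX.
Qed.

Lemma measurable_modulus_toC z D : measurable_fun D (fun w => modulus (toC w - z)).
Proof. by apply: measC_modulus; apply: measCD; [exact: measC_toC|exact: measC_cst]. Qed.

Definition disc z r : set plane := [set w | modulus (toC w - z) < r].

Lemma measurable_disc z r : measurable (disc z r).
Proof.
have -> : disc z r = [set: plane] `&` (fun w => modulus (toC w - z)) @^-1` `]-oo, r[.
  by apply/seteqP; split => w; rewrite /disc/= in_itv/= => // -[].
by apply: measurable_modulus_toC.
Qed.

Lemma disc0E r (w : plane) : disc (0 : Cplx R)%R r w = (modulus (toC w) < r) :> Prop.
Proof. by rewrite /disc/= subr0. Qed.

(** Multiplication by [u] in real coordinates maps the disc onto itself; [u != -1] excludes the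
    half-turn, as in [mpreserving_rotation]. *)
Lemma disc_rotation u r (G : plane -> \bar R) : modulus u = 1 -> u != -1 ->
  measurable_fun (disc (0 : Cplx R)%R r) G -> (forall w, 0 <= G w)%E ->
  (\int[lam2]_(w in disc (0 : Cplx R)%R r)
     G ((complex.Re u * w.1 - complex.Im u * w.2)%R, (complex.Re u * w.2 + complex.Im u * w.1)%R)
   = \int[lam2]_(w in disc (0 : Cplx R)%R r) G w)%E.
Proof.
move=> u1 un1 mG G0.
have cs : complex.Re u ^+ 2 + complex.Im u ^+ 2 = 1 by rewrite -modulus_sqr u1 expr1n.
have c1 : complex.Re u != -1.
  apply: contra un1 => /eqP c1; move: cs; rewrite c1 sqrrN expr1n => h.
  have : complex.Im u ^+ 2 = 0 by lra.
  move/eqP; rewrite sqrf_eq0 => /eqP i0.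
  by apply/eqP; case: u u1 c1 h i0 => a b _ /= -> _ ->; rewrite -[RHS]/((-1) +i* (- 0))%C oppr0.
rewrite -[RHS](mpreserving_integral (mpreserving_rotation cs c1) (measurable_disc (0 : Cplx R)%R r) mG); last first.
  by move=> *.
congr (integral _ _ _).
apply/seteqP; split => w; rewrite disc0E => h.
- rewrite /preimage/= disc0E.
  suff -> : toC ((complex.Re u * w.1 - complex.Im u * w.2)%R, (complex.Re u * w.2 + complex.Im u * w.1)%R) = u * toC w.
    by rewrite modulusM u1 mul1r.
  by rewrite /toC; case: u {u1 un1 cs c1} => a b; simpc; rewrite /= (addrC (a * w.2)).
- move: h; rewrite /preimage/= disc0E.
  suff -> : toC ((complex.Re u * w.1 - complex.Im u * w.2)%R, (complex.Re u * w.2 + complex.Im u * w.1)%R) = u * toC w.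
    by rewrite modulusM u1 mul1r.
  by rewrite /toC; case: u {u1 un1 cs c1} => a b; simpc; rewrite /= (addrC (a * w.2)).
Qed.

End PlaneComplex.

(** * Sub-mean value property and Bessel's inequality on discs *)

Section DiscMean.
Variable R : realType.
Local Notation plane := (plane R).
Local Notation lam2 := (@lam2 R).
Local Notation leb := (@lebesgue_measure R).
Implicit Types (c : Cplx R) (r : R).

Lemma sum_cst_ereal (x : \bar R) n : (0 <= x)%E ->
  (\sum_(i < n) x = n%:R%:E * x)%E.
Proof.
move=> x0; elim: n => [|n IH]; first by rewrite big_ord0 mul0e.
by rewrite big_ord_recr/= IH -natr1 EFinD ge0_muleDl ?mul1e// lee_fin.
Qed.

(** The concentric square of side r lies in the disc. *)
Lemma disc_area_ge c r : 0 < r -> ((r ^+ 2)%:E <= lam2 (disc c r))%E.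
Proof.
move=> r0.
pose I (x : R) := `[x - r / 2, x + r / 2]%classic.
have hI x : leb (I x) = r%:E.
  have h : x - r / 2 < x + r / 2 by lra.
  rewrite /I lebesgue_measure_itv/= lte_fin h.
  by rewrite -EFinD; congr EFin; field.
have -> : ((r ^+ 2)%:E = lam2 (I (complex.Re c) `*` I (complex.Im c)))%E.
  rewrite lam2E product_measure1E; [|exact: measurable_itv|exact: measurable_itv].
  transitivity (r%:E * r%:E)%E; first by rewrite expr2 EFinM.
  by congr (_ * _)%E; exact/esym/hI.
apply: le_measure; rewrite ?inE.
- by apply: measurableX; exact: measurable_itv.
- exact: measurable_disc.
move=> [x y] [] /=; rewrite /I /= !in_itv/= => hx hy.
rewrite /disc/= -(ltr_pXn2r (n:=2)) ?nnegrE ?modulus_ge0 ?(ltW r0)//.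
rewrite modulus_sqr !raddfB/=.
have h1 : (x - complex.Re c) ^+ 2 <= (r / 2) ^+ 2.
  by rewrite -subr_ge0 subr_sqr mulr_ge0//; lra.
have h2 : (y - complex.Im c) ^+ 2 <= (r / 2) ^+ 2.
  by rewrite -subr_ge0 subr_sqr mulr_ge0//; lra.
have r2 : 0 < r ^+ 2 by rewrite exprn_gt0.
have e : (r / 2) ^+ 2 = r ^+ 2 / 4 by field.
lra.
Qed.

Lemma disc_area_le c r : 0 <= r -> (lam2 (disc c r) <= (4 * r ^+ 2)%:E)%E.
Proof.
move=> r0.
pose I (x : R) := `[x - r, x + r]%classic.
have hI x : (leb (I x) <= (2 * r)%:E)%E.
  rewrite /I lebesgue_measure_itv/= lte_fin; case: ifPn => [_|_]; last by rewrite lee_fin mulr_ge0.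
  by rewrite -EFinD lee_fin; lra.
apply: (@le_trans _ _ (lam2 (I (complex.Re c) `*` I (complex.Im c)))).
  apply: le_measure; rewrite ?inE.
  - exact: measurable_disc.
  - by apply: measurableX; exact: measurable_itv.
  move=> [x y]; rewrite /disc/= => h.
  have := le_lt_trans (Re_le_modulus _) h; have := le_lt_trans (Im_le_modulus _) h.
  rewrite !raddfB/= !ltr_norml => /andP[? ?] /andP[? ?].
  by split; rewrite /I/= in_itv/=; apply/andP; split; lra.
rewrite lam2E product_measure1E; [|exact: measurable_itv|exact: measurable_itv].
have -> : (4 * r ^+ 2)%:E = ((2 * r)%:E * (2 * r)%:E)%E by rewrite -EFinM; congr EFin; ring.
by apply: lee_pmul => //; exact: hI.
Qed.

Lemma disc_area_fin c r : 0 <= r -> lam2 (disc c r) \is a fin_num.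
Proof.
move=> r0; rewrite ge0_fin_numE ?measure_ge0//.
by rewrite (le_lt_trans (disc_area_le c r0))// ltry.
Qed.

(** This exact ratio gives the areas of rings as differences of concentric discs. *)
Lemma disc_area_scale r : 0 < r ->
  (lam2 (disc (0 : Cplx R)%R r) = (r ^+ 2)%:E * lam2 (disc (0 : Cplx R)%R 1%R))%E.
Proof.
move=> r0; rewrite -(leb2_scale r0 (measurable_disc 0 r)).
congr (_ * lam2 _)%E; apply/seteqP; split => w.
- rewrite /preimage/= !disc0E.
  have -> : toC ((r * w.1)%R, (r * w.2)%R) = r%:C%C * toC w.
    by rewrite /toC; simpc.
  by rewrite modulusM modulus_real gtr0_norm// => h; rewrite -(ltr_pM2l r0) mulr1.
- rewrite /preimage/= !disc0E.
  have -> : toC ((r * w.1)%R, (r * w.2)%R) = r%:C%C * toC w.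
    by rewrite /toC; simpc.
  by rewrite modulusM modulus_real gtr0_norm// => h; rewrite -[ltRHS]mulr1 ltr_pM2l.
Qed.

(** Reason for taking roots of unity of odd order: no power is -1, so [disc_rotation] applies to
    each of them. *)
Lemma odd_root_neqN1 (w : R[i]) n l : odd n -> w ^+ n = 1 -> w ^+ l != -1.
Proof.
move=> on wn; apply/eqP => h.
have : (w ^+ l) ^+ n = 1 by rewrite exprAC wn expr1n.
rewrite h -signr_odd on expr1 => /eqP.
by rewrite -subr_eq0 -opprD oppr_eq0 -[1 + 1]/(2%:R) pnatr_eq0.
Qed.

Lemma toC_rotation (u : Cplx R) (w : plane) :
  toC ((complex.Re u * w.1 - complex.Im u * w.2)%R, (complex.Re u * w.2 + complex.Im u * w.1)%R) = u * toC w.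
Proof. by rewrite /toC; case: u => a b; simpc; rewrite /= (addrC (a * w.2)). Qed.

Lemma disc_root_average (w : R[i]) n r (H : Cplx R -> R) : odd n -> n.-primitive_root w ->
  (forall z, 0 <= H z) -> measurable_fun setT (fun x => H (toC x)) ->
  (\int[lam2]_(x in disc (0 : Cplx R)%R r) (\sum_(l < n) H (w ^+ l * toC x))%:E =
   n%:R%:E * \int[lam2]_(x in disc (0 : Cplx R)%R r) (H (toC x))%:E)%E.
Proof.
move=> on wn H0 mH; have n0 := prim_order_gt0 wn.
have mrot u : measurable_fun setT (fun x => H (u * toC x)).
  under eq_fun do rewrite -toC_rotation.
  apply: (measurableT_comp mH); apply/measurable_fun_pairP; split => /=.
  - by apply: measurable_funB; apply: measurable_funM => //; (exact: measurable_fst || exact: measurable_snd).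
  - by apply: measurable_funD; apply: measurable_funM => //; (exact: measurable_fst || exact: measurable_snd).
under eq_integral do rewrite -sumEFin.
rewrite ge0_integral_sum//=; last 3 first.
- exact: measurable_disc.
- by move=> l; apply/measurable_EFinP; apply: measurable_funTS; exact: mrot.
- by move=> l x _; rewrite lee_fin.
rewrite (eq_bigr (fun=> \int[lam2]_(x in disc (0 : Cplx R)%R r) (H (toC x))%:E)%E).
  by rewrite sum_cst_ereal// integral_ge0// => x _; rewrite lee_fin.
move=> l _.
rewrite -(@disc_rotation R (w ^+ l) r (fun x => (H (toC x))%:E)).
- by apply: eq_integral => x _; rewrite toC_rotation.
- by rewrite modulusX (unit_root_modulus n0 (prim_expr_order wn)) expr1n.
- exact: odd_root_neqN1 on (prim_expr_order wn).
- by apply/measurable_EFinP; apply: measurable_funTS.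
- by move=> x; rewrite lee_fin.
Qed.

Lemma disc_mean_poly (p : {poly R[i]}) r : 0 <= r ->
  ((modulus p.[0])%:E * lam2 (disc (0 : Cplx R)%R r) <=
   \int[lam2]_(w in disc (0 : Cplx R)%R r) (modulus p.[toC w])%:E)%E.
Proof.
move=> r0; pose n := (size p).*2.+1.
have on : odd n by rewrite /n /= odd_double.
have pn : (size p <= n)%N by rewrite /n -addnn leqW// leq_addr.
have [w wn] := exists_prim_root R (ltn0Sn (size p).*2).
have mp : measurable_fun setT (fun x : plane => modulus p.[toC x]).
  by apply: measC_modulus; apply: measC_horner; exact: measC_toC.
have n0 : (0 < n%:R :> R) by rewrite ltr0n.
rewrite -(@lee_pmul2l _ n%:R%:E)// ?lte_fin//.
rewrite -(@disc_root_average w n r (fun z => modulus p.[z]) on wn (fun z => modulus_ge0 _) mp).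
rewrite muleA -EFinM -integral_cst; last exact: measurable_disc.
apply: ge0_le_integral.
- exact: measurable_disc.
- by move=> x _; rewrite lee_fin mulr_ge0// modulus_ge0.
- exact: measurable_cst.
- apply/measurable_EFinP; apply: measurable_funTS.
  apply: measurable_sum => l; apply: measC_modulus; apply: measC_horner.
  by apply: measCM; [exact: measC_cst|exact: measC_toC].
move=> x _; rewrite lee_fin horner_coef0.
have := poly_root_average (toC x) wn pn => /(congr1 (@modulus R)).
rewrite modulusM modulus_nat => <-; exact: modulus_sum.
Qed.

(** The integral does not change when the integrand is averaged over rotations by m-th roots of
    unity, and the averaged integrand is given by [poly_parseval]. *)
Lemma disc_bessel_poly (p : {poly R[i]}) r n : (size p <= n)%N ->
  (\int[lam2]_(w in disc (0 : Cplx R)%R r) (modulus p.[toC w] ^+ 2)%:E =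
   \int[lam2]_(w in disc (0 : Cplx R)%R r)
     (\sum_(k < n) modulus p`_k ^+ 2 * modulus (toC w) ^+ k.*2)%:E)%E.
Proof.
move=> pn.
pose m := n.*2.+1.
have om : odd m by rewrite /m /= odd_double.
have nm : (n <= m)%N by rewrite /m -addnn leqW// leq_addr.
have pm : (size p <= m)%N by exact: leq_trans nm.
have [w wm] := exists_prim_root R (ltn0Sn n.*2).
have mp : measurable_fun setT (fun x : plane => modulus p.[toC x] ^+ 2).
  by apply: measurable_funX; apply: measC_modulus; apply: measC_horner; exact: measC_toC.
have m0 : (0 < m%:R :> R) by rewrite ltr0n.
have H0 (z : Cplx R) : 0 <= modulus p.[z] ^+ 2 by rewrite exprn_ge0// modulus_ge0.
have := @disc_root_average w m r (fun z => modulus p.[z] ^+ 2) om wm H0 mp.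
under eq_integral do rewrite (poly_parseval _ wm pm) EFinM.
rewrite ge0_integralZl_EFin//=; last 3 first.
- exact: measurable_disc.
- move=> x _; rewrite lee_fin sumr_ge0// => k _.
  by rewrite mulr_ge0// exprn_ge0// modulus_ge0.
- apply/measurable_EFinP; apply: measurable_sum => k; apply: measurable_funM => //.
  by apply: measurable_funX; apply: measC_modulus; exact: measC_toC.
have mi : (0 < m%:R^-1 :> R) by rewrite invr_gt0.
move/(congr1 (fun x => (m%:R^-1)%:E * x)%E).
rewrite !muleA -!EFinM mulVf ?gt_eqF// !mul1e => <-.
apply: eq_integral => x _; congr EFin.
rewrite (big_ord_widen m (fun k => modulus p`_k ^+ 2 * modulus (toC x) ^+ k.*2) nm).
rewrite [RHS]big_mkcond/=; apply: eq_bigr => k _; case: ifPn => //.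
rewrite -leqNgt => nk; rewrite nth_default ?modulus0 ?expr0n ?mul0r//.
exact: leq_trans nk.
Qed.

Lemma ps_unif (b : nat -> Cplx R) r (e : R) : abs_conv b -> 0 <= r < 1 -> 0 < e ->
  exists N, forall n, (N <= n)%N -> forall z, modulus z <= r ->
    modulus (ps b z - \sum_(0 <= k < n) b k * z ^+ k) <= e.
Proof.
move=> hb hr e0; have := hb _ hr; rewrite -/(majorant b r).
move/cvgrPdist_le => /(_ _ e0)[N _ hN]; exists N => n Nn z zr.
case/andP: (hr) => _ r1; apply: le_trans (ps_tail n hb r1 zr) _.
have := hN n Nn; rewrite seriesEnat/=; apply: le_trans; exact: ler_norm.
Qed.

Lemma poly_partial_sum (b : nat -> Cplx R) n z :
  (\poly_(k < n) b k).[z] = \sum_(0 <= k < n) b k * z ^+ k.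
Proof. by rewrite horner_poly big_mkord. Qed.

Lemma measC_ps (b : nat -> Cplx R) (D : set plane) : abs_conv b ->
  (forall w, D w -> modulus (toC w) < 1) -> measC D (fun w => ps b (toC w)).
Proof.
move=> hb hD; apply: (@measC_lim _ _ (fun n w => power_series b (toC w) n)).
  move=> n; rewrite /power_series; under eq_fun do rewrite seriesEnat.
  by apply: measC_sum => k; apply: measCM; [exact: measC_cst|apply: measCX; exact: measC_toC].
by move=> w Dw; apply: cvg_ps => //; exact: hD.
Qed.

Lemma disc_sub c r (w : plane) : disc c r w -> modulus (toC w) < modulus c + r.
Proof.
move=> h; rewrite -[toC w](subrK c) addrC (le_lt_trans (modulusD _ _))//.
by rewrite ltrD2l.
Qed.

Lemma disc_translation c r (G : plane -> \bar R) :
  measurable_fun (disc c r) G -> (forall w, 0 <= G w)%E ->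
  (\int[lam2]_(w in disc (0 : Cplx R)%R r) G ((w.1 + complex.Re c)%R, (w.2 + complex.Im c)%R) =
   \int[lam2]_(w in disc c r) G w)%E.
Proof.
move=> mG G0.
rewrite -[RHS](mpreserving_integral (mpreserving_translation (complex.Re c) (complex.Im c)) (measurable_disc c r) mG); last by [].
congr (integral _ _ _).
have E (w : plane) : toC ((w.1 + complex.Re c)%R, (w.2 + complex.Im c)%R) = toC w + c.
  by rewrite /toC; case: c {mG} => a b; simpc.
by apply/seteqP; split => w; rewrite disc0E /preimage/disc/= E addrK.
Qed.

Lemma disc_translation_area c r : lam2 (disc (0 : Cplx R)%R r) = lam2 (disc c r).
Proof.
have [_ h] := mpreserving_translation (complex.Re c) (complex.Im c).
rewrite -(h _ (measurable_disc c r)); congr (lam2 _).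
have E (w : plane) : toC ((w.1 + complex.Re c)%R, (w.2 + complex.Im c)%R) = toC w + c.
  by rewrite /toC; case: c {h} => a b; simpc.
by apply/seteqP; split => w; rewrite disc0E /preimage/disc/= E addrK.
Qed.

(** A Taylor polynomial q is uniformly close to the series on the disc, and [disc_mean_poly] applies
    to q translated to the origin. *)
Lemma disc_mean_ps (b : nat -> Cplx R) c r : abs_conv b -> 0 < r -> modulus c + r < 1 ->
  ((modulus (ps b c))%:E * lam2 (disc c r) <=
   \int[lam2]_(w in disc c r) (modulus (ps b (toC w)))%:E)%E.
Proof.
move=> hb r0 cr1.
have cr : 0 <= modulus c + r < 1 by rewrite cr1 addr_ge0 ?modulus_ge0 ?(ltW r0).
have [A hA] : exists A : R, lam2 (disc c r) = A%:E.
  by exists (fine (lam2 (disc c r))); rewrite fineK// disc_area_fin// ltW.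
have A0 : 0 <= A by rewrite -lee_fin -hA measure_ge0.
apply/lee_addgt0Pr => e e0.
(* The approximation error d is paid twice, at the centre and under the integral, so 2 d A has to be
   at most e. *)
pose d := e / (2 * A + 1).
have d0 : 0 < d by rewrite divr_gt0// ltr_wpDl// mulr_ge0.
have [N hN] := ps_unif hb cr d0.
pose q := \poly_(k < N) b k.
have qE z : q.[z] = \sum_(0 <= k < N) b k * z ^+ k by rewrite poly_partial_sum.
pose p := q \Po ('X + c%:P).
have pE z : p.[z] = q.[z + c] by rewrite horner_comp !hornerE.
have hpc : modulus (ps b c) <= modulus q.[c] + d.
  rewrite -lerBlDl (le_trans (modulusB _ _))// qE hN//.
  by rewrite lerDl ltW.
have D1 w : disc c r w -> modulus (toC w) < 1 by move=> /disc_sub h; exact: lt_trans cr1.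
have mh : measurable_fun (disc c r) (fun w => modulus (ps b (toC w))).
  by apply: measC_modulus; exact: measC_ps.
have mq : measurable_fun (disc c r) (fun w => modulus q.[toC w]).
  by apply: measC_modulus; apply: measC_horner; exact: measC_toC.
apply: (@le_trans _ _ ((modulus q.[c] + d)%:E * A%:E)%E).
  by rewrite hA -!EFinM lee_fin ler_wpM2r.
rewrite EFinD muleDl//.
have -> : ((modulus q.[c])%:E * A%:E = (modulus p.[0])%:E * lam2 (disc (0 : Cplx R)%R r))%E.
  by rewrite pE add0r (disc_translation_area c) hA.
have E1 : (\int[lam2]_(w in disc (0 : Cplx R)%R r) (modulus p.[toC w])%:E =
   \int[lam2]_(w in disc c r) (modulus q.[toC w])%:E)%E.
  rewrite -(@disc_translation c r (fun w => (modulus q.[toC w])%:E)).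
  - apply: eq_integral => w _; rewrite pE; congr ((modulus q.[_])%:E).
    by rewrite /toC; case: (c) => a' b'; simpc.
  - exact/measurable_EFinP.
  - by move=> w; rewrite lee_fin modulus_ge0.
have h2 : (\int[lam2]_(w in disc c r) (modulus q.[toC w])%:E <=
    \int[lam2]_(w in disc c r) (modulus (ps b (toC w)))%:E + d%:E * A%:E)%E.
  rewrite -hA -integral_cst; last exact: measurable_disc.
  rewrite -ge0_integralD//=.
  - apply: ge0_le_integral => //=.
    + exact: measurable_disc.
    + by move=> w _; rewrite lee_fin modulus_ge0.
    + exact/measurable_EFinP.
    + apply/measurable_EFinP; exact: measurable_funD.
    move=> w Dw; rewrite -EFinD lee_fin -lerBlDl (le_trans (modulusB _ _))//.
    by rewrite modulusBC qE hN// ltW// disc_sub.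
  - exact: measurable_disc.
  - by move=> w _; rewrite lee_fin modulus_ge0.
  - exact/measurable_EFinP.
  - by move=> w _; rewrite lee_fin ltW.
apply: le_trans (leeD2r _ (disc_mean_poly p (ltW r0))) _.
rewrite E1; apply: le_trans (leeD2r _ h2) _.
rewrite -addeA leeD2l// -EFinM -EFinD lee_fin -mulrDl.
have -> : (d + d) * A = e * (2 * A) / (2 * A + 1).
  by rewrite /d; field; apply: lt0r_neq0; rewrite ltr_wpDl// mulr_ge0.
by rewrite ler_pdivrMr ?ltr_wpDl ?mulr_ge0// ler_wpM2l ?(ltW e0)// lerDl.
Qed.

Lemma bernoulli_ineq (y : R) k : 0 <= y <= 1 -> 1 - k%:R * y <= (1 - y) ^+ k.
Proof.
move=> /andP[y0 y1]; elim: k => [|k IH]; first by rewrite expr0 mul0r subr0.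
rewrite exprS -natr1.
have h : (1 - y) * (1 - k%:R * y) <= (1 - y) * (1 - y) ^+ k.
  by rewrite ler_wpM2l// subr_ge0.
apply: le_trans h.
have : 0 <= k%:R * y ^+ 2 by rewrite mulr_ge0// sqr_ge0.
lra.
Qed.

(** Only the outer ring s <= |w| < r is kept, with s^2 = r^2 (1 - y) and y = 1 / (2 (k + 1)). There
    |w|^(2k) >= r^(2k) / 2 by Bernoulli's inequality, and the area of the ring is at least r^2 y. *)
Lemma disc_moment_ge r k : 0 < r ->
  ((r ^+ k.*2.+2 / (4 * k.+1%:R))%:E <=
   \int[lam2]_(w in disc (0 : Cplx R)%R r) (modulus (toC w) ^+ k.*2)%:E)%E.
Proof.
move=> r0.
have k0 : (0 < k.+1%:R :> R) by rewrite ltr0n.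
pose y : R := (2 * k.+1%:R)^-1.
have y0 : 0 < y by rewrite invr_gt0 mulr_gt0.
have yk : k.+1%:R * y = 2^-1 by rewrite /y invfM mulrCA mulfV ?mulr1// gt_eqF.
have y1 : y <= 2^-1.
  by rewrite -yk ler_peMl ?(ltW y0)// ler1n.
pose s := r * Num.sqrt (1 - y).
have y1' : 0 < 1 - y by lra.
have s0 : 0 < s by rewrite mulr_gt0// sqrtr_gt0.
have s2 : s ^+ 2 = r ^+ 2 * (1 - y) by rewrite /s exprMn sqr_sqrtr// ltW.
have sr : s < r.
  rewrite -(ltr_pXn2r (n:=2)) ?nnegrE ?(ltW s0) ?(ltW r0)// s2.
  by rewrite -[ltRHS]mulr1 ltr_pM2l ?exprn_gt0//; lra.
pose Dr : set plane := disc (0 : Cplx R) r; pose Ds : set plane := disc (0 : Cplx R) s.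
have mDr : measurable Dr by exact: measurable_disc.
have mDs : measurable Ds by exact: measurable_disc.
have mA : measurable (Dr `\` Ds) by exact: measurableD.
have mf D : measurable_fun D (fun w : plane => modulus (toC w) ^+ k.*2).
  by apply: measurable_funX; apply: measC_modulus; exact: measC_toC.
have [K hK] : exists K : R, lam2 (disc (0 : Cplx R) 1) = K%:E.
  by exists (fine (lam2 (disc (0 : Cplx R) 1))); rewrite fineK// disc_area_fin.
have K1 : 1 <= K.
  by have := disc_area_ge (0 : Cplx R) (@ltr01 R); rewrite hK expr1n lee_fin.
have hA : lam2 (Dr `\` Ds) = (r ^+ 2 * y * K)%:E.
  have DsDr : Ds `<=` Dr.
    by move=> w; rewrite /Ds /Dr !disc0E => /lt_trans; apply.
  rewrite measureD//.
    have -> : Dr `&` Ds = Ds by apply/setIidPr.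
    transitivity ((r ^+ 2)%:E * K%:E - (s ^+ 2)%:E * K%:E)%E.
      rewrite -hK; congr (_ - _)%E; first exact: disc_area_scale.
      exact: disc_area_scale.
    rewrite -!EFinM -EFinB s2; congr EFin; ring.
  by rewrite ltey_eq disc_area_fin// ltW.
apply: (@le_trans _ _ (\int[lam2]_(w in Dr `\` Ds) (modulus (toC w) ^+ k.*2)%:E)%E); last first.
  apply: ge0_subset_integral => //.
  - exact/measurable_EFinP.
  - by move=> w _; rewrite lee_fin exprn_ge0// modulus_ge0.
apply: (@le_trans _ _ (\int[lam2]_(w in Dr `\` Ds) (r ^+ k.*2 / 2)%:E)%E).
  rewrite integral_cst// hA -EFinM lee_fin.
  have -> : r ^+ k.*2 / 2 * (r ^+ 2 * y * K) = r ^+ k.*2.+2 / (4 * k.+1%:R) * K.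
    by rewrite !exprS /y; move: (k.+1%:R : R) (k0) => u u0; field; exact: lt0r_neq0.
  by rewrite ler_peMr// divr_ge0 ?exprn_ge0 ?(ltW r0)// mulr_ge0.
apply: ge0_le_integral => //=.
- by move=> w _; rewrite lee_fin divr_ge0// exprn_ge0// ltW.
- exact/measurable_EFinP.
move=> w [_]; rewrite /Ds disc0E => /negP; rewrite -leNgt => hs.
rewrite lee_fin -mul2n !exprM.
apply: (@le_trans _ _ ((s ^+ 2) ^+ k)); last first.
  by rewrite lerXn2r ?nnegrE ?sqr_ge0// lerXn2r ?nnegrE ?modulus_ge0// ltW.
rewrite s2 (exprMn k (r ^+ 2) (1 - y)); apply: ler_wpM2l.
  by rewrite exprn_ge0// sqr_ge0.
have hy : 0 <= y <= 1 by apply/andP; split; lra.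
apply: le_trans (bernoulli_ineq k hy).
have : k%:R * y <= k.+1%:R * y by rewrite ler_wpM2r ?(ltW y0)// ler_nat.
by rewrite yk => ?; lra.
Qed.

Lemma disc_bessel_ps (b : nat -> Cplx R) r M : abs_conv b -> 0 < r < 1 ->
  ((\sum_(0 <= k < M) modulus (b k) ^+ 2 * (r ^+ k.*2.+2 / (4 * k.+1%:R)))%:E <=
   \int[lam2]_(w in disc (0 : Cplx R)%R r) (modulus (ps b (toC w)) ^+ 2)%:E)%E.
Proof.
move=> hb /andP[r0 r1].
have r01 : 0 <= r < 1 by rewrite (ltW r0).
have B0 := majorant_ge0 hb r01.
have mD := measurable_disc (0 : Cplx R) r.
have D1 (w : plane) : disc (0 : Cplx R) r w -> modulus (toC w) < 1.
  by rewrite disc0E => /lt_trans; apply.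
have mh : measurable_fun (disc (0 : Cplx R) r) (fun w => modulus (ps b (toC w))).
  by apply: measC_modulus; exact: measC_ps.
have [A hA] : exists A : R, lam2 (disc (0 : Cplx R) r) = A%:E.
  by exists (fine (lam2 (disc (0 : Cplx R) r))); rewrite fineK// disc_area_fin// ltW.
have A0 : 0 <= A by rewrite -lee_fin -hA measure_ge0.
set B := majorant b r in B0.
apply/lee_addgt0Pr => e e0.
(* For 0 <= x <= B and d <= 1 one has (x + d)^2 <= x^2 + d (2 B + 1), and the integral of the error
   over area A must be at most e. *)
pose d := Num.min 1 (e / ((2 * B + 1) * A + 1)).
have den0 : 0 < (2 * B + 1) * A + 1 by rewrite ltr_wpDl// mulr_ge0// addr_ge0// mulr_ge0.
have d0 : 0 < d by rewrite lt_min ltr01 divr_gt0.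
have d1 : d <= 1 by rewrite ge_min lexx.
have de : d * ((2 * B + 1) * A) <= e.
  apply: (@le_trans _ _ (e / ((2 * B + 1) * A + 1) * ((2 * B + 1) * A))).
    by rewrite ler_wpM2r ?mulr_ge0 ?addr_ge0 ?mulr_ge0// ge_min lexx orbT.
  rewrite mulrAC ler_pdivrMr// ler_wpM2l ?(ltW e0)// lerDl//.
have [N hN] := ps_unif hb r01 d0.
(* N for the accuracy of the approximation, M so that q contains the first M coefficients. *)
pose n := maxn N M.
pose q := \poly_(k < n) b k.
have qE z : q.[z] = \sum_(0 <= k < n) b k * z ^+ k by rewrite poly_partial_sum.
have mq : measurable_fun (disc (0 : Cplx R) r) (fun w => modulus q.[toC w]).
  by apply: measC_modulus; apply: measC_horner; exact: measC_toC.
have szq : (size q <= n)%N by exact: size_poly.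
have h1 : ((\sum_(0 <= k < M) modulus (b k) ^+ 2 * (r ^+ k.*2.+2 / (4 * k.+1%:R)))%:E <=
   \int[lam2]_(w in disc (0 : Cplx R)%R r) (modulus q.[toC w] ^+ 2)%:E)%E.
  rewrite (disc_bessel_poly r szq).
  under [leRHS]eq_integral do rewrite -sumEFin.
  rewrite ge0_integral_sum//=; last 2 first.
  - move=> k; apply/measurable_EFinP; apply: measurable_funM => //.
    by apply: measurable_funX; apply: measC_modulus; exact: measC_toC.
  - by move=> k w _; rewrite lee_fin mulr_ge0// exprn_ge0// modulus_ge0.
  have Mn : (M <= n)%N by exact: leq_maxr.
  apply: (@le_trans _ _ (\sum_(0 <= k < n) modulus (b k) ^+ 2 * (r ^+ k.*2.+2 / (4 * k.+1%:R)))%:E).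
    rewrite lee_fin [leRHS](big_cat_nat (leq0n M) Mn)//= lerDl sumr_ge0// => k _.
    apply: mulr_ge0; first exact/exprn_ge0/modulus_ge0.
    by apply: divr_ge0; [exact/exprn_ge0/ltW|exact: mulr_ge0].
  rewrite big_mkord -sumEFin; apply: lee_sum => k _.
  under eq_integral do rewrite EFinM.
  rewrite ge0_integralZl_EFin//=; last 3 first.
  - by move=> w _; rewrite lee_fin exprn_ge0// modulus_ge0.
  - apply/measurable_EFinP.
    by apply: measurable_funX; apply: measC_modulus; exact: measC_toC.
  - by rewrite exprn_ge0// modulus_ge0.
  rewrite coef_poly ltn_ord EFinM lee_wpmul2l ?lee_fin ?exprn_ge0 ?modulus_ge0//.
  exact: disc_moment_ge.
apply: (le_trans h1).
apply: (@le_trans _ _ (\int[lam2]_(w in disc (0 : Cplx R)%R r) (modulus (ps b (toC w)) ^+ 2)%:E + (d * (2 * B + 1))%:E * A%:E)%E); last first.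
  by rewrite leeD2l// -EFinM lee_fin -mulrA.
rewrite -hA -integral_cst//.
rewrite -ge0_integralD//=.
- apply: ge0_le_integral => //=.
  + by move=> w _; rewrite lee_fin exprn_ge0// modulus_ge0.
  + by apply/measurable_EFinP; exact: measurable_funX.
  + by apply/measurable_EFinP; apply: measurable_funD => //; exact: measurable_funX.
  move=> w; rewrite disc0E => Dw; rewrite -EFinD lee_fin.
  have hB : modulus (ps b (toC w)) <= B by apply: ps_le_majorant => //; exact: ltW.
  have hq : modulus q.[toC w] <= modulus (ps b (toC w)) + d.
    rewrite -lerBlDl (le_trans (modulusB _ _))// modulusBC qE hN ?leq_maxl//.
    exact: ltW.
  apply: (@le_trans _ _ ((modulus (ps b (toC w)) + d) ^+ 2)).
    by rewrite lerXn2r ?nnegrE ?modulus_ge0// addr_ge0 ?modulus_ge0 ?(ltW d0).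
  move: (modulus (ps b (toC w))) hB => x hB.
  have : d * d <= d * 1 by rewrite ler_wpM2l// ltW.
  have : d * x <= d * B by rewrite ler_wpM2l// ltW.
  by move=> ? ?; lra.
- by move=> w _; rewrite lee_fin exprn_ge0// modulus_ge0.
- by apply/measurable_EFinP; exact: measurable_funX.
- by move=> w _; rewrite lee_fin mulr_ge0// ?(ltW d0)// addr_ge0// mulr_ge0.
Qed.

End DiscMean.

(** * Weighted estimates *)

Section RealTools.
Variable R : realType.
Implicit Types (x y L p q : R).

Lemma powR_le x y q : 0 <= q -> 0 <= x -> x <= y -> x `^ q <= y `^ q.
Proof.
by move=> q0 x0 xy; apply: ge0_ler_powR => //; rewrite nnegrE// (le_trans x0).
Qed.

Lemma powR_leN x y q : q <= 0 -> 0 < x -> x <= y -> y `^ q <= x `^ q.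
Proof.
move=> q0 x0 xy; rewrite -[q]opprK !(powRN _ (- q)).
by rewrite lef_pV2 ?posrE ?powR_gt0 ?(lt_le_trans x0)// powR_le// ?oppr_ge0// ltW.
Qed.

Lemma powR_add x a b : 0 < x -> x `^ (a + b) = x `^ a * x `^ b.
Proof. by move=> x0; rewrite powRD//; apply/implyP => _; rewrite gt_eqF. Qed.

(* Truncation at level [L] replaces Jensen's inequality for integrals. *)
Lemma powR_trunc x L p : 1 <= p -> 0 < L -> 0 <= x -> x <= L + L `^ (1 - p) * x `^ p.
Proof.
move=> p1 L0 x0; have [xL|Lx] := leP x L.
  by rewrite (le_trans xL)// lerDl mulr_ge0// powR_ge0.
have xp : 0 < x by exact: lt_trans Lx.
apply: (@le_trans _ _ (L `^ (1 - p) * x `^ p)); last by rewrite lerDr ltW.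
have {1}-> : x = x `^ (1 - p) * x `^ p.
  by rewrite -powR_add// subrK powRr1// ltW.
by rewrite ler_wpM2r ?powR_ge0// powR_leN// ?(ltW Lx)// subr_le0.
Qed.

Lemma nneseries_le (u : nat -> \bar R) (B : \bar R) : (forall n, 0 <= u n)%E ->
  (forall n, \sum_(0 <= i < n) u i <= B)%E -> (\sum_(0 <= i <oo) u i <= B)%E.
Proof.
move=> u0 h; apply: lime_le; first by apply: is_cvg_nneseries => ? _ _.
by apply: nearW => n; exact: h.
Qed.

Lemma geometric_sum_le (t : R) n : 0 <= t < 1 -> \sum_(0 <= k < n) t ^+ k <= (1 - t)^-1.
Proof.
move=> /andP[t0 t1]; rewrite -[leRHS]mul1r ler_pdivlMr ?subr_gt0// big_mkord.
by rewrite mulrC -opprB mulNr -subrX1 opprB gerBl exprn_ge0.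
Qed.

(** This is |i - j|: one of the two truncated differences is 0. *)
Definition dist (i j : nat) : nat := ((i - j) + (j - i))%N.

Lemma distC i j : dist i j = dist j i.
Proof. by rewrite /dist addnC. Qed.

(** Each distance to j occurs at most twice, so the indices below j and those from j on each
    contribute at most one geometric series. *)
Lemma geometric_dist_sum_le (t : R) n j : 0 <= t < 1 ->
  \sum_(0 <= i < n) t ^+ dist i j <= 2 / (1 - t).
Proof.
move=> t01; case/andP: (t01) => t0 t1.
have jm : (j <= maxn n j)%N by exact: leq_maxr.
have nm : (n <= maxn n j)%N by exact: leq_maxl.
apply: (@le_trans _ _ (\sum_(0 <= i < maxn n j) t ^+ dist i j)).
  by rewrite [leRHS](big_cat_nat (leq0n n) nm)//= lerDl sumr_ge0// => i _; rewrite exprn_ge0.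
rewrite (big_cat_nat (leq0n j) jm)//= mulr_natl mulr2n lerD//.
  apply: le_trans (geometric_sum_le j t01); rewrite big_nat_rev/= add0n.
  rewrite [leLHS]big_nat [leRHS]big_nat; apply: ler_sum => i /andP[_ ij].
  rewrite /dist ler_wiXn2l// ?(ltW t1)//.
  by rewrite subKn// (leq_trans (leqnSn i))// leq_addl.
rewrite -{1}[j]add0n big_addn.
apply: le_trans (geometric_sum_le (maxn n j - j) t01); apply: ler_sum => i _.
by rewrite /dist addnK (eqP (_ : j - (i + j) == 0)%N) ?addn0// subn_eq0 leq_addl.
Qed.

Lemma dist_kernel_sum (t : R) j : 0 <= t < 1 ->
  (\sum_(0 <= i <oo) (t ^+ dist i j)%:E <= (2 / (1 - t))%:E)%E.
Proof.
move=> t01; apply: nneseries_le => n; first by rewrite lee_fin exprn_ge0//; case/andP: t01.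
by rewrite sumEFin lee_fin geometric_dist_sum_le.
Qed.

(** Truncating each x i at a common level L bounds the sum by L S + L^(1 - p) V, which is at most (S
    + 1) L as soon as L^p >= V. *)
Lemma kernel_jensen (k x : nat -> R) (S p : R) : 1 <= p -> 0 <= S ->
  (forall i, 0 <= k i) -> (forall i, 0 <= x i) ->
  (\sum_(0 <= i <oo) (k i)%:E <= S%:E)%E ->
  ((\sum_(0 <= i <oo) (k i * x i)%:E) `^ p <=
   ((S + 1) `^ p)%:E * \sum_(0 <= i <oo) (k i * x i `^ p)%:E)%E.
Proof.
move=> p1 S0 k0 x0 kS.
have p0 : 0 < p by exact: lt_le_trans p1.
have S1 : 0 < S + 1 by rewrite ltr_wpDl.
set V := (\sum_(0 <= i <oo) (k i * x i `^ p)%:E)%E.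
have V0 : (0 <= V)%E.
  by apply: nneseries_ge0 => i _ _; rewrite lee_fin mulr_ge0// powR_ge0.
have [->|Vfin] := eqVneq V +oo%E.
  by rewrite gt0_muley ?leey// lte_fin powR_gt0.
have [v hv] : exists v, V = v%:E.
  by exists (fine V); rewrite fineK// ge0_fin_numE// ltey.
have v0 : 0 <= v by rewrite -lee_fin -hv.
pose s := v `^ p^-1.
have s0 : 0 <= s by exact: powR_ge0.
have sp : s `^ p = v by rewrite /s -powRrM mulVf ?gt_eqF// powRr1.
have main : (\sum_(0 <= i <oo) (k i * x i)%:E <= ((S + 1) * s)%:E)%E.
  apply/lee_addgt0Pr => e e0.
  (* The optimal level s may be 0 whereas truncation needs L > 0; the increment costs exactly e
     after multiplication by S + 1. *)
  pose L := s + e / (S + 1).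
  have L0 : 0 < L by rewrite ltr_wpDl// divr_gt0.
  have -> : ((S + 1) * s)%:E + e%:E = (S * L + L)%:E.
    by rewrite -EFinD; congr EFin; rewrite /L; field; rewrite gt_eqF.
  have -> : (S * L + L)%:E = (L%:E * S%:E + L%:E)%E by rewrite mulrC.
  apply: (@le_trans _ _ (\sum_(0 <= i <oo) (L%:E * (k i)%:E + (L `^ (1 - p))%:E * (k i * x i `^ p)%:E))%E).
    apply: lee_nneseries => i _; first by rewrite lee_fin mulr_ge0.
    rewrite -!EFinM -EFinD lee_fin.
    have -> : L * k i + L `^ (1 - p) * (k i * x i `^ p) = k i * (L + L `^ (1 - p) * x i `^ p) by ring.
    by rewrite ler_wpM2l// powR_trunc.
  rewrite nneseriesD; last 2 first.
  - by move=> i _ _; rewrite -EFinM lee_fin mulr_ge0// ltW.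
  - by move=> i _ _; rewrite -EFinM lee_fin mulr_ge0 ?powR_ge0// mulr_ge0// powR_ge0.
  rewrite !nneseriesZl; last 2 first.
  - by move=> i _; rewrite lee_fin mulr_ge0// powR_ge0.
  - by move=> i _; rewrite lee_fin.
  apply: leeD; first by rewrite lee_wpmul2l// lee_fin ltW.
  rewrite -/V hv -EFinM lee_fin.
  have : v <= L `^ p by rewrite -sp powR_le ?(ltW p0)// /L lerDl divr_ge0 ?(ltW e0)// ltW.
  move/(ler_wpM2l (powR_ge0 L (1 - p))) => /le_trans; apply.
  by rewrite -powR_add// subrK powRr1// ltW.
apply: (@le_trans _ _ ((((S + 1) * s)%:E) `^ p)%E).
  apply: gt0_ler_poweR => //; first exact: ltW.
  - rewrite in_itv/= leey andbT; apply: nneseries_ge0 => i _ _.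
    by rewrite lee_fin mulr_ge0.
  - by rewrite in_itv/= leey andbT lee_fin mulr_ge0// ltW.
rewrite poweR_EFin powRM ?(ltW S1)// sp EFinM -hv//.
Qed.

(** Jensen's inequality for each j, then interchange of the sums: the kernel is symmetric, so its
    row sums and column sums have the same bound S. *)
Lemma young_geometric (t p : R) : 0 <= t < 1 -> 1 <= p ->
  exists2 K : R, 0 < K & forall x : nat -> R, (forall i, 0 <= x i) ->
  (\sum_(0 <= j <oo) (\sum_(0 <= i <oo) (t ^+ dist i j * x i)%:E) `^ p <=
   K%:E * \sum_(0 <= i <oo) (x i `^ p)%:E)%E.
Proof.
move=> t01 p1; case/andP: (t01) => t0 t1.
pose S := 2 / (1 - t).
have S0 : 0 < S by rewrite divr_gt0// subr_gt0.
exists ((S + 1) `^ p * S); first by rewrite mulr_gt0// powR_gt0// ltr_wpDl// ltW.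
move=> x x0.
have xp0 i : 0 <= x i `^ p by exact: powR_ge0.
have td i j : 0 <= t ^+ dist i j by rewrite exprn_ge0.
apply: (@le_trans _ _ (\sum_(0 <= j <oo) (((S + 1) `^ p)%:E * \sum_(0 <= i <oo) (t ^+ dist i j * x i `^ p)%:E)%E)%E).
  apply: lee_nneseries => j _; first by move=> *; rewrite poweR_ge0.
  apply: kernel_jensen => //; first exact: ltW.
  exact: dist_kernel_sum.
rewrite nneseriesZl; last first.
  by move=> j _; apply: nneseries_ge0 => i _ _; rewrite lee_fin mulr_ge0.
rewrite nneseries_interchange; last first.
  by move=> i j; rewrite lee_fin mulr_ge0.
rewrite EFinM -muleA lee_wpmul2l ?lee_fin ?powR_ge0//.
rewrite -nneseriesZl; last by move=> i _; rewrite lee_fin.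
apply: lee_nneseries => i _.
  by move=> _; apply: nneseries_ge0 => j _ _; rewrite lee_fin mulr_ge0.
under eq_eseriesr do rewrite mulrC EFinM.
rewrite nneseriesZl; last by move=> j _; rewrite lee_fin.
rewrite muleC lee_wpmul2r ?lee_fin//.
under eq_eseriesr do rewrite distC.
exact: dist_kernel_sum.
Qed.

End RealTools.

(** * Pointwise bounds from the local weighted energy *)

Section PointwiseBound.
Variable R : realType.
Local Notation plane := (plane R).
Local Notation lam2 := (@lam2 R).
Implicit Types (c : Cplx R) (r : R).

Definition weight (alpha : R) (w : plane) : R := (1 - modulus (toC w) ^+ 2) `^ alpha.

Lemma weight_ge0 alpha w : 0 <= weight alpha w.
Proof. exact: powR_ge0. Qed.

Lemma measurable_powR_fun (D : set plane) (f : plane -> R) (q : R) :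
  measurable_fun D f -> measurable_fun D (fun w => f w `^ q).
Proof. by move=> mf; apply: (measurableT_comp (measurable_powR q)). Qed.

Lemma measurable_weight alpha (D : set plane) : measurable_fun D (weight alpha).
Proof.
apply: measurable_powR_fun; apply: measurable_funB => //.
by apply: measurable_funX; apply: measC_modulus; exact: measC_toC.
Qed.

Lemma powR_between (x r alpha : R) : 0 < r -> r <= x <= 6 * r ->
  6 `^ (- `|alpha|) * r `^ alpha <= x `^ alpha.
Proof.
move=> r0 /andP[rx x6]; have x0 : 0 < x by exact: lt_le_trans rx.
have [a0|a0] := leP 0 alpha.
  rewrite ger0_norm//.
  apply: (@le_trans _ _ (r `^ alpha)); last by rewrite powR_le// ltW.
  rewrite ler_piMl ?powR_ge0// powRN invf_le1 ?powR_gt0//.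
  have {1}-> : 1 = 1 `^ alpha :> R by rewrite powR1.
  by rewrite powR_le// ler1n.
rewrite ltr0_norm// opprK -powRM ?(ltW r0)//.
by rewrite powR_leN// ltW.
Qed.

(** On this disc 1 - |w| lies between r and 3r, hence 1 - |w|^2 between r and 6r. *)
Lemma disc_weight_ge (alpha r : R) c w : 0 < r -> modulus c = 1 - 2 * r -> disc c r w ->
  6 `^ (- `|alpha|) * r `^ alpha <= weight alpha w.
Proof.
move=> r0 cE hw; have h1 := disc_sub hw.
have h2 : modulus c - r < modulus (toC w).
  rewrite ltrBlDr -ltrBlDl (le_lt_trans (modulusB _ _))// modulusBC//.
have m0 := modulus_ge0 (toC w).
apply: powR_between => //.
move: (modulus (toC w)) h1 h2 m0 => u h1 h2 m0.
have m1 : u <= 1 by lra.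
apply/andP; split.
  have : u * u <= u * 1 by rewrite ler_wpM2l.
  by rewrite expr2; lra.
have : 0 <= (1 - u) ^+ 2 by exact: sqr_ge0.
rewrite sqrrB expr1n mul1r; lra.
Qed.

(** The level L = r^(-beta) s is the constant value whose energy on a region of area r^2 and weight
    r^alpha is s^p. Truncation at L inside the sub-mean value inequality gives 4 L from the area and
    6^|alpha| L from the energy. *)
Lemma pointwise_bound (b : nat -> Cplx R) (p alpha r s : R) c : abs_conv b -> 1 <= p ->
  0 < r -> modulus c = 1 - 2 * r -> 0 < s ->
  (\int[lam2]_(w in disc c r) (weight alpha w * modulus (ps b (toC w)) `^ p)%:E <= (s `^ p)%:E)%E ->
  modulus (ps b c) <= (4 + 6 `^ `|alpha|) * (r `^ (- ((alpha + 2) / p)) * s).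
Proof.
move=> hb p1 r0 cE s0 hI.
have p0 : 0 < p by exact: lt_le_trans p1.
pose beta := (alpha + 2) / p.
have bp : beta * p = alpha + 2 by rewrite /beta mulfVK// gt_eqF.
pose L := r `^ (- beta) * s.
have L0 : 0 < L by rewrite mulr_gt0// powR_gt0.
have D1 (w : plane) : disc c r w -> modulus (toC w) < 1 by move=> /disc_sub; lra.
have mD := measurable_disc c r.
have mh : measurable_fun (disc c r) (fun w => modulus (ps b (toC w))).
  by apply: measC_modulus; exact: measC_ps.
have mhp : measurable_fun (disc c r) (fun w => modulus (ps b (toC w)) `^ p).
  exact: measurable_powR_fun.
have mwhp : measurable_fun (disc c r) (fun w => weight alpha w * modulus (ps b (toC w)) `^ p).
  by apply: measurable_funM => //; exact: measurable_weight.
pose k : R := 6 `^ `|alpha| * r `^ (- alpha).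
have k0 : 0 < k by rewrite mulr_gt0 ?powR_gt0.
have kw w : disc c r w -> 1 <= k * weight alpha w.
  move=> /(disc_weight_ge alpha r0 cE)/(ler_wpM2l (ltW k0)); apply: le_trans.
  rewrite /k !powRN; set a := 6 `^ _; set d := r `^ alpha.
  have a0 : a != 0 by rewrite gt_eqF// powR_gt0.
  have d0 : d != 0 by rewrite gt_eqF// powR_gt0.
  by rewrite le_eqVlt; apply/orP; left; apply/eqP; field; rewrite a0 d0.
have c1 : modulus c + r < 1 by lra.
have := disc_mean_ps hb r0 c1 => hm.
have E : ((modulus (ps b c) * r ^+ 2)%:E <= (L * (4 * r ^+ 2) + L `^ (1 - p) * k * s `^ p)%:E)%E.
  apply: (@le_trans _ _ ((modulus (ps b c))%:E * lam2 (disc c r))%E).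
    rewrite EFinM lee_wpmul2l ?lee_fin ?modulus_ge0//; exact: disc_area_ge.
  apply: (le_trans hm).
  apply: (@le_trans _ _ (\int[lam2]_(w in disc c r) (L%:E + (L `^ (1 - p) * k)%:E * (weight alpha w * modulus (ps b (toC w)) `^ p)%:E))%E).
    apply: ge0_le_integral => //.
    - by move=> w _; rewrite lee_fin modulus_ge0.
    - exact/measurable_EFinP.
    - apply: emeasurable_funD => //; apply: emeasurable_funM => //; exact/measurable_EFinP.
    move=> w Dw; rewrite -EFinM -EFinD lee_fin.
    apply: le_trans (powR_trunc p1 L0 (modulus_ge0 _)) _.
    rewrite lerD2l -mulrA ler_wpM2l ?powR_ge0// mulrA.
    by rewrite -[leLHS]mul1r ler_wpM2r ?powR_ge0// kw.
  rewrite ge0_integralD//; last 3 first.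
  - by move=> w _; rewrite lee_fin ltW.
  - by move=> w _; rewrite -EFinM lee_fin !mulr_ge0 ?powR_ge0 ?(ltW k0)// weight_ge0.
  - by apply: emeasurable_funM => //; exact/measurable_EFinP.
  rewrite integral_cst// ge0_integralZl_EFin//; last 3 first.
  - by move=> w _; rewrite lee_fin mulr_ge0 ?powR_ge0// weight_ge0.
  - exact/measurable_EFinP.
  - by rewrite mulr_ge0 ?powR_ge0// ltW.
  rewrite EFinD; apply: leeD.
    rewrite [leRHS]EFinM lee_wpmul2l ?lee_fin ?(ltW L0)//; exact/disc_area_le/ltW.
  by rewrite [leRHS]EFinM lee_wpmul2l// lee_fin mulr_ge0 ?powR_ge0// ltW.
move: E; rewrite lee_fin.
have -> : L * (4 * r ^+ 2) + L `^ (1 - p) * k * s `^ p = (4 + 6 `^ `|alpha|) * L * r ^+ 2.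
  have -> : L `^ (1 - p) * k * s `^ p = 6 `^ `|alpha| * L * r ^+ 2.
    rewrite /k /L powRM ?powR_ge0 ?(ltW s0)// -powRrM.
    have -> : r `^ (- beta * (1 - p)) * s `^ (1 - p) * (6 `^ `|alpha| * r `^ (- alpha)) * s `^ p =
       6 `^ `|alpha| * (r `^ (- beta * (1 - p)) * r `^ (- alpha)) * (s `^ (1 - p) * s `^ p) by ring.
    rewrite -!powR_add// subrK powRr1 ?(ltW s0)//.
    have -> : - beta * (1 - p) + - alpha = - beta + 2 by rewrite mulrBr mulr1 mulNr opprK bp; ring.
    rewrite powR_add// -[2]/(2%:R) powR_mulrn ?(ltW r0)//; ring.
  ring.
by rewrite ler_pM2r ?exprn_gt0.
Qed.

End PointwiseBound.

(** * Dyadic decompositions *)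

Section Dyadic.
Variable R : realType.

Definition hp (n : nat) : R := 2^-1 ^+ n.

Lemma hp_gt0 n : 0 < hp n.
Proof. by rewrite exprn_gt0// invr_gt0. Qed.

Lemma hp_ge0 n : 0 <= hp n.
Proof. exact/ltW/hp_gt0. Qed.

Lemma hpS n : hp n.+1 = hp n / 2.
Proof. by rewrite /hp exprSr. Qed.

Lemma hpD m n : hp (m + n) = hp m * hp n.
Proof. by rewrite /hp exprD. Qed.

Lemma hp_le m n : (hp m <= hp n) = (n <= m)%N.
Proof. by rewrite /hp ler_iXn2l ?invr_gt0// invf_lt1// ltr1n. Qed.

Lemma hp_lt m n : (hp m < hp n) = (n < m)%N.
Proof. by rewrite ltNge hp_le -ltnNge. Qed.

Lemma hp0 : hp 0 = 1. Proof. by rewrite /hp expr0. Qed.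

Lemma hp_le1 n : hp n <= 1.
Proof. by rewrite -hp0 hp_le. Qed.

Lemma hp_powR n a : hp n `^ a = (2 `^ (- a)) ^+ n.
Proof.
rewrite -powR_mulrn ?powR_ge0// -powRrM.
have -> : hp n = 2 `^ (- n%:R) by rewrite powR_invn// /hp exprVn.
by rewrite -powRrM; congr (_ `^ _); ring.
Qed.

Lemma dyadic_level (x : R) : 0 < x <= 1 -> exists k, hp k.+1 < x <= hp k.
Proof.
move=> /andP[x0 x1].
have [N hN] : exists n, hp n < x.
  have h : `|2^-1 : R| < 1 by rewrite ger0_norm ?invr_ge0// invf_lt1// ltr1n.
  have /cvgrPdist_lt/(_ _ x0)[N _ hN] := cvg_expr h.
  exists N; have := hN N (leqnn _); rewrite /= sub0r normrN.
  by rewrite ger0_norm// hp_ge0.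
have [n hn nmin] := ex_minnP (ex_intro (fun n => hp n < x) N hN).
case: n hn nmin => [|k] hk kmin; first by rewrite hp0 ltNge x1 in hk.
exists k; rewrite hk/= leNgt; apply/negP => /kmin; by rewrite ltnn.
Qed.

Context d (T : measurableType d) (mu : {measure set T -> \bar R}).

Definition level (D : set T) (u : T -> R) (k : nat) : set T :=
  D `&` [set x | hp k.+1 < u x <= hp k].

Lemma measurable_level D u k : measurable D -> measurable_fun D u ->
  measurable (level D u k).
Proof.
move=> mD mu'.
have -> : level D u k = D `&` u @^-1` `]hp k.+1, hp k].
  by apply/seteqP; split => x; rewrite /level/= in_itv/=.
exact: mu'.
Qed.

Lemma dyadic_integral D (u : T -> R) (f : T -> \bar R) : measurable D ->
  measurable_fun D u -> measurable_fun D f -> (forall x, D x -> 0 <= f x)%E ->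
  (forall x, D x -> 0 < u x <= 1) ->
  (\int[mu]_(x in D) f x = \sum_(0 <= k <oo) \int[mu]_(x in level D u k) f x)%E.
Proof.
move=> mD mu' mf f0 hu.
have DE : D = \bigcup_k level D u k.
  apply/seteqP; split => x; last by case=> k _ [].
  by move=> Dx; have [k hk] := dyadic_level (hu _ Dx); exists k.
rewrite {1}DE ge0_integral_bigcup//.
- by move=> k; exact: measurable_level.
- by rewrite -DE.
- by move=> x; rewrite -DE; exact: f0.
apply/trivIsetP => i j _ _ ij; apply/seteqP; split => // x [[_ /andP[h1 h2]] [_ /andP[h3 h4]]].
have := lt_le_trans h1 h4; have := lt_le_trans h3 h2; rewrite !hp_lt !ltnS => ji ij'.
by move/negP: ij; apply; rewrite eqn_leq ji ij'.
Qed.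

End Dyadic.
Arguments hp {R}.

(** * Mass of the weight near the boundary point 1 *)

Section WeightIntegral.
Variable R : realType.
Local Notation plane := (plane R).
Local Notation lam2 := (@lam2 R).
Local Notation D1 := (disc (0 : Cplx R)%R 1 : set plane).

(* The factor 2 makes [near1 0] the whole disc. *)
Definition near1 m : set plane := D1 `&` [set w | modulus (1 - toC w) <= 2 * hp m].

Definition shell (w : plane) : R := 1 - modulus (toC w) ^+ 2.

Lemma measurable_modulus1 (D : set plane) : measurable_fun D (fun w => modulus (1 - toC w)).
Proof.
under eq_fun do rewrite modulusBC; exact: measurable_modulus_toC.
Qed.

Lemma measurable_near1 m : measurable (near1 m).
Proof.
have -> : near1 m = D1 `&` (fun w => modulus (1 - toC w)) @^-1` `]-oo, (2 * hp m)].
  by apply/seteqP; split => w; rewrite /near1/= in_itv/=.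
by apply: (@measurable_modulus1 D1); [exact: measurable_disc|exact: measurable_itv].
Qed.

Lemma measurable_shell (D : set plane) : measurable_fun D shell.
Proof.
apply: measurable_funB => //; apply: measurable_funX; apply: measC_modulus; exact: measC_toC.
Qed.

Lemma shell01 w : D1 w -> 0 < shell w <= 1.
Proof.
rewrite disc0E /shell => h; have m0 := modulus_ge0 (toC w).
rewrite subr_gt0 lerBlDr lerDl sqr_ge0 andbT.
by rewrite -[ltRHS](expr1n _ 2) ltrXn2r.
Qed.

Lemma shell_le w : D1 w -> shell w <= 2 * modulus (1 - toC w).
Proof.
rewrite disc0E /shell => h; have m0 := modulus_ge0 (toC w).
have h1 : 1 - modulus (toC w) <= modulus (1 - toC w).
  by rewrite -{1}(modulus1 R) modulusB.
move: (modulus (toC w)) h m0 h1 => u h m0 h1.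
have -> : 1 - u ^+ 2 = (1 + u) * (1 - u) by ring.
by rewrite ler_pM// ?subr_ge0 ?addr_ge0//; lra.
Qed.

(** For m >= 2 the region lies in Re w >= 1/2, where x^2 increases at rate at least 1: horizontal
    slices have diameter at most hp k, and |Im w| <= 2 hp m. For m < 2 the factor hp m is at least
    1/2 and the area of the full ring suffices. *)
Lemma level_area_le k m : (lam2 (level (near1 m) shell k) <= (16 * hp k * hp m)%:E)%E.
Proof.
have mL := measurable_level k (measurable_near1 m) (@measurable_shell (near1 m)).
have k0 := hp_ge0 R k; have m0 := hp_ge0 R m.
have [m2|m2] := leqP 2 m.
  have m4 : hp m <= 4^-1 :> R.
    have -> : 4^-1 = hp 2 :> R by rewrite /hp; field.
    by rewrite hp_le.
  (* [leb2_section_le] cuts vertically while the estimate is on horizontal slices. *)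
  have [mswap hswap] := mpreserving_swap R.
  rewrite -(hswap _ mL).
  set A := _ @^-1` _.
  have mA : measurable A by rewrite /A -[X in measurable X]setTI; exact: mswap.
  apply: le_trans (leb2_section_le (c := 0) (d := 2 * hp m) (e := hp k) mA _ _ _ _) _.
  - by rewrite mulr_ge0.
  - by [].
  - move=> y x [[_ h] _]; rewrite subr0.
    apply: le_trans h; rewrite modulusBC; apply: le_trans (Im_le_modulus _).
    by rewrite raddfB/= subr0.
  - move=> y x x' [[_ h] /andP[h1 h2]] [[_ h'] /andP[h1' h2']].
    have hx : 2^-1 <= x.
      have := le_trans (Re_le_modulus _) h; rewrite raddfB/= ler_norml => /andP[_ ?]; lra.
    have hx' : 2^-1 <= x'.
      have := le_trans (Re_le_modulus _) h'; rewrite raddfB/= ler_norml => /andP[_ ?]; lra.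
    move: h1 h2 h1' h2'; rewrite /shell !modulus_sqr/= hpS => h1 h2 h1' h2'.
    have e : `|x ^+ 2 - x' ^+ 2| <= hp k.
      rewrite ler_norml; apply/andP; split; lra.
    apply: le_trans e; rewrite subr_sqr normrM ler_peMr//.
    by rewrite ger0_norm; lra.
  rewrite lee_fin; have : 0 <= hp k * hp m :> R by rewrite mulr_ge0.
  lra.
have hm : 2^-1 <= hp m :> R.
  have -> : 2^-1 = hp 1 :> R by rewrite /hp expr1.
  by rewrite hp_le.
apply: (@le_trans _ _ (8 * hp k)%:E); last first.
  by rewrite lee_fin; have := ler_wpM2l k0 hm; lra.
(* At level 0 the inner radius would be 0, which [disc_area_scale] excludes; the area of the whole
   disc is used instead. *)
case: k mL k0 => [|k] mL k0.
  apply: (@le_trans _ _ (lam2 D1)).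
    apply: le_measure; rewrite ?inE//; first exact: measurable_disc.
    by move=> w [[]].
  apply: (le_trans (disc_area_le _ ler01)).
  by rewrite lee_fin hp0 expr1n; lra.
have hk1 : hp k.+1 <= 2^-1 :> R.
  have -> : 2^-1 = hp 1 :> R by rewrite /hp expr1.
  by rewrite hp_le.
have hk2 : hp k.+2 = hp k.+1 / 2 :> R by rewrite hpS.
have k1p := hp_gt0 R k.+1.
pose r : R := Num.sqrt (1 - hp k.+2); pose s : R := Num.sqrt (1 - hp k.+1).
have r2 : r ^+ 2 = 1 - hp k.+2 by rewrite sqr_sqrtr//; lra.
have s2 : s ^+ 2 = 1 - hp k.+1 by rewrite sqr_sqrtr//; lra.
have r0 : 0 < r by rewrite sqrtr_gt0; lra.
have s0 : 0 < s by rewrite sqrtr_gt0; lra.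
pose Dr : set plane := disc (0 : Cplx R) r; pose Ds : set plane := disc (0 : Cplx R) s.
have mDr : measurable Dr by exact: measurable_disc.
have mDs : measurable Ds by exact: measurable_disc.
have sub : level (near1 m) shell k.+1 `<=` Dr `\` Ds.
  move=> w [_ /andP[h1 h2]]; rewrite /shell in h1 h2.
  have m0' := modulus_ge0 (toC w); split.
    rewrite /Dr disc0E -(ltr_pXn2r (n:=2)) ?nnegrE ?(ltW r0)// r2; lra.
  rewrite /Ds disc0E; apply/negP; rewrite -leNgt.
  by rewrite -(ler_pXn2r (n:=2)) ?nnegrE ?(ltW s0)// s2; lra.
apply: (@le_trans _ _ (lam2 (Dr `\` Ds))).
  by apply: le_measure; rewrite ?inE//; exact: measurableD.
have [K hK] : exists K : R, lam2 (disc (0 : Cplx R) 1) = K%:E.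
  by exists (fine (lam2 (disc (0 : Cplx R) 1))); rewrite fineK// disc_area_fin.
have K4 : K <= 4.
  by have := disc_area_le (0 : Cplx R) (@ler01 R); rewrite hK expr1n mulr1 lee_fin.
have sr : s < r by rewrite -(ltr_pXn2r (n:=2)) ?nnegrE ?(ltW s0) ?(ltW r0)// r2 s2; lra.
have DsDr : Ds `<=` Dr by move=> w; rewrite /Ds /Dr !disc0E => /lt_trans; apply.
rewrite measureD//; last by rewrite ltey_eq disc_area_fin// ltW.
have -> : Dr `&` Ds = Ds by apply/setIidPr.
apply: (@le_trans _ _ ((r ^+ 2)%:E * K%:E - (s ^+ 2)%:E * K%:E)%E).
  rewrite le_eqVlt; apply/orP; left; apply/eqP.
  by rewrite -hK; congr (_ - _)%E; exact: disc_area_scale.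
rewrite -!EFinM -EFinB lee_fin r2 s2 hk2.
have := ler_wpM2l (ltW k1p) K4; lra.
Qed.

(** On the disc 1 - |w|^2 <= 2 |1 - w| <= 4 hp m, and 4 hp m <= hp k.+1 once m >= k + 3. *)
Lemma level_empty k m : (k.+2 < m)%N -> level (near1 m) shell k = set0.
Proof.
move=> km; apply/seteqP; split => // w [[hw h] /andP[h1 _]].
have := lt_le_trans h1 (shell_le hw).
have h4 : hp m <= hp k.+3 :> R by rewrite hp_le.
have e : hp k.+1 = 4 * hp k.+3 :> R by rewrite !hpS; field.
rewrite /= in h; lra.
Qed.

(** For negative alpha the bound is attained towards the lower end hp k / 2 of the level, hence the
    factor 2^|alpha|. *)
Lemma level_weight_le alpha k (D : set plane) w : level D shell k w ->
  weight alpha w <= 2 `^ `|alpha| * hp k `^ alpha.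
Proof.
move=> [_ /andP[h1 h2]]; rewrite /weight -/(shell w).
have x0 : 0 < shell w by apply: lt_trans h1; exact: hp_gt0.
have one : 1 <= 2 `^ `|alpha| :> R.
  have {1}-> : 1 = 2 `^ 0 :> R by rewrite powRr0.
  by rewrite ler_powR// ler1n.
have [a0|a0] := leP 0 alpha.
  apply: (@le_trans _ _ (hp k `^ alpha)); first by rewrite powR_le// ltW.
  by rewrite ler_peMl// powR_ge0.
apply: (@le_trans _ _ (hp k.+1 `^ alpha)).
  by rewrite powR_leN ?hp_gt0// ltW.
rewrite hpS powRM ?hp_ge0 ?invr_ge0// mulrC ler_wpM2r ?powR_ge0//.
by rewrite ltr0_norm// -powR_inv1// -powRrM mulN1r.
Qed.

(** Level k contributes about hp k ^ alpha times its area hp k hp m, that is hp m t^k with t =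
    2^(-(alpha + 1)) < 1. Only k >= m - 2 occurs, so the geometric series is of the order of hp m
    t^m. *)
Lemma weight_near1_le alpha : -1 < alpha -> exists2 C : R, 0 < C & forall m,
  (\int[lam2]_(w in near1 m) (weight alpha w)%:E <= (C * hp m `^ (alpha + 2))%:E)%E.
Proof.
move=> a1.
pose t : R := 2 `^ (- (alpha + 1)).
have t0 : 0 < t by exact: powR_gt0.
have t1 : t < 1.
  have {1}-> : 1 = 2 `^ 0 :> R by rewrite powRr0.
  rewrite /t !(powRN, powRr0) invf_lt1 ?powR_gt0//.
  have {1}-> : 1 = 1 `^ (alpha + 1) :> R by rewrite powR1.
  by apply: gt0_ltr_powR; rewrite ?nnegrE ?ltr1n//; lra.
have t01 : 0 <= t < 1 by rewrite (ltW t0).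
have hpt k : hp k `^ alpha * hp k = t ^+ k.
  have -> : hp k `^ alpha * hp k = hp k `^ (alpha + 1).
    by rewrite powR_add ?hp_gt0// powRr1 ?hp_ge0.
  by rewrite hp_powR.
pose B : R := 2 `^ `|alpha|.
have B0 : 0 < B by exact: powR_gt0.
pose C := 16 * B * t ^- 2 * (2 / (1 - t)).
have C0 : 0 < C by rewrite !mulr_gt0// ?invr_gt0 ?exprn_gt0// subr_gt0.
exists C => // m.
rewrite (@dyadic_integral R _ _ lam2 (near1 m) shell)//; last 5 first.
- exact: measurable_near1.
- exact: measurable_shell.
- by apply/measurable_EFinP; exact: measurable_weight.
- by move=> w _; rewrite lee_fin weight_ge0.
- by move=> w [hw _]; exact: shell01.
have -> : C * hp m `^ (alpha + 2) = 16 * B * t ^- 2 * hp m * t ^+ m * (2 / (1 - t)).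
  have -> : hp m `^ (alpha + 2) = hp m * t ^+ m.
    have e2 : hp m `^ 2 = hp m ^+ 2 :> R by rewrite (powR_mulrn 2) ?hp_ge0.
    by rewrite -hpt powR_add ?hp_gt0// e2; ring.
  rewrite /C; ring.
apply: nneseries_le.
  by move=> n; apply: integral_ge0 => w _; rewrite lee_fin weight_ge0.
move=> n.
(* For k + 2 >= m, t^k = t^-2 t^m t^(k + 2 - m); the last power is written with [dist] to use the
   summation bound for distance kernels. *)
apply: (@le_trans _ _ (\sum_(0 <= k < n) (16 * B * t ^- 2 * hp m * t ^+ m * t ^+ dist k.+2 m)%:E)%E).
  apply: lee_sum => k _.
  have [km|km] := ltnP k.+2 m.
    by rewrite level_empty// integral_set0 lee_fin !mulr_ge0// ?invr_ge0 ?exprn_ge0 ?hp_ge0// ltW.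
  have mL := measurable_level k (measurable_near1 m) (@measurable_shell (near1 m)).
  apply: (@le_trans _ _ (\int[lam2]_(w in level (near1 m) shell k) (B * hp k `^ alpha)%:E)%E).
    apply: ge0_le_integral => //.
    - by move=> w _; rewrite lee_fin weight_ge0.
    - by apply/measurable_EFinP; exact: measurable_weight.
    - by move=> w hw; rewrite lee_fin; exact: level_weight_le hw.
  rewrite integral_cst//.
  apply: (@le_trans _ _ ((B * hp k `^ alpha)%:E * (16 * hp k * hp m)%:E)%E).
    by rewrite lee_wpmul2l ?level_area_le// lee_fin mulr_ge0 ?powR_ge0// ltW.
  rewrite -EFinM lee_fin.
  have -> : B * hp k `^ alpha * (16 * hp k * hp m) = 16 * B * hp m * (hp k `^ alpha * hp k) by ring.
  rewrite hpt.
  have -> : 16 * B * t ^- 2 * hp m * t ^+ m * t ^+ dist k.+2 m =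
     16 * B * hp m * (t ^- 2 * (t ^+ m * t ^+ dist k.+2 m)) by ring.
  rewrite -exprD /dist (eqP (_ : m - k.+2 == 0)%N) ?subn_eq0// addn0 subnKC//.
  rewrite ler_wpM2l ?mulr_ge0 ?hp_ge0 ?(ltW B0)//.
  by rewrite -[k.+2]/(2 + k)%N exprD mulrA mulVf ?mul1r// expf_neq0// gt_eqF.
rewrite sumEFin lee_fin -mulr_sumr ler_wpM2l//.
  by rewrite !mulr_ge0// ?invr_ge0 ?exprn_ge0 ?hp_ge0// ltW.
apply: le_trans (geometric_dist_sum_le n.+2 m t01).
rewrite [leRHS]big_nat_recl//= [in leRHS]big_nat_recl//= addrA lerDr.
by rewrite addr_ge0// exprn_ge0// ltW.
Qed.

End WeightIntegral.

(** * Growth of f along the radius and the discrete Hardy inequality *)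

Section RadialGrowth.
Variable R : realType.
Local Notation plane := (plane R).
Local Notation lam2 := (@lam2 R).
Local Notation D1 := (disc (0 : Cplx R)%R 1 : set plane).
Variables p alpha : R.
Hypothesis p1 : 1 < p.
Hypothesis alpha_gt : p - 2 < alpha.
Hypothesis alpha_le : alpha <= p - 1.

Definition beta : R := (alpha + 2) / p.

Lemma p_gt0 : 0 < p. Proof. by rewrite (lt_trans _ p1). Qed.

Lemma beta_p : beta * p = alpha + 2.
Proof. by rewrite /beta mulfVK// gt_eqF// p_gt0. Qed.

Lemma beta_gt1 : 1 < beta.
Proof.
rewrite /beta ltr_pdivlMr ?p_gt0// mul1r.
by have := alpha_gt; rewrite ltrBlDr.
Qed.

Lemma beta_lt2 : beta < 2.
Proof.
rewrite /beta ltr_pdivrMr ?p_gt0// (le_lt_trans (y := p - 1 + 2))//.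
  by rewrite lerD2r.
by have := p1; lra.
Qed.

(** Common decay exponent: beta - 1 for the Hardy sum, 2 - beta for [hardy_kernel] with j > m. *)
Definition tau : R := Num.min (beta - 1) (2 - beta).

Lemma tau_gt0 : 0 < tau.
Proof. by rewrite lt_min !subr_gt0 beta_gt1 beta_lt2. Qed.

Definition theta : R := 2 `^ (- tau).

Lemma theta_gt0 : 0 < theta. Proof. exact: powR_gt0. Qed.

Lemma theta_lt1 : theta < 1.
Proof.
rewrite /theta powRN invf_lt1 ?powR_gt0//.
have {1}-> : 1 = 1 `^ tau :> R by rewrite powR1.
by apply: gt0_ltr_powR; rewrite ?nnegrE ?ltr1n// tau_gt0.
Qed.

Lemma theta01 : 0 <= theta < 1.
Proof. by rewrite theta_lt1 ltW// theta_gt0. Qed.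

Lemma hp_powR_le n g : tau <= g -> hp n `^ g <= theta ^+ n.
Proof.
move=> tg; rewrite hp_powR; apply: lerXn2r; rewrite ?nnegrE ?powR_ge0//.
by rewrite /theta; apply: ler_powR; rewrite ?ler1n// lerN2.
Qed.

(** Taken at h = f', this is the integral in the Dirichlet norm without its factor (alpha + 1) /
    pi. *)
Definition energy (h : Cplx R -> Cplx R) (D : set plane) : \bar R :=
  (\int[lam2]_(w in D) (weight alpha w * modulus (h (toC w)) `^ p)%:E)%E.

Definition depth (w : plane) : R := 1 - modulus (toC w).

Lemma measurable_depth (D : set plane) : measurable_fun D depth.
Proof. by apply: measurable_funB => //; apply: measC_modulus; exact: measC_toC. Qed.

Lemma depth01 w : D1 w -> 0 < depth w <= 1.
Proof. by rewrite disc0E /depth subr_gt0 lerBlDr lerDl modulus_ge0 andbT. Qed.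

Lemma measurable_energy_density (b : nat -> Cplx R) (D : set plane) : abs_conv b ->
  D `<=` D1 ->
  measurable_fun D (fun w => (weight alpha w * modulus (ps b (toC w)) `^ p)%:E).
Proof.
move=> hb hD; apply/measurable_EFinP; apply: measurable_funM; first exact: measurable_weight.
apply: measurable_powR_fun; apply: measC_modulus; apply: measC_ps => //.
by move=> w /hD; rewrite disc0E.
Qed.

Lemma energy_density_ge0 h w : (0 <= (weight alpha w * modulus (h (toC w)) `^ p)%:E)%E.
Proof. by rewrite lee_fin mulr_ge0 ?powR_ge0// weight_ge0. Qed.

Lemma energy_ge0 h D : (0 <= energy h D)%E.
Proof. by apply: integral_ge0 => w _; exact: energy_density_ge0. Qed.

(* Wide enough to contain the disc of centre c and radius (1 - |c|) / 2 whenever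
   2^-(j+1) <= 1 - |c| <= 2^-j. *)
Definition annulus (j : nat) : set plane :=
  D1 `&` [set w | hp j.+2 < depth w < 4 * hp j.+1].

Lemma measurable_annulus j : measurable (annulus j).
Proof.
have -> : annulus j = D1 `&` depth @^-1` `]hp j.+2, 4 * hp j.+1[.
  by apply/seteqP; split => w; rewrite /annulus/= in_itv/=.
by apply: (@measurable_depth D1); [exact: measurable_disc|exact: measurable_itv].
Qed.

(** An annulus meets only the dyadic levels at distance at most 1. Dominating this incidence by 2
    (1/2)^dist allows summation over j by the distance kernel, which gives 2 times 4. *)
Lemma energy_annulus_sum (b : nat -> Cplx R) : abs_conv b ->
  (\sum_(0 <= j <oo) energy (ps b) (annulus j) <= 8%:E * energy (ps b) D1)%E.
Proof.
move=> hb; pose t : R := 2^-1.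
have t01 : 0 <= t < 1 by rewrite /t invr_ge0 invf_lt1 ?ltr1n// ler0n.
have t0 : 0 <= t by case/andP: t01.
pose f w := (weight alpha w * modulus (ps b (toC w)) `^ p)%:E.
have mf D : D `<=` D1 -> measurable_fun D f by move=> ?; exact: measurable_energy_density.
have f0 w : (0 <= f w)%E by exact: energy_density_ge0.
pose Y i := energy (ps b) (level D1 depth i).
have Y0 i : (0 <= Y i)%E by exact: energy_ge0.
have sub j : annulus j `<=` D1 by move=> w [].
have mD1 : measurable D1 by exact: measurable_disc.
have mY i : measurable (level D1 depth i).
  by apply: measurable_level => //; exact: measurable_depth.
have XE j : energy (ps b) (annulus j) = (\sum_(0 <= i <oo) energy (ps b) (level (annulus j) depth i))%E.
  apply: dyadic_integral.
  - exact: measurable_annulus.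
  - exact: measurable_depth.
  - exact: mf.
  - by move=> w _; exact: f0.
  - by move=> w /sub; exact: depth01.
have XY i j : (energy (ps b) (level (annulus j) depth i) <= (2 * t ^+ dist i j)%:E * Y i)%E.
  have [ij|ij] := leqP (dist i j) 1.
    apply: (@le_trans _ _ (Y i)).
      apply: ge0_subset_integral => //.
      - by apply: measurable_level; [exact: measurable_annulus|exact: measurable_depth].
      - by apply: mf => w [].
      - by move=> w _; exact: f0.
      - by move=> w [/sub ? ?]; split.
    rewrite -{1}[Y i]mul1e lee_wpmul2r// lee_fin.
    have : t ^+ 1 <= t ^+ dist i j by rewrite ler_wiXn2l// ltW//; case/andP: t01.
    by rewrite expr1 /t; lra.
  have -> : level (annulus j) depth i = set0.
    apply/seteqP; split => // w [[_ /andP[h1 h2]] /andP[h3 h4]].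
    have := lt_le_trans h1 h4; rewrite hp_lt => ij2.
    have := lt_trans h3 h2.
    have -> : hp i.+1 = 4 * hp i.+3 :> R by rewrite !hpS; field.
    rewrite ltr_pM2l// hp_lt => ji2.
    move: ij; rewrite /dist ltnNge => /negP; apply.
    have [le|lt] := leqP i j.
      by rewrite (eqP (_ : i - j == 0)%N) ?subn_eq0// add0n leq_subLR addn1 -ltnS -ltnS.
    rewrite (eqP (_ : j - i == 0)%N) ?subn_eq0 ?(ltnW lt)// addn0 leq_subLR addn1.
    by rewrite -ltnS.
  by rewrite /energy integral_set0 mule_ge0// lee_fin mulr_ge0// exprn_ge0.
apply: (@le_trans _ _ (\sum_(0 <= j <oo) \sum_(0 <= i <oo) (2 * t ^+ dist i j)%:E * Y i)%E).
  apply: lee_nneseries => j _; first by move=> *; exact: energy_ge0.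
  rewrite XE; apply: lee_nneseries => i _; first by move=> *; exact: energy_ge0.
  exact: XY.
have K0 i j : (0 <= (2 * t ^+ dist i j)%:E * Y i)%E.
  by rewrite mule_ge0// lee_fin mulr_ge0// exprn_ge0.
rewrite nneseries_interchange//.
have -> : energy (ps b) D1 = (\sum_(0 <= i <oo) Y i)%E.
  apply: dyadic_integral => //.
  - exact: measurable_depth.
  - exact: mf.
  - by move=> w _; exact: f0.
  - exact: depth01.
rewrite -nneseriesZl//.
apply: lee_nneseries => i _; first by move=> *; apply: nneseries_ge0 => j _ _; exact: K0.
have [->|Yfin] := eqVneq (Y i) +oo%E; first by rewrite gt0_muley ?leey// lte_fin.
have [v hv] : exists v, Y i = v%:E.
  by exists (fine (Y i)); rewrite fineK// ge0_fin_numE// ltey.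
have v0 : 0 <= v by rewrite -lee_fin -hv.
rewrite hv (@eq_eseriesr _ _ (fun j => (v * 2)%:E * (t ^+ dist i j)%:E)%E); last first.
  by move=> j _; rewrite -!EFinM; congr EFin; ring.
rewrite nneseriesZl; last by move=> j _; rewrite lee_fin exprn_ge0.
have -> : (8%:E * v%:E = (v * 2)%:E * (4%:E : \bar R))%E.
  by rewrite -!EFinM; congr EFin; ring.
apply: lee_wpmul2l; first by rewrite lee_fin mulr_ge0.
under eq_eseriesr do rewrite distC.
apply: le_trans (dist_kernel_sum i t01) _.
by rewrite lee_fin /t le_eqVlt; apply/orP; left; apply/eqP; field.
Qed.

(** The constant of [pointwise_bound], times the price of replacing the radius, at least [hp j.+2],
    by [hp j]. *)
Definition point_const : R := (4 + 6 `^ `|alpha|) * hp 2 `^ (- beta).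

Lemma point_const_gt0 : 0 < point_const.
Proof. by rewrite mulr_gt0 ?powR_gt0 ?hp_gt0// addr_gt0// powR_gt0. Qed.

(** x j is the p-th root of the energy of the j-th annulus, which contains the discs used in
    [pointwise_bound]. *)
Lemma radial_samples (b : nat -> Cplx R) (L : R) : abs_conv b ->
  (energy (ps b) D1 <= (L `^ p)%:E)%E ->
  exists x : nat -> R, [/\ forall j, 0 <= x j,
    (\sum_(0 <= j <oo) (x j `^ p)%:E <= (8 * L `^ p)%:E)%E &
    forall j c, 0 <= c -> hp j.+1 <= 1 - c <= hp j ->
      modulus (ps b c%:C%C) <= point_const * (hp j `^ (- beta) * x j)].
Proof.
move=> hb hE; have p0 := p_gt0.
have sub j : annulus j `<=` D1 by move=> w [].
have Xfin j : energy (ps b) (annulus j) \is a fin_num.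
  rewrite ge0_fin_numE ?energy_ge0//; apply: le_lt_trans (ltry (L `^ p)).
  apply: le_trans hE; apply: ge0_subset_integral => //.
  - exact: measurable_annulus.
  - exact: measurable_disc.
  - exact: measurable_energy_density.
  - by move=> w _; exact: energy_density_ge0.
pose X j := fine (energy (ps b) (annulus j)).
have XE j : energy (ps b) (annulus j) = (X j)%:E by rewrite fineK.
have X0 j : 0 <= X j by rewrite -lee_fin -XE energy_ge0.
pose x j := X j `^ p^-1.
have x0 j : 0 <= x j by exact: powR_ge0.
have xp j : x j `^ p = X j by rewrite -powRrM mulVf ?gt_eqF// powRr1.
exists x; split => //.
  under eq_eseriesr do rewrite xp -XE.
  apply: le_trans (energy_annulus_sum hb) _.
  by rewrite EFinM lee_wpmul2l// lee_fin.
move=> j c c0 /andP[cj1 cj2].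
pose r := (1 - c) / 2.
have hj := hp_gt0 R j.+1.
have r0 : 0 < r by rewrite divr_gt0// (lt_le_trans hj).
have cE : modulus (c%:C%C : Cplx R) = 1 - 2 * r by rewrite modulus_real ger0_norm// /r; field.
have rj : hp j.+2 <= r by rewrite hpS /r; lra.
have k0 : 0 < point_const * hp j `^ (- beta).
  by rewrite mulr_gt0 ?point_const_gt0// powR_gt0// hp_gt0.
have discsub : disc (c%:C%C : Cplx R) r `<=` annulus j.
  move=> w hw; have h1 := disc_sub hw.
  have h2 : modulus (c%:C%C : Cplx R) - r < modulus (toC w).
    by rewrite ltrBlDr -ltrBlDl (le_lt_trans (modulusB _ _))// modulusBC.
  move: h1 h2; rewrite cE => h1 h2.
  split; first by rewrite disc0E; lra.
  have e : hp j = 2 * hp j.+1 :> R by rewrite hpS; field.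
  rewrite /= /depth; apply/andP; split; first lra.
  by move: cj2; rewrite e /r in h2 *; lra.
apply/ler_addgt0Pr => e e0.
(* x j may vanish, whereas [pointwise_bound] needs a positive s; the increment costs e in the
   end. *)
pose s := x j + e / (point_const * hp j `^ (- beta)).
have s0 : 0 < s by rewrite ltr_wpDl// divr_gt0.
have xs : x j <= s by rewrite lerDl ltW// divr_gt0.
have := @pointwise_bound R b p alpha r s c%:C%C hb (ltW p1) r0 cE s0.
rewrite -/beta => H.
apply: (@le_trans _ _ ((4 + 6 `^ `|alpha|) * (r `^ (- beta) * s))).
  apply: H.
  apply: (@le_trans _ _ (energy (ps b) (annulus j))).
    apply: ge0_subset_integral => //.
    - exact: measurable_disc.
    - exact: measurable_annulus.
    - exact: measurable_energy_density.
    - by move=> w _; exact: energy_density_ge0.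
  by rewrite XE lee_fin -xp powR_le// ltW.
have b0 : 0 < beta by rewrite (lt_trans _ beta_gt1).
have -> : point_const * (hp j `^ (- beta) * x j) + e = (4 + 6 `^ `|alpha|) * (hp j.+2 `^ (- beta) * s).
  have -> : hp j.+2 `^ (- beta) = hp 2 `^ (- beta) * hp j `^ (- beta) :> R.
    by rewrite -powRM ?hp_ge0// -hpD.
  have -> : (4 + 6 `^ `|alpha|) * (hp 2 `^ (- beta) * hp j `^ (- beta) * s) = (point_const * hp j `^ (- beta)) * s.
    by rewrite /point_const; ring.
  rewrite /s mulrDr [(point_const * hp j `^ (- beta)) * (e / _)]mulrCA divff ?gt_eqF//; ring.
rewrite ler_wpM2l ?addr_ge0 ?powR_ge0// ler_wpM2r ?(ltW s0)//.
by rewrite powR_leN ?hp_gt0// oppr_le0 ltW.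
Qed.

(** Induction along the dyadic points 1 - hp i: a segment at level i has length at most hp i, and f'
    is at most M i on it. *)
Lemma radial_growth f a (M : nat -> R) : taylor_disc f a -> (forall j, 0 <= M j) ->
  (forall j c, 0 <= c -> hp j.+1 <= 1 - c <= hp j -> modulus (ps (dcoef a) c%:C%C) <= M j) ->
  forall j t, 0 <= t -> hp j.+1 <= 1 - t <= hp j ->
  modulus (f t%:C%C) <= modulus (f 0) + \sum_(0 <= i < j.+1) hp i * M i.
Proof.
move=> fa M0 HM; elim=> [|j IH] t t0 /andP[t1 t2].
  rewrite big_nat1 hp0 mul1r.
  have h1 := hp_gt0 R 1.
  have := @modulus_increment R f a 0 t (M 0%N) fa (lexx 0) t0.
  have tl : t < 1 by lra.
  move=> /(_ tl) H.
  have hb : forall u, 0 <= u <= t -> modulus (ps (dcoef a) u%:C%C) <= M 0%N.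
    move=> u /andP[u0 ut]; apply: HM => //; rewrite hp0; apply/andP; split; lra.
  have := H hb; rewrite subr0 => h.
  rewrite -lerBlDl (le_trans (modulusB _ _))// (le_trans h)//.
  by rewrite ler_piMr// ltW.
pose s : R := 1 - hp j.+1.
have hj2 := hp_gt0 R j.+2.
have s0 : 0 <= s by rewrite subr_ge0 hp_le1.
have st : s <= t by rewrite /s; lra.
have tl : t < 1 by lra.
have hb : forall u, s <= u <= t -> modulus (ps (dcoef a) u%:C%C) <= M j.+1.
  move=> u /andP[su ut]; apply: HM; first exact: le_trans su.
  by rewrite /s in su; apply/andP; split; lra.
have := @modulus_increment R f a s t (M j.+1) fa s0 st tl hb => h.
have := IH s s0; rewrite {1 2}/s subKr lexx hp_le leqnSn => /(_ isT) h2.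
rewrite big_nat_recr//= addrA.
apply: (@le_trans _ _ (modulus (f s%:C%C) + M j.+1 * (t - s))).
  by rewrite -lerBlDl (le_trans (modulusB _ _)).
rewrite lerD// mulrC ler_wpM2r//; rewrite /s; lra.
Qed.

(** Keeping hp j ^- 2 for j <= m leaves the power beta of hp (m - j); keeping hp m ^- 2 for j > m
    leaves the power 2 - beta of hp (j - m). Both exponents are at least tau. *)
Lemma hardy_kernel m j : hp m `^ beta * (hp j * Num.min (hp j ^- 2) (hp m ^- 2)) <=
  theta ^+ dist j m * hp j `^ (beta - 1).
Proof.
have hj := hp_gt0 R j; have hm := hp_gt0 R m.
have e1 : hp j = hp j `^ (2 - beta) * hp j `^ (beta - 1) :> R.
  by rewrite -powR_add// (_ : 2 - beta + (beta - 1) = 1) ?powRr1 ?hp_ge0//; ring.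
have inv2 (n : nat) : hp n ^- 2 = hp n `^ (- 2) :> R.
  by rewrite -[2 in RHS]/(2%:R) powR_invn ?hp_ge0.
rewrite {1}e1.
set q := hp j `^ (beta - 1); have q0 : 0 <= q by exact: powR_ge0.
have -> : hp m `^ beta * (hp j `^ (2 - beta) * q * Num.min (hp j ^- 2) (hp m ^- 2)) =
   (hp m `^ beta * hp j `^ (2 - beta) * Num.min (hp j ^- 2) (hp m ^- 2)) * q by ring.
rewrite ler_wpM2r//.
have [jm|mj] := leqP j m.
  apply: (@le_trans _ _ (hp m `^ beta * hp j `^ (2 - beta) * hp j ^- 2)).
    by rewrite ler_wpM2l ?mulr_ge0 ?powR_ge0// ge_min lexx.
  rewrite /dist (eqP (_ : j - m == 0)%N) ?subn_eq0// add0n.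
  apply: le_trans (_ : hp (m - j) `^ beta <= _).
    rewrite inv2 -mulrA -powR_add// (_ : 2 - beta + - 2 = - beta); last by ring.
    rewrite -{1}(subnK jm) hpD powRM ?hp_ge0// -mulrA -powR_add// subrr powRr0 mulr1//.
  by apply: hp_powR_le; rewrite /tau ge_min; apply/orP; left; rewrite gerBl.
apply: (@le_trans _ _ (hp m `^ beta * hp j `^ (2 - beta) * hp m ^- 2)).
  by rewrite ler_wpM2l ?mulr_ge0 ?powR_ge0// ge_min lexx orbT.
rewrite /dist (eqP (_ : m - j == 0)%N) ?subn_eq0 ?(ltnW mj)// addn0.
apply: le_trans (_ : hp (j - m) `^ (2 - beta) <= _).
  rewrite inv2 mulrAC -powR_add// (_ : beta + - 2 = - (2 - beta)); last by ring.
  rewrite -{1}(subnK (ltnW mj)) hpD powRM ?hp_ge0// mulrC -mulrA -powR_add// subrr powRr0 mulr1//.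
by apply: hp_powR_le; rewrite /tau ge_min lexx orbT.
Qed.

Lemma hardy_bound : exists2 K : R, 0 < K & forall f a (L : R), 0 < L ->
  taylor_disc f a -> modulus (f 0) <= L -> (energy (ps (dcoef a)) D1 <= (L `^ p)%:E)%E ->
  exists F : nat -> R, [/\ forall j, 0 <= F j,
    forall j t, 0 <= t -> hp j.+1 <= 1 - t <= hp j -> modulus (f t%:C%C) <= F j &
    (\sum_(0 <= m <oo)
       (\sum_(0 <= j <oo) (theta ^+ dist j m * (hp j `^ (beta - 1) * F j))%:E) `^ p <=
     (K * L `^ p)%:E)%E].
Proof.
have [K K0 HK] := young_geometric theta01 (ltW p1).
have p0 := p_gt0.
pose C := 1 + point_const.
have pc0 := point_const_gt0.
have C0 : 0 < C by rewrite addr_gt0.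
(* K occurs twice because Young's inequality is applied to the outer kernel and to the Hardy sums.
   The factor 9 is 8 for the samples plus 1 for the added L, and 2^p comes from (x + L)^p <= 2^p
   (x^p + L^p). *)
exists (K * (C `^ p * (K * (9 * 2 `^ p)))).
  by rewrite !mulr_gt0 ?powR_gt0.
move=> f a L L0 fa f0L hE.
have ha := taylor_abs_conv fa.
have [x [x0 xs xb]] := radial_samples (abs_conv_dcoef ha) hE.
pose M j := point_const * (hp j `^ (- beta) * x j).
have M0 j : 0 <= M j by rewrite !mulr_ge0 ?powR_ge0// ltW.
pose F j := modulus (f 0) + \sum_(0 <= i < j.+1) hp i * M i.
have F0 j : 0 <= F j.
  by rewrite addr_ge0 ?modulus_ge0// sumr_ge0// => i _; rewrite mulr_ge0// hp_ge0.
exists F; split=> //.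
  by move=> j t t0 ht; apply: (radial_growth fa M0 xb).
(* The term |f(0)| <= L is stored in sample 0, so that F j becomes a pure kernel sum. *)
pose xt i := x i + (if i == 0%N then L else 0).
have xt0 i : 0 <= xt i by rewrite addr_ge0//; case: ifP => // _; rewrite ltW.
pose y j := hp j `^ (beta - 1) * F j.
have y0 j : 0 <= y j by rewrite mulr_ge0// powR_ge0.
have tp : forall n, 0 <= theta ^+ n by move=> n; rewrite exprn_ge0// ltW// theta_gt0.
have yle j : ((y j)%:E <= C%:E * \sum_(0 <= i <oo) (theta ^+ dist i j * xt i)%:E)%E.
  apply: (@le_trans _ _ (C%:E * \sum_(0 <= i < j.+1) (theta ^+ dist i j * xt i)%:E)%E); last first.
    rewrite lee_wpmul2l ?lee_fin ?(ltW C0)//.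
    by apply: nneseries_lim_ge => i _; rewrite lee_fin mulr_ge0.
  rewrite sumEFin -EFinM lee_fin /y /F mulrDr mulr_sumr /C mulrDl mul1r.
  have hpb i : hp i * M i = point_const * (hp i `^ (1 - beta) * x i).
    rewrite /M powR_add ?hp_gt0// powRr1 ?hp_ge0//; ring.
  apply: lerD.
    rewrite big_nat_recl//= /xt /= {1}/dist subn0 sub0n add0n.
    apply: (@le_trans _ _ (theta ^+ j * (x 0%N + L))).
      apply: ler_pM; rewrite ?powR_ge0 ?modulus_ge0//.
        by apply: hp_powR_le; rewrite /tau ge_min lexx.
      by rewrite (le_trans f0L)// lerDr.
    by rewrite lerDl sumr_ge0// => i _; rewrite mulr_ge0// xt0.
  rewrite mulr_sumr; rewrite [leLHS]big_nat [leRHS]big_nat; apply: ler_sum => i /andP[_ ij].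
  rewrite hpb mulrCA ler_wpM2l ?(ltW pc0)// mulrA.
  apply: ler_pM; rewrite ?mulr_ge0 ?powR_ge0//; last first.
    by rewrite /xt lerDl; case: ifP => // _; exact: ltW.
  rewrite ltnS in ij.
  rewrite /dist (eqP (_ : i - j == 0)%N) ?subn_eq0// add0n.
  rewrite -{1}(subnK ij) hpD powRM ?hp_ge0// -mulrA -powR_add ?hp_gt0//.
  rewrite (_ : beta - 1 + (1 - beta) = 0); last by ring.
  rewrite powRr0 mulr1; apply: hp_powR_le; by rewrite /tau ge_min lexx.
apply: (le_trans (HK y y0)).
rewrite [leRHS](_ : _ = (K%:E * (C `^ p * (K * (9 * 2 `^ p)) * L `^ p)%:E)%E); last first.
  by rewrite -EFinM; congr EFin; ring.
rewrite lee_wpmul2l ?lee_fin ?(ltW K0)//.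
apply: (@le_trans _ _ (\sum_(0 <= j <oo) ((C `^ p)%:E * (\sum_(0 <= i <oo) (theta ^+ dist i j * xt i)%:E) `^ p))%E).
  apply: lee_nneseries => j _; first by move=> *; rewrite lee_fin powR_ge0.
  have s0 : (0 <= \sum_(0 <= i <oo) (theta ^+ dist i j * xt i)%:E)%E.
    by apply: nneseries_ge0 => i _ _; rewrite lee_fin mulr_ge0.
  rewrite -!poweR_EFin -poweRM//; last by rewrite lee_fin ltW.
  apply: gt0_ler_poweR; rewrite ?(ltW p0)//.
  - by rewrite in_itv/= leey andbT lee_fin.
  - by rewrite in_itv/= leey andbT mule_ge0// lee_fin ltW.
rewrite nneseriesZl; last by move=> j _; rewrite poweR_ge0.
have -> : C `^ p * (K * (9 * 2 `^ p)) * L `^ p = C `^ p * (K * (9 * 2 `^ p * L `^ p)) by ring.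
rewrite EFinM lee_wpmul2l ?lee_fin ?powR_ge0//.
apply: (le_trans (HK xt xt0)).
rewrite EFinM lee_wpmul2l ?lee_fin ?(ltW K0)//.
apply: (@le_trans _ _ (\sum_(0 <= i <oo) ((2 `^ p)%:E * ((x i `^ p)%:E + (if i == 0%N then (L `^ p)%:E else 0))))%E).
  apply: lee_nneseries => i _; first by move=> *; rewrite lee_fin powR_ge0.
  rewrite /xt; case: ifP => _; last first.
    rewrite adde0 addr0 -EFinM lee_fin ler_peMl ?powR_ge0//.
    have {1}-> : 1 = 1 `^ p :> R by rewrite powR1.
    by rewrite powR_le ?ler1n// ltW.
  rewrite -EFinD -EFinM lee_fin.
  have [xL|Lx] := leP (x i) L.
    apply: (@le_trans _ _ ((2 * L) `^ p)).
      by rewrite powR_le ?(ltW p0)// ?addr_ge0 ?(ltW L0)//; lra.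
    by rewrite powRM ?(ltW L0)// ler_wpM2l ?powR_ge0// lerDr powR_ge0.
  apply: (@le_trans _ _ ((2 * x i) `^ p)).
    by rewrite powR_le ?(ltW p0)// ?addr_ge0 ?(ltW L0)//; lra.
  by rewrite powRM// ler_wpM2l ?powR_ge0// lerDl powR_ge0.
have ite0 i : (0 <= (if i == 0%N then (L `^ p)%:E else 0 : \bar R))%E.
  by case: ifP => // _; rewrite lee_fin powR_ge0.
rewrite nneseriesZl; last first.
  by move=> i _; rewrite adde_ge0// lee_fin powR_ge0.
rewrite nneseriesD; last 2 first.
- by move=> i _ _; rewrite lee_fin powR_ge0.
- by move=> i _ _.
have -> : (9 * 2 `^ p * L `^ p)%:E = ((2 `^ p)%:E * ((8 * L `^ p)%:E + (L `^ p)%:E))%E.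
  by rewrite -EFinD -EFinM; congr EFin; ring.
rewrite lee_wpmul2l ?lee_fin ?powR_ge0//.
apply: leeD => //.
apply: nneseries_le => // n.
case: n => [|n]; first by rewrite big_nil lee_fin powR_ge0.
by rewrite big_nat_recl//= big1 ?adde0.
Qed.

End RadialGrowth.

(** * Growth of the sums of |a_k| t^k *)

Section CoefficientGrowth.
Variable R : realType.
Local Notation plane := (plane R).
Local Notation lam2 := (@lam2 R).
Local Notation D1 := (disc (0 : Cplx R)%R 1 : set plane).
Variables p alpha : R.
Hypothesis p1 : 1 < p.
Hypothesis alpha_gt : p - 2 < alpha.
Hypothesis alpha_le : alpha <= p - 1.
Local Notation beta := (beta p alpha).
Local Notation energy := (energy p alpha).

(** Exponent of the lower bound for the weight on |w| < 1 - hp j: for alpha <= 0 the weight is at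
    least 1. *)
Definition alpha_pos : R := Num.max alpha 0.

Lemma weight_ge_hp j (w : plane) : modulus (toC w) < 1 - hp j ->
  hp j `^ alpha_pos <= weight alpha w.
Proof.
move=> h; have m0 := modulus_ge0 (toC w); have hj := hp_gt0 R j.
have h1 : hp j <= 1 - modulus (toC w) ^+ 2.
  have : modulus (toC w) ^+ 2 <= modulus (toC w) by rewrite expr2 ler_piMr//; lra.
  lra.
rewrite /alpha_pos /weight; have [a0|a0] := leP alpha 0.
  rewrite powRr0; have {1}-> : 1 = 1 `^ alpha :> R by rewrite powR1.
  apply: powR_leN => //; first exact: lt_le_trans h1.
  by rewrite gerBl sqr_ge0.
by rewrite powR_le// ltW.
Qed.

(** Common end of the cases p >= 2 and p < 2, which differ in the pointwise domination of the
    square; 4 bounds the area of the disc. *)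
Lemma square_integral_le (b : nat -> Cplx R) (L A B : R) j : abs_conv b -> 0 <= A -> 0 <= B ->
  (energy (ps b) D1 <= (L `^ p)%:E)%E ->
  (forall w, modulus (toC w) < 1 - hp j -> modulus (ps b (toC w)) ^+ 2 <=
    A + B * (weight alpha w * modulus (ps b (toC w)) `^ p)) ->
  (\int[lam2]_(w in disc (0 : Cplx R)%R (1 - hp j)%R) (modulus (ps b (toC w)) ^+ 2)%:E <=
   (4 * A + B * L `^ p)%:E)%E.
Proof.
move=> hb A0 B0 hE hAB.
have mD := measurable_disc (0 : Cplx R) (1 - hp j).
have sub : disc (0 : Cplx R) (1 - hp j) `<=` D1.
  by move=> w; rewrite !disc0E => h; have := hp_gt0 R j; lra.
have mh : measurable_fun (disc (0 : Cplx R) (1 - hp j)) (fun w => modulus (ps b (toC w))).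
  by apply: measC_modulus; apply: measC_ps => // w /sub; rewrite disc0E.
have md := @measurable_energy_density R p alpha b _ hb sub.
apply: (@le_trans _ _ (\int[lam2]_(w in disc (0 : Cplx R)%R (1 - hp j)%R)
   (A%:E + B%:E * (weight alpha w * modulus (ps b (toC w)) `^ p)%:E))%E).
  apply: ge0_le_integral => //.
  - by move=> w _; rewrite lee_fin sqr_ge0.
  - by apply/measurable_EFinP; exact: measurable_funX.
  - by apply: emeasurable_funD => //; apply: emeasurable_funM.
  - by move=> w; rewrite disc0E -EFinM -EFinD lee_fin; exact: hAB.
rewrite ge0_integralD//; last 2 first.
- by move=> w _; rewrite mule_ge0// energy_density_ge0.
- by apply: emeasurable_funM.
rewrite integral_cst// ge0_integralZl_EFin//; last first.
  by move=> w _; exact: energy_density_ge0.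
rewrite EFinD !EFinM [(4%:E * _)%E]muleC; apply: leeD; apply: lee_wpmul2l => //.
  have h1 : 0 <= 1 - hp j :> R by rewrite subr_ge0 hp_le1.
  apply: (le_trans (disc_area_le _ h1)); rewrite lee_fin ler_piMr// expr_le1//.
  by rewrite gerBl hp_ge0.
apply: le_trans hE; apply: ge0_subset_integral => //.
- exact: measurable_disc.
- exact: measurable_energy_density.
- by move=> w _; exact: energy_density_ge0.
Qed.

(* Here |h|^2 <= L^2 + L^(2-p) |h|^p with L a power of 2^j; for p < 2 one uses
   instead |h|^2 <= L^(2-p) |h|^p with L the pointwise bound of h. *)
Lemma ps_square_integral_ge2 (b : nat -> Cplx R) (L : R) : 2 <= p -> abs_conv b -> 0 < L ->
  (energy (ps b) D1 <= (L `^ p)%:E)%E ->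
  exists v C : R, [/\ 0 < v < 2, 0 < C & forall j,
    (\int[lam2]_(w in disc (0 : Cplx R)%R (1 - hp j)%R) (modulus (ps b (toC w)) ^+ 2)%:E <=
     (C * (v ^+ 2) ^+ j)%:E)%E].
Proof.
move=> p2 hb L0 hE; have p0 := p_gt0 p1.
(* Chosen so that (v^j)^p is the inverse of the lower bound [hp j] ^ [alpha_pos] for the weight; g <
   1 because alpha <= p - 1. *)
pose g := alpha_pos / p.
have g0 : 0 <= g by rewrite divr_ge0 ?(ltW p0)// le_max lexx orbT.
have g1 : g < 1.
  rewrite ltr_pdivrMr// mul1r /alpha_pos gt_max p0 andbT.
  by rewrite (le_lt_trans alpha_le)// gtrBl.
have gp : g * p = alpha_pos by rewrite mulfVK// gt_eqF.
pose v : R := 2 `^ g.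
have v0 : 0 < v by exact: powR_gt0.
have v2 : v < 2.
  have e : 2 = 2 `^ 1 :> R by rewrite powRr1.
  rewrite [ltRHS]e.
  by rewrite /v /powR pnatr_eq0/= ltr_expR ltr_pM2r// ln_gt0// ltr1n.
pose C := 4 + L `^ p.
have C0 : 0 < C by rewrite addr_gt0// powR_gt0.
exists v, C; split => //; first by rewrite v0.
move=> j; pose Lm := v ^+ j.
have Lm0 : 0 < Lm by rewrite exprn_gt0.
have hpv : hp j `^ alpha_pos = (Lm `^ p)^-1.
  have powRX (x : R) : 0 <= x -> (x ^+ j) `^ p = (x `^ p) ^+ j.
    by move=> x0; rewrite -!powR_mulrn ?powR_ge0// -!powRrM mulrC.
  by rewrite hp_powR powRN exprVn -gp powRrM /Lm powRX ?ltW.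
have -> : C * (v ^+ 2) ^+ j = 4 * Lm ^+ 2 + Lm ^+ 2 * L `^ p.
  by rewrite /C /Lm exprAC; ring.
apply: square_integral_le => //; rewrite ?sqr_ge0// => w Dw.
set u := modulus (ps b (toC w)); have u0 : 0 <= u by exact: modulus_ge0.
have [uL|Lu] := leP u Lm.
  apply: (@le_trans _ _ (Lm ^+ 2)); first by rewrite lerXn2r ?nnegrE// ltW.
  rewrite lerDl; apply: mulr_ge0; first exact: sqr_ge0.
  by apply: mulr_ge0; [exact: weight_ge0|exact: powR_ge0].
have up : 0 < u by exact: lt_trans Lu.
apply: (@le_trans _ _ (Lm ^+ 2 * (weight alpha w * u `^ p))); last first.
  by rewrite lerDr sqr_ge0.
apply: (@le_trans _ _ (Lm ^+ 2 * ((Lm `^ p)^-1 * u `^ p))); last first.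
  by rewrite ler_wpM2l ?sqr_ge0// ler_wpM2r ?powR_ge0// -hpv weight_ge_hp.
have -> : Lm ^+ 2 * ((Lm `^ p)^-1 * u `^ p) = (Lm `^ (2 - p)) * u `^ p.
  by rewrite powR_add// powRN (powR_mulrn 2) ?(ltW Lm0)// mulrA.
have -> : u ^+ 2 = u `^ (2 - p) * u `^ p.
  by rewrite -powR_add// subrK (powR_mulrn 2).
by rewrite ler_wpM2r ?powR_ge0// powR_leN ?subr_le0// ltW.
Qed.

Lemma ps_pointwise (b : nat -> Cplx R) (L : R) (c : Cplx R) : abs_conv b -> 0 < L ->
  (energy (ps b) D1 <= (L `^ p)%:E)%E -> modulus c < 1 ->
  modulus (ps b c) <= (4 + 6 `^ `|alpha|) * (((1 - modulus c) / 2) `^ (- beta) * L).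
Proof.
move=> hb L0 hE c1; pose r := (1 - modulus c) / 2.
have r0 : 0 < r by rewrite divr_gt0// subr_gt0.
have cE : modulus c = 1 - 2 * r by rewrite /r; field.
apply: (@pointwise_bound R b p alpha r L c hb (ltW p1) r0 cE L0).
apply: le_trans hE; apply: ge0_subset_integral => //.
- exact: measurable_disc.
- exact: measurable_disc.
- exact: measurable_energy_density.
- by move=> w _; exact: energy_density_ge0.
- by move=> w /disc_sub h; rewrite disc0E; lra.
Qed.

Lemma ps_square_integral_lt2 (b : nat -> Cplx R) (L : R) : p < 2 -> abs_conv b -> 0 < L ->
  (energy (ps b) D1 <= (L `^ p)%:E)%E ->
  exists v C : R, [/\ 0 < v < 2, 0 < C & forall j,
    (\int[lam2]_(w in disc (0 : Cplx R)%R (1 - hp j)%R) (modulus (ps b (toC w)) ^+ 2)%:E <=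
     (C * (v ^+ 2) ^+ j)%:E)%E].
Proof.
move=> p2 hb L0 hE; have p0 := p_gt0 p1.
have b1 := beta_gt1 p1 alpha_gt; have b2 := beta_lt2 p1 alpha_le.
have bp := beta_p alpha p1.
(* Half the exponent of 2^j in Lm^(2 - p) divided by the lower bound for the weight. Twice g is
   below beta < 2 for alpha <= 0, and equals 2 beta - 2 < 2 for alpha > 0 since beta p = alpha +
   2. *)
pose g := (beta * (2 - p) + alpha_pos) / 2.
have g1 : g < 1.
  rewrite ltr_pdivrMr// mul1r /alpha_pos; have [a0|a0] := leP alpha 0.
    rewrite addr0 (@lt_trans _ _ beta)//.
    have : 0 < beta * (p - 1) by rewrite mulr_gt0 ?subr_gt0// (lt_trans _ b1).
    lra.
  rewrite mulrBr bp; lra.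
pose v : R := 2 `^ g.
have v0 : 0 < v by exact: powR_gt0.
have v2 : v < 2.
  have e : 2 = 2 `^ 1 :> R by rewrite powRr1.
  rewrite [ltRHS]e.
  by rewrite /v /powR pnatr_eq0/= ltr_expR ltr_pM2r// ln_gt0// ltr1n.
pose c0 := (4 + 6 `^ `|alpha|) * (hp 1 `^ (- beta) * L).
have c00 : 0 < c0.
  by rewrite !mulr_gt0// ?powR_gt0 ?hp_gt0// addr_gt0// powR_gt0.
pose C := c0 `^ (2 - p) * L `^ p.
have C0 : 0 < C by rewrite mulr_gt0// powR_gt0.
exists v, C; split => //; first by rewrite v0.
move=> j.
have hj := hp_gt0 R j.
pose Lm := c0 * hp j `^ (- beta).
have Lm0 : 0 < Lm by rewrite mulr_gt0// powR_gt0.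
pose k := Lm `^ (2 - p) * hp j `^ (- alpha_pos).
have k0 : 0 <= k by rewrite mulr_ge0 ?powR_ge0.
have -> : C * (v ^+ 2) ^+ j = 4 * 0 + k * L `^ p.
  rewrite mulr0 add0r /C /k /Lm powRM ?powR_ge0 ?(ltW c00)//.
  have -> : c0 `^ (2 - p) * hp j `^ (- beta) `^ (2 - p) * hp j `^ (- alpha_pos) * L `^ p
    = c0 `^ (2 - p) * L `^ p * (hp j `^ (- beta) `^ (2 - p) * hp j `^ (- alpha_pos)) by ring.
  congr (_ * _); rewrite -powRrM -powR_add// hp_powR; congr (_ ^+ _).
  rewrite -powR_mulrn ?powR_ge0// /v -powRrM; by congr (_ `^ _); rewrite /g; field.
apply: square_integral_le => // w Dw; rewrite add0r.
have c1 : modulus (toC w) < 1 by lra.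
have hu := ps_pointwise hb L0 hE c1.
have {}hu : modulus (ps b (toC w)) <= Lm.
  apply: (le_trans hu); rewrite /Lm /c0 -!mulrA ler_wpM2l ?addr_ge0 ?powR_ge0//.
  rewrite [hp 1 `^ _ * _]mulrCA [_ `^ _ * L]mulrC ler_wpM2l ?(ltW L0)//.
  rewrite -powRM ?hp_ge0// -hpD add1n hpS.
  apply: powR_leN; rewrite ?oppr_le0 ?divr_gt0//; lra.
set u := modulus (ps b (toC w)) in hu *.
have u0 : 0 <= u by exact: modulus_ge0.
have [->|un0] := eqVneq u 0.
  by rewrite expr0n/= !mulr_ge0 ?powR_ge0 ?weight_ge0.
have up : 0 < u by rewrite lt_def un0.
have -> : u ^+ 2 = u `^ (2 - p) * u `^ p by rewrite -powR_add// subrK (powR_mulrn 2).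
rewrite mulrA ler_wpM2r ?powR_ge0//.
apply: (@le_trans _ _ (Lm `^ (2 - p))); first by rewrite powR_le// subr_ge0 ltW.
rewrite /k -mulrA ler_peMr ?powR_ge0//.
rewrite powRN mulrC ler_pdivlMr ?powR_gt0// mul1r; exact: weight_ge_hp.
Qed.

(** Each block from 2^n to 2^(n + 1) contributes at most 1. *)
Lemma harmonic_dyadic n : \sum_(0 <= k < 2 ^ n) (k.+1%:R : R)^-1 <= n.+1%:R.
Proof.
elim: n => [|n IH]; first by rewrite expn0 big_nat1 invr1.
have le2 : (2 ^ n <= 2 ^ n.+1)%N by rewrite leq_exp2l.
rewrite (big_cat_nat (leq0n _) le2)//= -[n.+2%:R]natr1 lerD//.
apply: (@le_trans _ _ (\sum_(2 ^ n <= k < 2 ^ n.+1) ((2 ^ n)%:R : R)^-1)).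
  rewrite [leLHS]big_nat [leRHS]big_nat; apply: ler_sum => k /andP[nk _].
  by rewrite lef_pV2 ?posrE ?ltr0n ?expn_gt0// ler_nat ltnW.
rewrite sumr_const_nat expnS mul2n -addnn addnK.
by rewrite -(mulr_natr (2 ^ n)%:R^-1) mulVf// pnatr_eq0 expn_eq0.
Qed.

(** Below 2^n this is a harmonic sum; beyond, 1 / (k + 1) <= hp n and the geometric series is at
    most 1 / hp n, which adds 1. *)
Lemma harmonic_geometric (y : R) n M : 0 <= y -> y <= 1 - hp n ->
  \sum_(0 <= k < M) y ^+ k.+1 / k.+1%:R <= n.+2%:R.
Proof.
move=> y0 yn; have hn := hp_gt0 R n.
have y1 : y < 1 by lra.
have t0 k : 0 <= y ^+ k.+1 / k.+1%:R by rewrite divr_ge0// exprn_ge0.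
have le1 : (M <= maxn M (2 ^ n))%N by exact: leq_maxl.
have le2 : (2 ^ n <= maxn M (2 ^ n))%N by exact: leq_maxr.
apply: (@le_trans _ _ (\sum_(0 <= k < maxn M (2 ^ n)) y ^+ k.+1 / k.+1%:R)).
  by rewrite [leRHS](big_cat_nat (leq0n M) le1)//= lerDl sumr_ge0.
rewrite (big_cat_nat (leq0n _) le2)//= -[n.+2%:R]natr1 lerD//.
  apply: le_trans (harmonic_dyadic n); apply: ler_sum => k _.
  by rewrite ler_piMl// exprn_ile1// ltW.
apply: (@le_trans _ _ (\sum_(2 ^ n <= k < maxn M (2 ^ n)) hp n * y ^+ k)).
  rewrite [leLHS]big_nat [leRHS]big_nat; apply: ler_sum => k /andP[nk _].
  rewrite mulrC ler_pM ?exprn_ge0//.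
    rewrite /hp exprVn -natrX lef_pV2 ?posrE ?ltr0n ?expn_gt0// ler_nat ltnW//.
  by rewrite ler_wiXn2l// ltW.
rewrite -mulr_sumr mulrC -ler_pdivlMr// mul1r.
apply: (@le_trans _ _ (\sum_(0 <= k < maxn M (2 ^ n)) y ^+ k)).
  by rewrite [leRHS](big_cat_nat (leq0n _) le2)//= lerDr sumr_ge0// => k _; rewrite exprn_ge0.
apply: le_trans (geometric_sum_le _ _) _; first by rewrite y0.
by rewrite lef_pV2 ?posrE ?subr_gt0//; lra.
Qed.

(** Cauchy-Schwarz in additive form: |a_k| is split between k |a_k|^2, summed by Bessel's
    inequality, and 1 / k, summed by [harmonic_geometric]. Since the first sum is of order v^(2j),
    the balancing weight is v^j. *)
Lemma coefficient_growth a (L : R) : abs_conv a -> 0 < L ->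
  (energy (ps (dcoef a)) D1 <= (L `^ p)%:E)%E ->
  exists v C : R, [/\ 0 < v < 2, 0 < C & forall j t M, 0 <= t -> hp j.+1 <= 1 - t ->
    \sum_(0 <= k < M) modulus (a k) * t ^+ k <= modulus (a 0%N) + C * (j.+4%:R * v ^+ j)].
Proof.
move=> ha L0 hE; have hb := abs_conv_dcoef ha.
have [v [C [v02 C0 HC]]] : exists v C : R, [/\ 0 < v < 2, 0 < C & forall j,
    (\int[lam2]_(w in disc (0 : Cplx R)%R (1 - hp j)%R) (modulus (ps (dcoef a) (toC w)) ^+ 2)%:E <=
     (C * (v ^+ 2) ^+ j)%:E)%E].
  have [p2|p2] := leP 2 p; first exact: (@ps_square_integral_ge2 (dcoef a) L).
  exact: (@ps_square_integral_lt2 (dcoef a) L).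
case/andP: (v02) => v0 v2.
exists v, (4 * C * v ^+ 4 + 1); split => //.
  by rewrite addr_gt0// !mulr_gt0// exprn_gt0.
move=> j t M t0 tj.
have hj := hp_gt0 R j.+2.
(* Bessel's inequality yields powers of r^2, and r^2 >= 1 - 2 hp j.+2 = 1 - hp j.+1 >= t. The index
   j + 2 is also the origin of j + 4 in the bound. *)
pose r : R := 1 - hp j.+2.
have r1 : 0 < r < 1.
  have : hp j.+2 <= hp 1 :> R by rewrite hp_le.
  by rewrite {2}/hp expr1 /r => ?; apply/andP; split; lra.
case/andP: (r1) => r0 rl1.
have tr : t <= r ^+ 2.
  have e : hp j.+1 = 2 * hp j.+2 :> R by rewrite (hpS R j.+1); field.
  have : 0 <= hp j.+2 ^+ 2 :> R by rewrite sqr_ge0.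
  rewrite /r sqrrB expr1n mul1r; lra.
have bessel := @disc_bessel_ps R (dcoef a) r M hb r1.
have {}bessel := le_trans bessel (HC j.+2).
rewrite lee_fin in bessel.
have bE k : modulus (dcoef a k) ^+ 2 * (r ^+ k.*2.+2 / (4 * k.+1%:R)) =
    4^-1 * (k.+1%:R * modulus (a k.+1) ^+ 2 * (r ^+ 2) ^+ k.+1).
  rewrite /dcoef modulusM modulus_nat exprMn -exprM mulnC muln2 doubleS.
  have n0 : k.+1%:R != 0 :> R by rewrite pnatr_eq0.
  by move: (k.+1%:R : R) (r ^+ _) n0 => n q n0; field.
have {}bessel : \sum_(0 <= k < M) k.+1%:R * modulus (a k.+1) ^+ 2 * (r ^+ 2) ^+ k.+1 <=
     4 * (C * (v ^+ 2) ^+ j.+2).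
  rewrite -ler_pdivrMl// mulr_sumr; apply: le_trans bessel.
  by rewrite le_eqVlt; apply/orP; left; apply/eqP; apply: eq_bigr => k _; rewrite bE.
have y0 : 0 <= r ^+ 2 by exact: sqr_ge0.
have yj : r ^+ 2 <= 1 - hp j.+2.
  by rewrite -/r expr2 ler_piMr// ltW.
have harm := @harmonic_geometric (r ^+ 2) j.+2 M y0 yj.
have vj0 : 0 < v ^+ j by rewrite exprn_gt0.
have amgm k : modulus (a k.+1) * t ^+ k.+1 <=
   v ^- j * (k.+1%:R * modulus (a k.+1) ^+ 2 * (r ^+ 2) ^+ k.+1) +
   v ^+ j * ((r ^+ 2) ^+ k.+1 / k.+1%:R).
  apply: (@le_trans _ _ (modulus (a k.+1) * (r ^+ 2) ^+ k.+1)).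
    by rewrite ler_wpM2l ?modulus_ge0// lerXn2r ?nnegrE.
  have -> : v ^- j * (k.+1%:R * modulus (a k.+1) ^+ 2 * (r ^+ 2) ^+ k.+1) +
   v ^+ j * ((r ^+ 2) ^+ k.+1 / k.+1%:R) =
   (v ^- j * (k.+1%:R * modulus (a k.+1) ^+ 2) + v ^+ j / k.+1%:R) * (r ^+ 2) ^+ k.+1 by ring.
  rewrite ler_wpM2r ?exprn_ge0 ?(ltW r0)//.
  have n0 : 0 < k.+1%:R :> R by rewrite ltr0n.
  move: (k.+1%:R : R) n0 (modulus (a k.+1)) (modulus_ge0 (a k.+1)) (v ^+ j) vj0 => n n0 x x0 s s0.
  have q0 : 0 < n / s by rewrite divr_gt0.
  have -> : s^-1 * (n * x ^+ 2) + s / n = (n / s) * x ^+ 2 + (n / s)^-1.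
    by field; rewrite !gt_eqF.
  move: (n / s) q0 => q q0.
  rewrite -(ler_pM2l q0) mulrDr mulfV ?gt_eqF//.
  have : 0 <= (q * x - 1) ^+ 2 by exact: sqr_ge0.
  have : 0 <= q * x by rewrite mulr_ge0// ltW.
  rewrite sqrrB expr1n mulr1 exprMn; move=> h1 h2.
  have -> : q * (q * x ^+ 2) = q ^+ 2 * x ^+ 2 by ring.
  lra.
apply: (@le_trans _ _ (\sum_(0 <= k < M.+1) modulus (a k) * t ^+ k)).
  by rewrite [leRHS]big_nat_recr//= lerDl mulr_ge0 ?modulus_ge0 ?exprn_ge0.
rewrite big_nat_recl//= expr0 mulr1 lerD2l.
apply: le_trans (ler_sum _ (fun k _ => amgm k)) _.
rewrite big_split/= -!mulr_sumr.
apply: le_trans (lerD (ler_wpM2l _ bessel) (ler_wpM2l _ harm)) _.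
- by rewrite invr_ge0 ltW.
- exact: ltW.
have -> : v ^- j * (4 * (C * (v ^+ 2) ^+ j.+2)) = 4 * C * v ^+ 4 * v ^+ j.
  have -> : (v ^+ 2) ^+ j.+2 = v ^+ 4 * (v ^+ j * v ^+ j).
    by rewrite -exprM -!exprD; congr (_ ^+ _); rewrite mulnC muln2 -addnn !addSn !addnS.
  by field; rewrite gt_eqF.
rewrite [leRHS]mulrDl mul1r; apply: lerD; last by rewrite mulrC.
apply: ler_wpM2l; first by rewrite !mulr_ge0 ?exprn_ge0 ?ltW.
by rewrite ler_peMl ?ler1n// ltW.
Qed.

End CoefficientGrowth.

Lemma cvg_combination (R : realType) (c l : nat -> Cplx R) (u : nat -> nat -> Cplx R) N :
  (forall n, u n @ \oo --> l n) ->
  (\sum_(0 <= n < N) c n * u n K) @[K --> \oo] --> \sum_(0 <= n < N) c n * l n.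
Proof.
move=> ul; apply/cvg_modulusP.
apply: (@squeeze_cvgr _ _ _ _ (fun=> 0) (fun K => \sum_(0 <= n < N) modulus (c n) * modulus (u n K - l n))).
- apply: nearW => K; rewrite modulus_ge0/= -sumrB (le_trans (modulus_sum _ _ _))//.
  by apply: ler_sum => n _; rewrite -modulusM mulrBr.
- exact: cvg_cst.
elim: N => [|N IH].
  have -> : (fun K => \sum_(0 <= n < 0) modulus (c n) * modulus (u n K - l n)) = fun=> 0.
    by apply/funext => K; rewrite big_nil.
  exact: cvg_cst.
have -> : (fun K => \sum_(0 <= n < N.+1) modulus (c n) * modulus (u n K - l n)) =
    (fun K => \sum_(0 <= n < N) modulus (c n) * modulus (u n K - l n) + modulus (c N) * modulus (u N K - l N)).
  by apply/funext => K; rewrite big_nat_recr.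
rewrite [X in _ --> X](_ : (0 : R) = 0 + modulus (c N) * 0); last by rewrite mulr0 addr0.
by apply: cvgD; [exact: IH|apply: cvgMr; apply/cvg_modulusP].
Qed.

(** * Moments and Carleson measures *)

Section Moments.
Variable R : realType.
Variable mu : {finite_measure set (measurableTypeR R) -> \bar R}.
Local Notation E := (`[0%R, 1%R[%classic : set (measurableTypeR R)).

Lemma measurable_E : measurable E.
Proof. exact: measurable_itv. Qed.

Lemma measurable_pow (n : nat) : measurable_fun E (fun t : measurableTypeR R => t ^+ n : R).
Proof. by apply: measurable_funX; exact: measurable_id. Qed.

Lemma integrable_pow n : mu.-integrable E (EFin \o (fun t : measurableTypeR R => t ^+ n : R)).
Proof.
apply: (le_integrable measurable_E _ _ (finite_measure_integrable_cst mu 1 measurable_E)).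
  by apply/measurable_EFinP; exact: measurable_pow.
move=> t; rewrite /= in_itv/= => /andP[t0 t1].
by rewrite lee_fin normr1 ger0_norm ?exprn_ge0// exprn_ile1// ltW.
Qed.

Lemma momentE n : ((moment mu n)%:E = \int[mu]_(t in E) (t ^+ n)%:E)%E.
Proof.
rewrite /moment /Rintegral fineK//.
exact: (integrable_fin_num measurable_E (integrable_pow n)).
Qed.

Lemma moment_ge0 n : 0 <= moment mu n.
Proof.
apply: Rintegral_ge0 => t; rewrite /= in_itv/= => /andP[t0 _].
exact: exprn_ge0.
Qed.

Lemma moment_le m n : (n <= m)%N -> moment mu m <= moment mu n.
Proof.
move=> nm; apply: le_Rintegral.
- exact: measurable_E.
- exact: integrable_pow.
- exact: integrable_pow.
- move=> t; rewrite /= in_itv/= => /andP[t0 t1].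
  by rewrite ler_wiXn2l// ltW.
Qed.

Lemma moment_sum (I : Type) (s : seq I) (d : I -> R) (e : I -> nat) :
  mu.-integrable E (EFin \o (fun t : measurableTypeR R => \sum_(i <- s) d i * t ^+ e i : R)) /\
  \sum_(i <- s) d i * moment mu (e i) =
  Rintegral mu E (fun t => \sum_(i <- s) d i * t ^+ e i).
Proof.
elim: s => [|i s [IH1 IH2]].
  split.
    apply: eq_integrable (integrable0 mu E) => //.
    by move=> t _; rewrite /= big_nil.
  rewrite big_nil (@eq_Rintegral _ _ _ _ _ (fun=> 0)); last by move=> t _; rewrite big_nil.
  by rewrite Rintegral_cst ?mul0r//; exact: measurable_E.
have hi : mu.-integrable E (EFin \o (fun t : measurableTypeR R => d i * t ^+ e i : R)).
  apply: eq_integrable (integrableZl measurable_E (d i) (integrable_pow (e i))).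
  - exact: measurable_E.
  - by [].
split.
  apply: eq_integrable (integrableD measurable_E hi IH1).
  - exact: measurable_E.
  - by move=> t _; rewrite /= big_cons.
rewrite big_cons IH2 [RHS](@eq_Rintegral _ _ _ _ _ (fun t : measurableTypeR R => d i * t ^+ e i + \sum_(j <- s) d j * t ^+ e j)); last first.
  by move=> t _; rewrite big_cons.
rewrite RintegralD// RintegralZl//.
exact: integrable_pow.
Qed.

Definition measCE (phi : R -> Cplx R) : Prop :=
  measurable_fun E (fun t : measurableTypeR R => complex.Re (phi t)) /\
  measurable_fun E (fun t : measurableTypeR R => complex.Im (phi t)).

Lemma measCE_modulus phi : measCE phi ->
  measurable_fun E (fun t : measurableTypeR R => modulus (phi t)).
Proof.
move=> [f1 f2].
have -> : (fun t : measurableTypeR R => modulus (phi t)) =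
    (fun t => Num.sqrt (complex.Re (phi t) ^+ 2 + complex.Im (phi t) ^+ 2)).
  by apply/funext => t; rewrite modulus_def.
apply: (@measurableT_comp _ _ _ _ _ _ (@Num.sqrt R)).
  by apply: continuous_measurable_fun; exact: sqrt_continuous.
by apply: measurable_funD; exact: measurable_funX.
Qed.

Lemma measCE_sum (I : Type) (s : seq I) (d : I -> Cplx R) (e : I -> nat) :
  measCE (fun t => \sum_(i <- s) d i * t%:C%C ^+ e i).
Proof.
have E1 t : complex.Re (\sum_(i <- s) d i * t%:C%C ^+ e i) = \sum_(i <- s) complex.Re (d i) * t ^+ e i.
  rewrite raddf_sum/=; apply: eq_bigr => i _; rewrite -rmorphXn/=.
  by case: (d i) => x y /=; rewrite mulr0 subr0.
have E2 t : complex.Im (\sum_(i <- s) d i * t%:C%C ^+ e i) = \sum_(i <- s) complex.Im (d i) * t ^+ e i.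
  rewrite raddf_sum/=; apply: eq_bigr => i _; rewrite -rmorphXn/=.
  by case: (d i) => x y /=; rewrite mulr0 add0r.
split.
- have -> : (fun t : measurableTypeR R => complex.Re (\sum_(i <- s) d i * t%:C%C ^+ e i)) =
      (fun t => \sum_(i <- s) complex.Re (d i) * t ^+ e i) by apply/funext => t; rewrite E1.
  apply: measurable_sum => i.
  by apply: measurable_funM; [exact: measurable_cst|exact: measurable_pow].
- have -> : (fun t : measurableTypeR R => complex.Im (\sum_(i <- s) d i * t%:C%C ^+ e i)) =
      (fun t => \sum_(i <- s) complex.Im (d i) * t ^+ e i) by apply/funext => t; rewrite E2.
  apply: measurable_sum => i.
  by apply: measurable_funM; [exact: measurable_cst|exact: measurable_pow].
Qed.

(* Multiplying by the conjugate of the sum reduces the claim to real integrands. *)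
Lemma modulus_moment_sum_le (I : Type) (s : seq I) (d : I -> Cplx R) (e : I -> nat) :
  ((modulus (\sum_(i <- s) d i * (moment mu (e i))%:C%C))%:E <=
   \int[mu]_(t in E) (modulus (\sum_(i <- s) d i * t%:C%C ^+ e i))%:E)%E.
Proof.
set D := \sum_(i <- s) _.
have [D0|D0] := eqVneq (modulus D) 0.
  by rewrite D0; apply: integral_ge0 => t _; rewrite lee_fin modulus_ge0.
have Dp : 0 < modulus D by rewrite lt_def D0 modulus_ge0.
have mJ (w : Cplx R) : modulus (conjc w : Cplx R) = modulus w.
  by rewrite !modulus_def; case: w => u v /=; rewrite sqrrN.
pose rho i := complex.Re (conjc D * d i).
have [int1 sum1] := moment_sum s rho e.
have DE : modulus D ^+ 2 = \sum_(i <- s) rho i * moment mu (e i).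
  have -> : modulus D ^+ 2 = complex.Re (conjc D * D).
    by rewrite modulus_sqr; case: (D) => u v /=; rewrite mulNr opprK -!expr2.
  rewrite {2}/D mulr_sumr raddf_sum/=; apply: eq_bigr => i _.
  by rewrite /rho mulrA; case: (conjc D * d i) => u v /=; rewrite mulr0 subr0.
have mS := measCE_modulus (measCE_sum s d e).
rewrite -(@lee_pmul2l _ (modulus D)%:E)// ?lte_fin// -EFinM -expr2 DE sum1.
rewrite -ge0_integralZl_EFin//; last 3 first.
- by move=> t _; rewrite lee_fin modulus_ge0.
- exact/measurable_EFinP.
- exact: modulus_ge0.
rewrite /Rintegral fineK; last exact: (integrable_fin_num measurable_E int1).
apply: (le_trans (lee_abs _)); apply: (le_trans (le_abse_integral _ measurable_E _)).
  exact: (measurable_int _ int1).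
apply: ge0_le_integral.
- exact: measurable_E.
- by move=> t _; exact: abse_ge0.
- by apply: measurableT_comp => //; exact: (measurable_int _ int1).
- by apply/measurable_EFinP; exact: measurable_funM.
move=> t _ /=; rewrite lee_fin.
have -> : \sum_(i <- s) rho i * t ^+ e i = complex.Re (conjc D * \sum_(i <- s) d i * t%:C%C ^+ e i).
  rewrite mulr_sumr raddf_sum/=; apply: eq_bigr => i _.
  rewrite /rho mulrA -rmorphXn/=; case: (conjc D * d i) => u v /=.
  by rewrite mulr0 subr0.
by rewrite (le_trans (Re_le_modulus _))// modulusM mJ.
Qed.

End Moments.

Lemma derivative_geometric_sum (R : realType) (w : Cplx R) N :
  (1 - w) ^+ 2 * \sum_(0 <= n < N) n.+1%:R * w ^+ n = 1 - N.+1%:R * w ^+ N + N%:R * w ^+ N.+1.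
Proof.
elim: N => [|N IH]; first by rewrite big_nil mulr0 expr0 mulr1 mul0r addr0 subrr.
rewrite big_nat_recr//= mulrDr IH -!natr1 !exprS; ring.
Qed.

(** 2N + 1 = (N + 1) + N adds up the two remainder coefficients in [derivative_geometric_sum]; (N +
    1) r^N tends to 0 as the general term of a convergent series. *)
Lemma near_odd_exp_le1 (R : realType) (r : R) : 0 <= r < 1 ->
  \forall N \near \oo, N.*2.+1%:R * r ^+ N <= 1.
Proof.
move=> r01; case/andP: (r01) => r0 r1.
have one : abs_conv (fun=> 1 : Cplx R).
  move=> s /andP[s0 s1]; under eq_fun do rewrite modulus1.
  by apply: is_cvg_geometric_series; rewrite ger0_norm.
have h := cvg_series_cvg_0 (abs_conv_dcoef one r01).
have /cvgrPdist_le/(_ 2^-1) := h; rewrite invr_gt0 ltr0n => /(_ isT).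
apply: filterS => N; rewrite sub0r normrN ger0_norm ?mulr_ge0 ?modulus_ge0 ?exprn_ge0//.
rewrite /dcoef modulusM modulus_nat modulus1 mulr1 => hN.
apply: (@le_trans _ _ (2 * (N.+1%:R * r ^+ N))); last lra.
rewrite mulrA ler_wpM2r ?exprn_ge0// -natrM ler_nat -muln2 mulnC mulnS.
by rewrite addnC addn2 ltnW.
Qed.

(** The condition on N involves r only, so one N serves all w = tz with t in [0, 1) and r = |z|. *)
Lemma derivative_geometric_le (R : realType) (w : Cplx R) r N :
  modulus w <= r -> r <= 1 -> N.*2.+1%:R * r ^+ N <= 1 ->
  modulus (\sum_(0 <= n < N) n.+1%:R * w ^+ n) * modulus (1 - w) ^+ 2 <= 2.
Proof.
move=> wr r1 hN; have r0 := le_trans (modulus_ge0 _) wr.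
rewrite -modulusX -modulusM mulrC derivative_geometric_sum.
apply: (le_trans (modulusD _ _)).
have h1 : modulus (1 - N.+1%:R * w ^+ N) <= 1 + N.+1%:R * r ^+ N.
  rewrite (le_trans (modulusD _ _))// modulus1 modulusN modulusM modulus_nat modulusX.
  by rewrite lerD2l ler_wpM2l// lerXn2r ?nnegrE ?modulus_ge0.
have h2 : modulus (N%:R * w ^+ N.+1) <= N%:R * r ^+ N.
  rewrite modulusM modulus_nat modulusX ler_wpM2l//.
  apply: (@le_trans _ _ (modulus w ^+ N)).
    by rewrite exprS ler_piMl ?exprn_ge0 ?modulus_ge0// (le_trans wr).
  by rewrite lerXn2r ?nnegrE ?modulus_ge0.
apply: (le_trans (lerD h1 h2)).
have e : N.*2.+1%:R = N.+1%:R + N%:R :> R by rewrite -natrD addSn addnn.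
rewrite e in hN; lra.
Qed.

(** * The Hankel operator for a Carleson measure *)

Section CarlesonSums.
Variable R : realType.
Variable mu : {finite_measure set (measurableTypeR R) -> \bar R}.
Local Notation E := (`[0%R, 1%R[%classic : set (measurableTypeR R)).
Variable C : R.
Hypothesis C0 : 0 < C.
Hypothesis carleson : forall t : R, 0 <= t < 1 -> (mu [set` `[t, 1%R[] <= (C * (1 - t))%:E)%E.

Definition gap (t : measurableTypeR R) : R := 1 - t.

Lemma measurable_gap : measurable_fun E gap.
Proof. by apply: measurable_funB => //; exact: measurable_id. Qed.

Lemma gap01 t : E t -> 0 < gap t <= 1.
Proof. by rewrite /= in_itv/= /gap => /andP[t0 t1]; apply/andP; split; lra. Qed.

Lemma measurable_gap_level j : measurable (level E gap j).
Proof. by apply: measurable_level; [exact: measurable_E|exact: measurable_gap]. Qed.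

Lemma carleson_level j : (mu (level E gap j) <= (C * hp j)%:E)%E.
Proof.
have h : 0 <= 1 - (hp j : R) < 1 by rewrite subr_ge0 hp_le1/= gtrBl hp_gt0.
apply: le_trans (_ : mu [set` `[(1 - hp j)%R, 1%R[] <= _)%E; last first.
  by apply: le_trans (carleson h) _; rewrite subKr.
apply: le_measure; rewrite ?inE; first exact: measurable_gap_level.
  exact: measurable_itv.
move=> t [/= + /andP[_ h2]]; rewrite !in_itv/= /gap in h2 * => /andP[t0 t1].
by rewrite t1 andbT; lra.
Qed.

Lemma carleson_integral_le (f : measurableTypeR R -> \bar R) (F : nat -> R) :
  measurable_fun E f -> (forall t, E t -> 0 <= f t)%E -> (forall j, 0 <= F j) ->
  (forall j t, level E gap j t -> f t <= (F j)%:E)%E ->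
  (\int[mu]_(t in E) f t <= \sum_(0 <= j <oo) (C * (hp j * F j))%:E)%E.
Proof.
move=> mf f0 F0 fF.
rewrite (@dyadic_integral R _ _ mu E gap)//; last 2 first.
- exact: measurable_gap.
- exact: gap01.
apply: lee_nneseries => j _.
  by move=> _; apply: integral_ge0 => t [Et _]; exact: f0.
apply: (@le_trans _ _ (\int[mu]_(t in level E gap j) (F j)%:E)%E).
  apply: ge0_le_integral => //.
  - exact: measurable_gap_level.
  - by move=> t [Et _]; exact: f0.
  - by apply: measurable_funS mf; [exact: measurable_E|move=> t []].
  - by move=> t ht; exact: fF ht.
rewrite integral_cst; last exact: measurable_gap_level.
apply: (@le_trans _ _ ((F j)%:E * (C * hp j)%:E)%E).
  by rewrite lee_wpmul2l ?lee_fin// carleson_level.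
by rewrite -EFinM lee_fin le_eqVlt; apply/orP; left; apply/eqP; ring.
Qed.

Variable a : nat -> Cplx R.
Variables A v C' : R.
Hypothesis ha : abs_conv a.
Hypothesis A0 : 0 <= A.
Hypothesis C'0 : 0 < C'.
Hypothesis v02 : 0 < v < 2.
Hypothesis growth : forall j t M, 0 <= t -> hp j.+1 <= 1 - t ->
  \sum_(0 <= k < M) modulus (a k) * t ^+ k <= A + C' * (j.+4%:R * v ^+ j).

Lemma growth_sum_le : exists B : R,
  (\sum_(0 <= j <oo) (C * (hp j * (A + C' * (j.+4%:R * v ^+ j))))%:E <= B%:E)%E.
Proof.
case/andP: v02 => v0 v2.
pose q := v / 2.
have q01 : 0 <= q < 1 by rewrite divr_ge0 ?(ltW v0)//= /q ltr_pdivrMr// mul1r.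
case/andP: (q01) => q0 q1.
(* The power q^j is split in two halves: one absorbs the factor j + 1, the other is summed. *)
pose s := Num.sqrt q.
have s0 : 0 <= s by rewrite sqrtr_ge0.
have sq : s ^+ 2 = q by rewrite sqr_sqrtr.
have s1 : s < 1.
  by rewrite -(ltr_pXn2r (n:=2)) ?nnegrE// sq expr1n.
have s01 : 0 <= s < 1 by rewrite s0.
have h01 : 0 <= (2^-1 : R) < 1 by rewrite invr_ge0 ler0n/= invf_lt1// ltr1n.
exists (C * (A * (1 - 2^-1)^-1 + C' * (4 * ((1 - s)^-1 * (1 - s)^-1)))).
have vj j : 0 <= v ^+ j by rewrite exprn_ge0// ltW.
apply: nneseries_le.
  move=> j; rewrite lee_fin mulr_ge0 ?(ltW C0)// mulr_ge0 ?hp_ge0// addr_ge0//.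
  by rewrite !mulr_ge0// ltW.
move=> n; rewrite sumEFin lee_fin -mulr_sumr ler_wpM2l ?(ltW C0)//.
under eq_bigr do rewrite mulrDr.
rewrite big_split/=; apply: lerD.
  rewrite -mulr_suml mulrC ler_wpM2l//; exact: geometric_sum_le.
under eq_bigr do rewrite mulrCA.
rewrite -mulr_sumr ler_wpM2l ?(ltW C'0)//.
apply: (@le_trans _ _ (\sum_(0 <= j < n) 4 * ((1 - s)^-1 * s ^+ j))).
  apply: ler_sum => j _.
  have -> : hp j * (j.+4%:R * v ^+ j) = j.+4%:R * (s ^+ j * s ^+ j).
    have -> : s ^+ j * s ^+ j = hp j * v ^+ j.
      by rewrite -exprMn -expr2 sq /q /hp -exprMn mulrC.
    by ring.
  apply: (@le_trans _ _ (4 * (j.+1%:R * s ^+ j * s ^+ j))).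
    have -> : 4 * (j.+1%:R * s ^+ j * s ^+ j) = (4 * j.+1%:R) * (s ^+ j * s ^+ j) by ring.
    rewrite ler_wpM2r ?mulr_ge0 ?exprn_ge0//.
    by rewrite -natrM ler_nat mulnS -addn4 addnC leq_add2l leq_pmull.
  rewrite ler_wpM2l// ler_wpM2r ?exprn_ge0//.
  exact: mulrn_exp_le.
rewrite -!mulr_sumr ler_wpM2l// ler_wpM2l ?invr_ge0 ?subr_ge0 ?(ltW s1)//.
exact: geometric_sum_le.
Qed.

Definition abs_series (t : measurableTypeR R) : \bar R :=
  (\sum_(0 <= k <oo) (modulus (a k) * t ^+ k)%:E)%E.

Lemma abs_term_ge0 k t : E t -> (0 <= (modulus (a k) * t ^+ k)%:E)%E.
Proof.
rewrite /= in_itv/= => /andP[t0 _].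
by rewrite lee_fin mulr_ge0 ?modulus_ge0 ?exprn_ge0.
Qed.

Lemma measurable_abs_series : measurable_fun E abs_series.
Proof.
apply: ge0_emeasurable_sum.
- by move=> k t Et _; exact: abs_term_ge0.
- move=> k _; apply/measurable_EFinP; apply: measurable_funM.
    exact: measurable_cst.
  exact: measurable_pow.
Qed.

(** Used twice: for the convergence of the moment series, and as the integrable majorant in
    [hankel_combination_le]. *)
Lemma abs_series_int : exists B : R, (\int[mu]_(t in E) abs_series t <= B%:E)%E.
Proof.
have [B hB] := growth_sum_le; exists B; apply: le_trans hB.
apply: carleson_integral_le.
- exact: measurable_abs_series.
- by move=> t Et; apply: nneseries_ge0 => k _ _; exact: abs_term_ge0.
- move=> j; rewrite addr_ge0// !mulr_ge0 ?(ltW C'0)// exprn_ge0// ltW//.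
  by case/andP: v02.
move=> j t [Et /andP[h1 h2]].
have t0 : 0 <= t by move: Et; rewrite /= in_itv/= => /andP[].
apply: nneseries_le; first by move=> k; exact: abs_term_ge0.
by move=> n; rewrite sumEFin lee_fin; apply: growth => //; exact: ltW.
Qed.

Lemma moment_series_le : exists2 B : R, 0 <= B & forall M,
  \sum_(0 <= k < M) modulus (a k) * moment mu k <= B.
Proof.
have [B hB] := abs_series_int.
have S0 M : 0 <= \sum_(0 <= k < M) modulus (a k) * moment mu k.
  by apply: sumr_ge0 => k _; rewrite mulr_ge0 ?modulus_ge0 ?moment_ge0.
have H M : \sum_(0 <= k < M) modulus (a k) * moment mu k <= B.
  rewrite -lee_fin; apply: le_trans hB.
  rewrite integral_nneseries//; last 2 first.
  - move=> k; apply/measurable_EFinP.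
    by apply: measurable_funM; [exact: measurable_cst|exact: measurable_pow].
  - by move=> k t Et; exact: abs_term_ge0.
  rewrite -sumEFin.
  have IE k : (\int[mu]_(t in E) (modulus (a k) * t ^+ k)%:E = (modulus (a k) * moment mu k)%:E)%E.
    rewrite EFinM momentE -ge0_integralZl_EFin//; last 3 first.
    - by move=> t; rewrite /= in_itv/= => /andP[t0 _]; rewrite lee_fin exprn_ge0.
    - by apply/measurable_EFinP; exact: measurable_pow.
    - exact: modulus_ge0.
  rewrite (eq_bigr (fun k => \int[mu]_(t in E) (modulus (a k) * t ^+ k)%:E)%E); last by move=> k _; rewrite IE.
  apply: nneseries_lim_ge => k *; apply: integral_ge0 => t Et; exact: abs_term_ge0.
by exists B => //; apply: le_trans (H 0%N); rewrite big_nil.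
Qed.

(** Moments decrease, so [moment_series_le] dominates the series of every index n at once. *)
Lemma hankel_series_abs n : cvgn (series (fun k => modulus ((moment mu (n + k))%:C%C * a k))).
Proof.
have [B B0 HB] := moment_series_le.
apply: nondecreasing_is_cvgn.
  apply/nondecreasing_seqP => m.
  by rewrite !seriesEnat/= big_nat_recr//= lerDl modulus_ge0.
exists B => _ [m _ <-]; rewrite seriesEnat/=; apply: le_trans (HB m).
apply: ler_sum => k _; rewrite modulusM modulus_real ger0_norm ?moment_ge0// mulrC.
by rewrite ler_wpM2l ?modulus_ge0// moment_le// leq_addl.
Qed.

Lemma cvg_hankel_series n : hankel_series mu a n @ \oo --> hankel_coef mu a n.
Proof.
rewrite /hankel_coef /hankel_series; apply: series_abs_cvg; exact: hankel_series_abs.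
Qed.

Lemma hankel_coef_bounded : exists2 B : R, 0 <= B & forall n, modulus (hankel_coef mu a n) <= B.
Proof.
have [B B0 HB] := moment_series_le; exists B => // n.
apply: (modulus_lim_le (@cvg_hankel_series n)).
apply: nearW => m; rewrite /hankel_series seriesEnat/=.
apply: le_trans (modulus_sum _ _ _) _; apply: le_trans (HB m).
apply: ler_sum => k _; rewrite modulusM modulus_real ger0_norm ?moment_ge0// mulrC.
by rewrite ler_wpM2l ?modulus_ge0// moment_le// leq_addl.
Qed.

Lemma abs_conv_hankel_coef : abs_conv (hankel_coef mu a).
Proof.
have [B B0 HB] := hankel_coef_bounded.
move=> r /andP[r0 r1].
apply: (@series_le_cvg _ _ (fun k => B * r ^+ k)).
- by move=> k; rewrite mulr_ge0 ?modulus_ge0 ?exprn_ge0.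
- by move=> k; rewrite mulr_ge0 ?exprn_ge0.
- by move=> k; rewrite ler_wpM2r ?exprn_ge0.
- by apply: is_cvg_geometric_series; rewrite ger0_norm.
Qed.

Lemma hankel_well_definedP : hankel_well_defined mu a.
Proof.
have hg := abs_conv_hankel_coef; split.
- by move=> n; apply/cvg_ex; eexists; exact: cvg_hankel_series.
- move=> z; rewrite unit_discE => z1; apply/cvg_ex; eexists; exact: (cvg_ps hg z1).
- move=> z; rewrite unit_discE => z1.
  by have [] := taylor_derive (taylor_ps hg) z1.
Qed.

Variable f : Cplx R -> Cplx R.
Hypothesis fa : taylor_disc f a.

Lemma E_modulus t : E t -> modulus (t%:C%C : Cplx R) < 1.
Proof.
by rewrite /= in_itv/= => /andP[t0 t1]; rewrite modulus_real ger0_norm.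
Qed.

Lemma measCE_f : measCE (fun t => f t%:C%C).
Proof.
have cf (t : measurableTypeR R) : E t -> (\sum_(k <- index_iota 0 n) a k * t%:C%C ^+ k) @[n --> \oo] --> f t%:C%C.
  move=> /E_modulus h; have := fa (z := t%:C%C); rewrite unit_discE => /(_ h).
  by rewrite /power_series; under eq_fun do rewrite seriesEnat.
split.
- apply: (@measurable_fun_cvg _ _ _ _ (fun n (t : measurableTypeR R) => complex.Re (\sum_(k <- index_iota 0 n) a k * t%:C%C ^+ k))).
    by move=> n; case: (measCE_sum (index_iota 0 n) a id).
  by move=> t /cf; exact: cvg_Re.
- apply: (@measurable_fun_cvg _ _ _ _ (fun n (t : measurableTypeR R) => complex.Im (\sum_(k <- index_iota 0 n) a k * t%:C%C ^+ k))).
    by move=> n; case: (measCE_sum (index_iota 0 n) a id).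
  by move=> t /cf; exact: cvg_Im.
Qed.

(** Underlying identity: the combination is the integral of P f against mu, where P is the
    polynomial with coefficients c. Truncating the inner series at K gives finite moment sums, and
    dominated convergence with majorant [c1] times [abs_series] gives the limit. With moduli only
    real integrals occur. *)
Lemma hankel_combination_le (c : nat -> Cplx R) N :
  ((modulus (\sum_(0 <= n < N) c n * hankel_coef mu a n))%:E <=
   \int[mu]_(t in E) (modulus (\sum_(0 <= n < N) c n * t%:C%C ^+ n) * modulus (f t%:C%C))%:E)%E.
Proof.
pose P (t : measurableTypeR R) : Cplx R := \sum_(0 <= n < N) c n * t%:C%C ^+ n.
pose s K (t : measurableTypeR R) : Cplx R := \sum_(0 <= k < K) a k * t%:C%C ^+ k.
pose c1 := \sum_(0 <= n < N) modulus (c n).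
have c10 : 0 <= c1 by apply: sumr_ge0 => n _; exact: modulus_ge0.
have Pc t : E t -> modulus (P t) <= c1.
  move=> Et; apply: le_trans (modulus_sum _ _ _) _; apply: ler_sum => n _.
  rewrite modulusM modulusX ler_piMr ?modulus_ge0// exprn_ile1 ?modulus_ge0//.
  by rewrite ltW// E_modulus.
have mP : measurable_fun E (fun t => modulus (P t)).
  exact: (measCE_modulus (measCE_sum (index_iota 0 N) c id)).
have ms K : measurable_fun E (fun t => modulus (s K t)).
  exact: (measCE_modulus (measCE_sum (index_iota 0 K) a id)).
have mf := measCE_modulus measCE_f.
have step K : ((modulus (\sum_(0 <= n < N) c n * hankel_series mu a n K))%:E <=
   \int[mu]_(t in E) (modulus (P t) * modulus (s K t))%:E)%E.
  have -> : \sum_(0 <= n < N) c n * hankel_series mu a n K =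
     \sum_(i : 'I_N * 'I_K) c i.1 * a i.2 * (moment mu (i.1 + i.2))%:C%C.
    rewrite -(pair_bigA _ (fun (n : 'I_N) (k : 'I_K) => c n * a k * (moment mu (n + k))%:C%C))/=.
    rewrite big_mkord; apply: eq_bigr => n _.
    rewrite /hankel_series seriesEnat/= big_mkord mulr_sumr; apply: eq_bigr => k _.
    by ring.
  apply: (le_trans (modulus_moment_sum_le mu _ _ _)).
  rewrite le_eqVlt; apply/orP; left; apply/eqP; apply: eq_integral => t _.
  rewrite -modulusM; congr (modulus _)%:E.
  rewrite -(pair_bigA _ (fun (n : 'I_N) (k : 'I_K) => c n * a k * t%:C%C ^+ (n + k)))/=.
  rewrite /P /s !big_mkord mulr_suml; apply: eq_bigr => n _.
  by rewrite mulr_sumr; apply: eq_bigr => k _; rewrite exprD; ring.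
have cvgL : (modulus (\sum_(0 <= n < N) c n * hankel_series mu a n K))%:E @[K --> \oo] -->
   (modulus (\sum_(0 <= n < N) c n * hankel_coef mu a n))%:E.
  apply: cvg_EFin; first exact: nearW.
  apply: (@cvg_modulus R).
  by apply: cvg_combination => n; exact: cvg_hankel_series.
have F1 t : E t -> (abs_series t < +oo)%E.
  rewrite /= in_itv/= => ht; apply: le_lt_trans (ltry (majorant a t)).
  apply: nneseries_le.
    by move=> k; case/andP: ht => ? _; rewrite lee_fin mulr_ge0 ?modulus_ge0 ?exprn_ge0.
  by move=> n; rewrite sumEFin lee_fin partial_le_majorant.
have F0 t : E t -> (0 <= abs_series t)%E.
  by move=> Et; apply: nneseries_ge0 => k _ _; exact: abs_term_ge0.
have cvgR : (\int[mu]_(t in E) (modulus (P t) * modulus (s K t))%:E)%E @[K --> \oo] -->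
   (\int[mu]_(t in E) (modulus (P t) * modulus (f t%:C%C))%:E)%E.
  have D := @dominated_cvg _ (measurableTypeR R) R mu E (@measurable_E R)
    (fun K t => (modulus (P t) * modulus (s K t))%:E)
    (fun t => (modulus (P t) * modulus (f t%:C%C))%:E) (fun t => c1%:E * abs_series t)%E.
  apply: D.
  - by move=> K; apply/measurable_EFinP; exact: measurable_funM.
  - move=> t Et; apply: cvg_EFin; first exact: nearW.
    apply: cvgMr; apply: (@cvg_modulus R).
    have h := E_modulus Et; have := fa (z := t%:C%C); rewrite unit_discE => /(_ h).
    by rewrite /power_series; under eq_fun do rewrite seriesEnat.
  - by move=> t Et; rewrite fin_numM// ge0_fin_numE ?F1// F0.
  - apply: integrableZl; first exact: measurable_E.
    apply/integrableP; split; first exact: measurable_abs_series.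
    have [B hB] := abs_series_int.
    apply: le_lt_trans (ltry B); apply: le_trans hB.
    apply: ge0_le_integral.
    + exact: measurable_E.
    + by move=> t _; exact: abse_ge0.
    + by apply: measurableT_comp => //; exact: measurable_abs_series.
    + exact: measurable_abs_series.
    + by move=> t Et; rewrite gee0_abs// F0.
  - move=> K t Et.
    rewrite gee0_abs ?lee_fin ?mulr_ge0 ?modulus_ge0// EFinM.
    apply: lee_pmul; rewrite ?lee_fin ?modulus_ge0//; first exact: Pc.
    apply: (@le_trans _ _ (\sum_(0 <= k < K) (modulus (a k) * t ^+ k)%:E)%E).
      rewrite sumEFin lee_fin; apply: le_trans (modulus_sum _ _ _) _.
      apply: ler_sum => k _; rewrite modulusM modulusX modulus_real ger0_norm//.
      by move: Et; rewrite /= in_itv/= => /andP[].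
    by apply: nneseries_lim_ge => k *; exact: abs_term_ge0.
rewrite -(cvg_lim _ cvgL)// -(cvg_lim _ cvgR)//.
apply: lee_lim; [by apply/cvg_ex; eexists; exact: cvgL|by apply/cvg_ex; eexists; exact: cvgR|].
exact: nearW.
Qed.

Lemma hankel_coef0_le : ((modulus (hankel_coef mu a 0%N))%:E <=
  \int[mu]_(t in E) (modulus (f t%:C%C))%:E)%E.
Proof.
have := hankel_combination_le (fun=> 1) 1.
rewrite big_nat1 mul1r => /le_trans; apply.
rewrite le_eqVlt; apply/orP; left; apply/eqP; apply: eq_integral => t _.
by rewrite big_nat1 expr0 mulr1 modulus1 mul1r.
Qed.

Lemma measurable_kernel_modulus (z : Cplx R) :
  measurable_fun E (fun t : measurableTypeR R => modulus (1 - t%:C%C * z)).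
Proof.
have h := measCE_modulus (measCE_sum (index_iota 0 2) (fun k => if k == 0%N then 1 else - z) id).
have -> : (fun t : measurableTypeR R => modulus (1 - t%:C%C * z)) =
    (fun t => modulus (\sum_(i <- index_iota 0 2) (if i == 0%N then 1 else - z) * t%:C%C ^+ i)).
  apply/funext => t; rewrite big_nat_recl//= big_nat1 expr0 expr1 mulr1 mulNr.
  by rewrite [z * _]mulrC.
exact: h.
Qed.

(** The partial sums of g'(z) are combinations of Hankel coefficients, and their kernels t times the
    sum of (i + 1)(tz)^i are at most 2 / |1 - tz|^2 uniformly in t. The limit in N is thus taken
    outside the integral. *)
Lemma hankel_derivative_le (z : Cplx R) : modulus z < 1 ->
  ((modulus (ps (dcoef (hankel_coef mu a)) z))%:E <=
   \int[mu]_(t in E) (2 * (modulus (f t%:C%C) / modulus (1 - t%:C%C * z) ^+ 2))%:E)%E.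
Proof.
move=> z1; set g := hankel_coef mu a.
have hg := abs_conv_dcoef abs_conv_hankel_coef.
have cg := cvg_ps hg z1.
have z0 := modulus_ge0 z.
have r1 : 0 <= modulus z < 1 by rewrite z0.
have eta := near_odd_exp_le1 r1.
have main N : N.*2.+1%:R * modulus z ^+ N <= 1 ->
  ((modulus (power_series (dcoef g) z N))%:E <=
   \int[mu]_(t in E) (2 * (modulus (f t%:C%C) / modulus (1 - t%:C%C * z) ^+ 2))%:E)%E.
  move=> hN.
  (* Differentiation shifts the index: g_(m + 1) gets the factor (m + 1) z^m and g_0 gets 0. *)
  pose c n : Cplx R := if n is m.+1 then m.+1%:R * z ^+ m else 0.
  have := hankel_combination_le c N.+1.
  rewrite big_nat_recl//= mul0r add0r.
  have -> : power_series (dcoef g) z N = \sum_(0 <= i < N) c i.+1 * g i.+1.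
    rewrite /power_series seriesEnat/=; apply: eq_bigr => i _.
    by rewrite /dcoef /=; ring.
  move=> /le_trans; apply.
  have mf := measCE_modulus measCE_f.
  have mc := measCE_modulus (measCE_sum (index_iota 0 N.+1) c id).
  have m2 := measurable_kernel_modulus z.
  apply: ge0_le_integral.
  - exact: (@measurable_E R).
  - by move=> t _; rewrite lee_fin mulr_ge0 ?modulus_ge0.
  - by apply/measurable_EFinP; exact: measurable_funM.
  - apply/measurable_EFinP; apply: measurable_funM => //; apply: measurable_funM => //.
    have -> : (fun t : measurableTypeR R => (modulus (1 - t%:C%C * z) ^+ 2)^-1) =
       (fun t => modulus (1 - t%:C%C * z) `^ (- 2)).
      by apply/funext => t; rewrite -[2 in RHS]/(2%:R) powR_invn ?modulus_ge0.
    by apply: (measurableT_comp (measurable_powR (- 2))).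
  move=> t Et; rewrite lee_fin.
  have t1 := E_modulus Et; have Et' := Et.
  move: Et'; rewrite /= in_itv/= => /andP[t0 tl1].
  set w : Cplx R := t%:C%C * z.
  have wz : modulus w <= modulus z by rewrite modulusM ler_piMl// ltW.
  have w1 : 0 < modulus (1 - w).
    apply: lt_le_trans (modulusB _ _); rewrite modulus1 subr_gt0.
    exact: le_lt_trans z1.
  rewrite [leRHS]mulrCA [leRHS]mulrC ler_wpM2r ?modulus_ge0//.
  rewrite ler_pdivlMr ?exprn_gt0//.
  rewrite big_nat_recl// mul0r add0r.
  have -> : \sum_(0 <= i < N) c i.+1 * t%:C%C ^+ i.+1 = t%:C%C * \sum_(0 <= i < N) i.+1%:R * w ^+ i.
    by rewrite mulr_sumr; apply: eq_bigr => i _; rewrite /c /w exprMn exprS; ring.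
  rewrite modulusM -mulrA; apply: le_trans (derivative_geometric_le wz (ltW z1) hN).
  by rewrite ler_piMl ?mulr_ge0 ?exprn_ge0 ?modulus_ge0// ltW.
have cgE : (modulus (power_series (dcoef g) z N))%:E @[N --> \oo] --> (modulus (ps (dcoef g) z))%:E.
  by apply: cvg_EFin; [exact: nearW|exact: (@cvg_modulus R)].
rewrite -(cvg_lim _ cgE)//; apply: lime_le; first by apply/cvg_ex; eexists; exact: cgE.
by apply: filterS eta => N; exact: main.
Qed.

End CarlesonSums.

Lemma ps0 (R : realType) (a : nat -> Cplx R) : ps a 0 = a 0%N.
Proof.
apply: cvgC_lim; apply/cvg_modulusP/cvgrPdist_lt => e e0.
near=> n; rewrite sub0r normrN.
have -> : power_series a 0 n = a 0%N; last by rewrite subrr modulus0 normr0.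
have : (0 < n)%N by near: n; exact: nbhs_infty_gt.
move=> n0; rewrite -(prednK n0) /power_series seriesEnat/= big_nat_recl// expr0 mulr1.
by rewrite big1 ?addr0// => i _; rewrite exprS mul0r mulr0.
Unshelve. all: by end_near.
Qed.

(** * Dirichlet norm and energy *)

Section DirichletNorm.
Variable R : realType.
Variables p alpha : R.
Hypothesis p1 : 1 < p.
Hypothesis alpha_gt : p - 2 < alpha.
Hypothesis alpha_le : alpha <= p - 1.
Local Notation D1 := (disc (0 : Cplx R)%R 1 : set (plane R)).

Definition kappa : R := (alpha + 1) / pi.

Lemma kappa_gt0 : 0 < kappa.
Proof. by rewrite divr_gt0 ?pi_gt0//; have := p1; have := alpha_gt; lra. Qed.

Lemma dirichlet_normE f : dirichlet_norm p alpha f =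
  ((modulus (f 0))%:E + (kappa%:E * energy p alpha (derive1 f) D1) `^ p^-1)%E.
Proof.
rewrite /dirichlet_norm /disc_integral muleA -EFinM /energy.
have -> : D1 = [set w : R * R | unit_disc ((w.1 +i* w.2)%C : Cplx R)].
  apply/funext => w; rewrite disc0E.
  rewrite -[RHS]/(unit_disc (toC w)); exact/esym/unit_discE.
by rewrite unlock.
Qed.

Lemma energy_derive1 f a : taylor_disc f a ->
  energy p alpha (derive1 f) D1 = energy p alpha (ps (dcoef a)) D1.
Proof.
move=> fa; apply: eq_integral => w; rewrite inE disc0E => w1.
by have [_ ->] := taylor_derive fa w1.
Qed.

Lemma dirichlet_spaceP f a : taylor_disc f a ->
  (energy p alpha (ps (dcoef a)) D1 < +oo)%E -> dirichlet_space p alpha f.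
Proof.
move=> fa fin; split.
  by move=> z; rewrite unit_discE => z1; case: (taylor_derive fa z1).
rewrite dirichlet_normE (energy_derive1 fa).
apply: lte_add_pinfty; first exact: ltry.
have E0 : (0 <= energy p alpha (ps (dcoef a)) D1)%E by exact: energy_ge0.
have : energy p alpha (ps (dcoef a)) D1 \is a fin_num by rewrite ge0_fin_numE.
by move=> /fineK <-; rewrite -EFinM poweR_EFin ltry.
Qed.

Lemma root_powR_le x K L : 0 <= x -> 0 <= K -> 0 <= L -> x <= K * L `^ p ->
  x `^ p^-1 <= K `^ p^-1 * L.
Proof.
move=> x0 K0 L0 h.
have p0 : 0 < p by rewrite (lt_trans _ p1).
apply: le_trans (powR_le (q := p^-1) _ x0 h) _; first by rewrite invr_ge0 ltW.
by rewrite powRM ?powR_ge0// -powRrM divff ?gt_eqF// powRr1.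
Qed.

Lemma dirichlet_norm_le f a K L : taylor_disc f a -> 0 <= K -> 0 <= L ->
  modulus (f 0) <= L ->
  (energy p alpha (ps (dcoef a)) D1 <= (K * L `^ p)%:E)%E ->
  (dirichlet_norm p alpha f <= ((1 + (kappa * K) `^ p^-1) * L)%:E)%E.
Proof.
move=> fa K0 L0 h0 h1; rewrite dirichlet_normE (energy_derive1 fa).
have E0 : (0 <= energy p alpha (ps (dcoef a)) D1)%E by exact: energy_ge0.
have Ef : energy p alpha (ps (dcoef a)) D1 \is a fin_num.
  by rewrite ge0_fin_numE// (le_lt_trans h1) ?ltry.
move: E0 h1; rewrite -(fineK Ef) !lee_fin => E0 h1.
rewrite mulrDl mul1r lerD//.
have k0 := ltW kappa_gt0.
apply: root_powR_le => //; [exact: mulr_ge0|exact: mulr_ge0|].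
by rewrite -(mulrA (kappa)) ler_wpM2l.
Qed.

Lemma dirichlet_norm_ge f a e : taylor_disc f a -> 0 <= e ->
  (dirichlet_norm p alpha f <= e%:E)%E ->
  modulus (f 0) <= e /\ (energy p alpha (ps (dcoef a)) D1 <= (kappa^-1 * e `^ p)%:E)%E.
Proof.
move=> fa e0; rewrite dirichlet_normE (energy_derive1 fa) => h.
have p0 : 0 < p by rewrite (lt_trans _ p1).
have E0 : (0 <= energy p alpha (ps (dcoef a)) D1)%E by exact: energy_ge0.
have k0 := kappa_gt0.
split.
  by rewrite -lee_fin; apply: le_trans h; rewrite leeDl// poweR_ge0.
have {}h : ((kappa%:E * energy p alpha (ps (dcoef a)) D1) `^ p^-1 <= e%:E)%E.
  by apply: le_trans h; rewrite leeDr// lee_fin modulus_ge0.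
have h2 : ((kappa%:E * energy p alpha (ps (dcoef a)) D1) <= (e `^ p)%:E)%E.
  have n0 : (0 <= kappa%:E * energy p alpha (ps (dcoef a)) D1)%E.
    by rewrite mule_ge0// lee_fin ltW.
  have := @gt0_ler_poweR R p (ltW p0) _ _ _ _ h.
  rewrite !in_itv/= !leey !andbT poweR_ge0 lee_fin => /(_ isT e0).
  by rewrite -poweRrM mulVf ?gt_eqF// poweRe1// poweR_EFin.
have := lee_wpmul2l (x := kappa^-1%:E) _ h2.
rewrite lee_fin invr_ge0 ltW// => /(_ isT).
by rewrite muleA -!EFinM mulVf ?gt_eqF// mul1e.
Qed.

(** The disc is cut along |1 - w| / 2, which lies in (0, 1]; its m-th level is contained in
    [near1 m]. The bounds k m are extended reals because they will be sums of series. *)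
Lemma energy_dyadic_le (b : nat -> Cplx R) (k : nat -> \bar R) (CW : R) : abs_conv b ->
  (forall m, \int[lam2 R]_(w in near1 m) (weight alpha w)%:E <=
    (CW * hp m `^ (alpha + 2))%:E)%E ->
  (forall m, 0 <= k m)%E ->
  (forall m w, D1 w -> hp m.+1 < modulus (1 - toC w) / 2 ->
    ((modulus (ps b (toC w)))%:E <= k m)%E) ->
  (energy p alpha (ps b) D1 <=
   \sum_(0 <= m <oo) k m `^ p * (CW * hp m `^ (alpha + 2))%:E)%E.
Proof.
move=> hb hCW k0 bk; have p0 : 0 < p by rewrite (lt_trans _ p1).
pose u (w : plane R) := modulus (1 - toC w) / 2.
have mu_ : measurable_fun D1 u by apply: measurable_funM => //; exact: measurable_modulus1.
rewrite /energy (@dyadic_integral R _ _ (lam2 R) D1 u); last first.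
- move=> w; rewrite disc0E => w1; rewrite /u ltr_pdivlMr// ler_pdivrMr// mul0r mul1r.
  have := modulusB 1 (toC w); have := modulusD 1 (- toC w).
  by rewrite modulus1 modulusN => h1 h2; apply/andP; split; lra.
- by move=> w _; exact: energy_density_ge0.
- by apply: measurable_energy_density.
- exact: mu_.
- exact: measurable_disc.
apply: lee_nneseries => m _.
  by move=> _; apply: integral_ge0 => w _; exact: energy_density_ge0.
have mlev : measurable (level D1 u m) by apply: measurable_level => //; exact: measurable_disc.
have sub : level D1 u m `<=` D1 by move=> w [].
apply: (@le_trans _ _ (\int[lam2 R]_(w in level D1 u m) (k m `^ p * (weight alpha w)%:E))%E).
  apply: ge0_le_integral => //.
  - by move=> w _; exact: energy_density_ge0.
  - exact: measurable_energy_density.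
  - by apply: emeasurable_funM => //; apply/measurable_EFinP; exact: measurable_weight.
  move=> w [Dw /andP[hw _]].
  rewrite EFinM muleC lee_wpmul2r ?lee_fin ?weight_ge0// -poweR_EFin.
  apply: gt0_ler_poweR; rewrite ?(ltW p0)// ?in_itv/= ?leey ?andbT ?lee_fin ?modulus_ge0//.
  exact: bk.
rewrite ge0_integralZl//; last 3 first.
- by apply/measurable_EFinP; exact: measurable_weight.
- by move=> w _; rewrite lee_fin weight_ge0.
- exact: poweR_ge0.
rewrite lee_wpmul2l ?poweR_ge0//; apply: le_trans (hCW m); apply: ge0_subset_integral => //.
- exact: measurable_near1.
- by apply/measurable_EFinP; exact: measurable_weight.
- by move=> w _; rewrite lee_fin weight_ge0.
- by move=> w [Dw /andP[_ hw]]; split => //=; move: hw; rewrite /u ler_pdivrMr// mulrC.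
Qed.

End DirichletNorm.

(** * Carleson measures give bounded operators *)

Section Sufficiency.
Variable R : realType.
Variables p alpha : R.
Hypothesis p1 : 1 < p.
Hypothesis alpha_gt : p - 2 < alpha.
Hypothesis alpha_le : alpha <= p - 1.
Variable mu : {finite_measure set (measurableTypeR R) -> \bar R}.
Variable C : R.
Hypothesis C0 : 0 < C.
Hypothesis carleson : forall t : R, 0 <= t < 1 -> (mu [set` `[t, 1%R[] <= (C * (1 - t))%:E)%E.
Local Notation D1 := (disc (0 : Cplx R)%R 1 : set (plane R)).
Local Notation E := (`[0%R, 1%R[%classic : set (measurableTypeR R)).
Local Notation theta := (theta p alpha).
Local Notation beta := (beta p alpha).

Lemma hankel_estimates f a L : 0 < L -> taylor_disc f a ->
  (energy p alpha (ps (dcoef a)) D1 <= (L `^ p)%:E)%E ->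
  [/\ hankel_well_defined mu a, abs_conv (hankel_coef mu a),
      ((modulus (hankel_coef mu a 0%N))%:E <= \int[mu]_(t in E) (modulus (f t%:C%C))%:E)%E &
      forall z, modulus z < 1 ->
        ((modulus (ps (dcoef (hankel_coef mu a)) z))%:E <=
         \int[mu]_(t in E) (2 * (modulus (f t%:C%C) / modulus (1 - t%:C%C * z) ^+ 2))%:E)%E].
Proof.
move=> L0 fa hE; have ha := taylor_abs_conv fa.
have [v [C' [v02 C'0 growth]]] := coefficient_growth p1 alpha_gt alpha_le ha L0 hE.
have A0 := modulus_ge0 (a 0%N).
split.
- exact: (hankel_well_definedP C0 carleson A0 C'0 v02 growth).
- by move=> r r01; exact: (abs_conv_hankel_coef C0 carleson A0 C'0 v02 growth r01).
- exact: (hankel_coef0_le C0 carleson ha A0 C'0 v02 growth fa).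
- move=> z z1; exact: (hankel_derivative_le C0 carleson ha A0 C'0 v02 growth fa z1).
Qed.

(** For the second bound, |1 - z| <= |1 - tz| + (1 - t)|z|, and the last term is at most |1 - tz| by
    the first bound. *)
Lemma kernel_denominator (t : R) (z : Cplx R) : 0 <= t <= 1 -> modulus z <= 1 ->
  1 - t <= modulus (1 - t%:C%C * z) /\ modulus (1 - z) / 2 <= modulus (1 - t%:C%C * z).
Proof.
move=> /andP[t0 t1] z1.
have h1 : 1 - t <= modulus (1 - t%:C%C * z).
  apply: le_trans (modulusB _ _); rewrite modulus1 lerD2l lerN2 modulusM modulus_real.
  by rewrite ger0_norm// ler_piMr.
split => //.
have -> : 1 - z = (1 - t%:C%C * z) - (1 - t)%:C%C * z.
  by rewrite rmorphB rmorph1; ring.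
have := modulusD (1 - t%:C%C * z) (- ((1 - t)%:C%C * z)).
rewrite modulusN modulusM modulus_real ger0_norm ?subr_ge0// => h2.
have h3 : (1 - t) * modulus z <= 1 - t by rewrite ler_piMr ?subr_ge0.
by rewrite ler_pdivrMr//; lra.
Qed.

Lemma kernel_level_le j m (t : R) (z : Cplx R) : 0 <= t < 1 -> modulus z <= 1 ->
  hp j.+1 < 1 - t -> hp m.+1 < modulus (1 - z) / 2 ->
  (modulus (1 - t%:C%C * z) ^+ 2)^-1 <= 4 * Num.min (hp j ^- 2) (hp m ^- 2).
Proof.
move=> /andP[t0 t1] z1 hj hm.
have t01 : 0 <= t <= 1 by rewrite t0 ltW.
have [d1 d2] := kernel_denominator t01 z1.
have aux n : hp n.+1 < modulus (1 - t%:C%C * z) ->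
  (modulus (1 - t%:C%C * z) ^+ 2)^-1 <= 4 * hp n ^- 2.
  move=> h; have g := hp_gt0 R n.+1; have g' := hp_gt0 R n.
  have e : 4 * hp n ^- 2 = (hp n.+1 ^+ 2)^-1 :> R.
    by rewrite hpS; field; rewrite gt_eqF.
  rewrite e lef_pV2 ?posrE ?exprn_gt0//; last exact: lt_trans h.
  by rewrite ler_pXn2r ?nnegrE ?modulus_ge0 ?ltW.
have a1 := aux j (lt_le_trans hj d1); have a2 := aux m (lt_le_trans hm d2).
by rewrite minEle; case: ifP.
Qed.

Variables (f : Cplx R -> Cplx R) (a : nat -> Cplx R) (L K CW : R) (F : nat -> R).
Hypothesis L0 : 0 < L.
Hypothesis fa : taylor_disc f a.
Hypothesis fE : (energy p alpha (ps (dcoef a)) D1 <= (L `^ p)%:E)%E.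
Hypothesis K0 : 0 < K.
Hypothesis F0 : forall j, 0 <= F j.
Hypothesis fF : forall j t, 0 <= t -> hp j.+1 <= 1 - t <= hp j -> modulus (f t%:C%C) <= F j.
Let H m := (\sum_(0 <= j <oo) (theta ^+ dist j m * (hp j `^ (beta - 1) * F j))%:E)%E.
Hypothesis HL : (\sum_(0 <= m <oo) H m `^ p <= (K * L `^ p)%:E)%E.
Hypothesis CW0 : 0 < CW.
Hypothesis hCW : forall m, (\int[lam2 R]_(w in near1 m) (weight alpha w)%:E <=
  (CW * hp m `^ (alpha + 2))%:E)%E.

Let termge0 j m : 0 <= theta ^+ dist j m * (hp j `^ (beta - 1) * F j).
Proof.
have /andP[t0 _] := theta01 p1 alpha_gt alpha_le.
by rewrite !mulr_ge0 ?exprn_ge0 ?powR_ge0.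
Qed.

Let Hge0 m : (0 <= H m)%E.
Proof. by apply: nneseries_ge0 => j _ _; rewrite lee_fin termge0. Qed.

Let levelE j (t : measurableTypeR R) : level E (@gap R) j t ->
  [/\ 0 <= t, t < 1, hp j.+1 < 1 - t & 1 - t <= hp j].
Proof. by rewrite /level /gap/= in_itv/= => -[/andP[-> ->] /andP[-> ->]]. Qed.

(** |g(0)| is controlled by the term m = 0 of the same kernel sums: there the minimum in
    [hardy_kernel] is 1, so the sum of hp j F j is at most H 0. *)
Lemma hankel_coef0_energy : modulus (hankel_coef mu a 0%N) <= (C `^ p * K) `^ p^-1 * L.
Proof.
have p0 : 0 < p by rewrite (lt_trans _ p1).
have [_ _ h _] := hankel_estimates L0 fa fE.
have h1 : ((modulus (hankel_coef mu a 0%N))%:E <= C%:E * H 0%N)%E.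
  apply: le_trans h _; apply: le_trans (carleson_integral_le carleson (F := F) _ _ F0 _) _.
  - by apply/measurable_EFinP; exact: measCE_modulus (measCE_f fa).
  - by move=> t _; rewrite lee_fin modulus_ge0.
  - by move=> j t /levelE[t0 _ h1 h2]; rewrite lee_fin; apply: fF => //; rewrite (ltW h1).
  rewrite /H -nneseriesZl; last by move=> j _; rewrite lee_fin termge0.
  apply: lee_nneseries => j _.
    by move=> _; rewrite lee_fin !mulr_ge0 ?hp_ge0 ?(ltW C0).
  rewrite -EFinM lee_fin ler_wpM2l ?(ltW C0)//.
  rewrite mulrA ler_wpM2r//.
  have := hardy_kernel p alpha 0 j.
  rewrite hp0 powR1 mul1r; apply: le_trans.
  rewrite expr1n invr1 min_r ?mulr1//.
  have hj := hp_gt0 R j.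
  by rewrite invf_ge1 ?exprn_gt0// exprn_ile1 ?hp_le1 ?(ltW hj).
have h2 : ((modulus (hankel_coef mu a 0%N) `^ p)%:E <= (C `^ p * K * L `^ p)%:E)%E.
  rewrite -poweR_EFin.
  apply: (@le_trans _ _ ((C%:E * H 0%N) `^ p)%E).
    apply: gt0_ler_poweR => //; rewrite ?(ltW p0)// in_itv/= leey andbT ?lee_fin ?modulus_ge0//.
    by rewrite mule_ge0// lee_fin ltW.
  rewrite poweRM ?lee_fin ?(ltW C0)// poweR_EFin -mulrA EFinM lee_wpmul2l ?lee_fin ?powR_ge0//.
  apply: le_trans HL.
  have := nneseries_lim_ge (u_ := fun m => (H m `^ p)%E) (P := xpredT) (m := 0%N) 1.
  by rewrite big_nat1; apply => *; exact: poweR_ge0.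
have := root_powR_le p1 (powR_ge0 _ _) _ (ltW L0) h2.
rewrite -powRrM divff ?gt_eqF// powRr1 ?modulus_ge0//; apply.
by rewrite mulr_ge0 ?powR_ge0// ltW.
Qed.

(** 8 is 2 from [hankel_derivative_le] times 4 from [kernel_level_le]; the factor of exponent -beta
    compensates the one in [hardy_kernel]. *)
Lemma hankel_derivative_level m w : D1 w -> hp m.+1 < modulus (1 - toC w) / 2 ->
  ((modulus (ps (dcoef (hankel_coef mu a)) (toC w)))%:E <=
   (8 * C * hp m `^ (- beta))%:E * H m)%E.
Proof.
rewrite disc0E => w1 hm.
have [_ _ _ h] := hankel_estimates L0 fa fE.
have b0 : hp m `^ beta * hp m `^ (- beta) = 1 :> R.
  by rewrite powRN divff// gt_eqF// powR_gt0// hp_gt0.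
apply: le_trans (h _ w1) _.
have min0 j : 0 <= Num.min (hp j ^- 2) (hp m ^- 2) :> R.
  by rewrite le_min !invr_ge0 !exprn_ge0 ?hp_ge0.
apply: le_trans (carleson_integral_le carleson
   (F := fun j => 2 * (F j * (4 * Num.min (hp j ^- 2) (hp m ^- 2)))) _ _ _ _) _.
- apply/measurable_EFinP; apply: measurable_funM => //; apply: measurable_funM.
    exact: measCE_modulus (measCE_f fa).
  have -> : (fun t : measurableTypeR R => (modulus (1 - t%:C%C * toC w) ^+ 2)^-1) =
     (fun t => modulus (1 - t%:C%C * toC w) `^ (- 2)).
    by apply/funext => t; rewrite -[2 in RHS]/(2%:R) powR_invn ?modulus_ge0.
  apply: (measurableT_comp (measurable_powR (- 2))).
  exact: measurable_kernel_modulus.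
- by move=> t _; rewrite lee_fin !mulr_ge0 ?invr_ge0 ?exprn_ge0 ?modulus_ge0.
- by move=> j; rewrite !mulr_ge0.
- move=> j t /levelE[t0 t1 h1 h2]; rewrite lee_fin ler_wpM2l//.
  apply: ler_pM; rewrite ?modulus_ge0 ?invr_ge0 ?exprn_ge0 ?modulus_ge0//.
    by apply: fF => //; rewrite (ltW h1).
  by apply: kernel_level_le => //; rewrite ?t0 ?t1 ?ltW.
rewrite /H -nneseriesZl; last by move=> j _; rewrite lee_fin termge0.
apply: lee_nneseries => j _.
  by move=> _; rewrite lee_fin !mulr_ge0 ?hp_ge0 ?(ltW C0).
rewrite -EFinM lee_fin.
have k := hardy_kernel p alpha m j.
rewrite [leRHS](_ : _ = (8 * C) * (hp m `^ (- beta) * F j) * (theta ^+ dist j m * hp j `^ (beta - 1))); last by ring.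
apply: le_trans (ler_wpM2l _ k); last by rewrite !mulr_ge0 ?powR_ge0 ?(ltW C0).
rewrite le_eqVlt; apply/orP; left; apply/eqP.
rewrite [RHS](_ : _ = (hp m `^ beta * hp m `^ (- beta)) * (8 * C * F j * (hp j * Num.min (hp j ^- 2) (hp m ^- 2)))); last by ring.
by rewrite b0 mul1r; ring.
Qed.

(** Raised to the power p, the factor of exponent -beta becomes one of exponent -(alpha + 2) and
    cancels the mass of the weight on [near1 m]. *)
Lemma hankel_energy_le : (energy p alpha (ps (dcoef (hankel_coef mu a))) D1 <=
  ((8 * C) `^ p * CW * K * L `^ p)%:E)%E.
Proof.
have p0 : 0 < p by rewrite (lt_trans _ p1).
have [_ hg _ _] := hankel_estimates L0 fa fE.
have c0 m : 0 <= 8 * C * hp m `^ (- beta).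
  by rewrite !mulr_ge0 ?powR_ge0 ?(ltW C0).
apply: le_trans (energy_dyadic_le p1 (abs_conv_dcoef hg) hCW
  (k := fun m => ((8 * C * hp m `^ (- beta))%:E * H m)%E) _ _) _.
- by move=> m; rewrite mule_ge0 ?lee_fin.
- exact: hankel_derivative_level.
apply: (@le_trans _ _ (\sum_(0 <= m <oo) ((8 * C) `^ p * CW)%:E * H m `^ p)%E); last first.
  rewrite nneseriesZl; last by move=> *; exact: poweR_ge0.
  have -> : ((8 * C) `^ p * CW * K * L `^ p)%:E = (((8 * C) `^ p * CW)%:E * (K * L `^ p)%:E)%E.
    by rewrite -EFinM !mulrA.
  by apply: lee_wpmul2l => //; rewrite lee_fin mulr_ge0 ?powR_ge0// ltW.
apply: lee_nneseries => m _.
  by move=> _; rewrite mule_ge0 ?poweR_ge0// lee_fin mulr_ge0 ?powR_ge0// ltW.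
rewrite poweRM ?lee_fin// poweR_EFin muleAC -EFinM lee_wpmul2r ?poweR_ge0// lee_fin.
rewrite powRM ?powR_ge0 ?mulr_ge0 ?(ltW C0)// -powRrM mulNr beta_p//.
have b0 : hp m `^ (- (alpha + 2)) * hp m `^ (alpha + 2) = 1 :> R.
  by rewrite powRN mulVf// gt_eqF// powR_gt0// hp_gt0.
rewrite [leLHS](_ : _ = (8 * C) `^ p * CW * (hp m `^ (- (alpha + 2)) * hp m `^ (alpha + 2))); last by ring.
by rewrite b0 mulr1.
Qed.

End Sufficiency.

Section SufficiencyTheorem.
Variable R : realType.
Variables p alpha : R.
Hypothesis p1 : 1 < p.
Hypothesis alpha_gt : p - 2 < alpha.
Hypothesis alpha_le : alpha <= p - 1.
Variable mu : {finite_measure set (measurableTypeR R) -> \bar R}.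
Hypothesis mu_carleson : carleson_measure mu.
Local Notation D1 := (disc (0 : Cplx R)%R 1 : set (plane R)).

Lemma carleson_hankel_energy : exists2 M : R, 0 < M & forall f a L, 0 < L ->
  taylor_disc f a -> modulus (f 0) <= L ->
  (energy p alpha (ps (dcoef a)) D1 <= (L `^ p)%:E)%E ->
  [/\ hankel_well_defined mu a, dirichlet_space p alpha (hankel_op mu a) &
      (dirichlet_norm p alpha (hankel_op mu a) <= (M * L)%:E)%E].
Proof.
have [C C0 carleson] := mu_carleson.
have [K K0 hK] := hardy_bound p1 alpha_gt alpha_le.
have a1 : -1 < alpha by have := p1; have := alpha_gt; lra.
have [CW CW0 hCW] := weight_near1_le a1.
have k0 := kappa_gt0 p1 alpha_gt.
(* The summand 1 gives M1 L >= L, so M1 L can replace L in the energy bound while dominating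
   |g(0)|. *)
pose M1 := 1 + (C `^ p * K) `^ p^-1.
pose M2 := (8 * C) `^ p * CW * K.
have M20 : 0 <= M2 by rewrite !mulr_ge0 ?powR_ge0// ltW.
have M10 : 1 <= M1 by rewrite lerDl powR_ge0.
exists ((1 + (kappa alpha * M2) `^ p^-1) * M1).
  by rewrite mulr_gt0// ?(lt_le_trans _ M10)// ltr_wpDr// powR_ge0.
move=> f a L L0 fa f0 fE.
have [F [F0 fF HL]] := hK f a L L0 fa f0 fE.
have [wd hg _ _] := hankel_estimates p1 alpha_gt alpha_le C0 carleson L0 fa fE.
have e0 := hankel_coef0_energy p1 alpha_gt alpha_le C0 carleson L0 fa fE K0 F0 fF HL.
have e1 := hankel_energy_le p1 alpha_gt alpha_le C0 carleson L0 fa fE F0 fF HL CW0 hCW.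
have ta : taylor_disc (hankel_op mu a) (hankel_coef mu a) by exact: taylor_ps.
have M1L : L <= M1 * L by rewrite ler_peMl// ltW.
have z1 : modulus (0 : Cplx R) < 1 by rewrite modulus0.
have g0 : modulus (hankel_op mu a 0) <= M1 * L.
  rewrite (taylorE ta z1) ps0 (le_trans e0)// ler_wpM2r ?(ltW L0)//.
  by rewrite lerDr.
have e2 : (energy p alpha (ps (dcoef (hankel_coef mu a))) D1 <= (M2 * (M1 * L) `^ p)%:E)%E.
  apply: le_trans e1 _; rewrite lee_fin ler_wpM2l// powR_le// ?ltW//.
  by rewrite (lt_trans _ p1).
split; first exact: wd.
  by apply: (dirichlet_spaceP ta); exact: le_lt_trans e2 (ltry _).
rewrite -mulrA; apply: (dirichlet_norm_le p1 alpha_gt ta M20 _ g0 e2).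
by rewrite (le_trans (ltW L0)).
Qed.

Lemma carleson_hankel_bounded :
  hankel_well_defined_on mu p alpha /\ hankel_bounded_on mu p alpha.
Proof.
have [M M0 HM] := carleson_hankel_energy.
have k0 := kappa_gt0 p1 alpha_gt.
(* S^p dominates the factor 1 / kappa relating energy and norm, and S >= 1 keeps the bound on
   |f(0)|. *)
pose S := 1 + (kappa alpha)^-1 `^ p^-1.
have S1 : 1 <= S by rewrite lerDl powR_ge0.
have p0 : 0 < p by rewrite (lt_trans _ p1).
have main f a : dirichlet_space p alpha f -> taylor_disc f a ->
  [/\ hankel_well_defined mu a, dirichlet_space p alpha (hankel_op mu a) &
    (dirichlet_norm p alpha (hankel_op mu a) <= (M * S)%:E * dirichlet_norm p alpha f)%E].
  move=> [_ ffin] fa.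
  have N0 : (0 <= dirichlet_norm p alpha f)%E.
    by rewrite adde_ge0 ?lee_fin ?modulus_ge0// poweR_ge0.
  have Nf : dirichlet_norm p alpha f \is a fin_num by rewrite ge0_fin_numE.
  set N := fine (dirichlet_norm p alpha f).
  have NE : dirichlet_norm p alpha f = N%:E by rewrite fineK.
  have N00 : 0 <= N by rewrite -lee_fin -NE.
  have NE' : (dirichlet_norm p alpha f <= N%:E)%E by rewrite NE.
  have [h0 h1] := dirichlet_norm_ge p1 alpha_gt fa N00 NE'.
  (* [carleson_hankel_energy] needs a positive L whereas the norm N may be 0, so N + e is used and e
     tends to 0. *)
  have step e : 0 < e -> [/\ hankel_well_defined mu a, dirichlet_space p alpha (hankel_op mu a) &
      (dirichlet_norm p alpha (hankel_op mu a) <= (M * (S * (N + e)))%:E)%E].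
    move=> e0; have Ne : 0 < N + e by rewrite ltr_wpDl.
    have NS : N <= S * (N + e).
      by apply: (@le_trans _ _ (N + e)); [rewrite lerDl ltW|rewrite ler_peMl// ltW].
    apply: (HM f a (S * (N + e))) => //.
    - by rewrite mulr_gt0// (lt_le_trans _ S1).
    - exact: le_trans NS.
    apply: le_trans h1 _; rewrite lee_fin powRM ?(ltW Ne) ?(le_trans _ S1)//.
    apply: ler_pM; rewrite ?invr_ge0 ?powR_ge0// ?(ltW k0)//.
      rewrite -[leLHS](@powRr1 _ (kappa alpha)^-1) ?invr_ge0 ?(ltW k0)//.
      rewrite -(@mulVf _ p) ?gt_eqF// powRrM powR_le ?(ltW p0) ?powR_ge0//.
      by rewrite lerDr.
    by apply: powR_le; rewrite ?(ltW p0)// lerDl ltW.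
  have [wd ds _] := step 1 ltr01.
  split; [exact: wd|exact: ds|]; rewrite NE; apply/lee_addgt0Pr => e e0.
  have MS : 0 < M * S by rewrite mulr_gt0// (lt_le_trans _ S1).
  have [_ _] := step (e / (M * S)) (divr_gt0 e0 MS).
  by rewrite mulrA mulrDr mulrCA divff ?mulr1 ?gt_eqF// EFinD EFinM.
split; first by move=> f a df fa; case: (main f a df fa).
exists (M * S); first by rewrite mulr_gt0// (lt_le_trans _ S1).
by move=> f a df fa; case: (main f a df fa).
Qed.

End SufficiencyTheorem.

(** * Necessity of the Carleson condition *)

Lemma sum_succ_ge (R : realFieldType) (n : nat) :
  2^-1 * n%:R ^+ 2 <= \sum_(0 <= j < n) j.+1%:R :> R.
Proof.
elim: n => [|n IH]; first by rewrite big_nil expr0n mulr0.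
rewrite big_nat_recr//; apply: le_trans (lerD IH (lexx _)).
by rewrite -(natr1 n); move: (n%:R : R) => x; rewrite !expr2; lra.
Qed.

Section GeometricTest.
Variable R : realType.
Variables p alpha : R.
Hypothesis p1 : 1 < p.
Hypothesis alpha_gt : p - 2 < alpha.
Hypothesis alpha_le : alpha <= p - 1.
Local Notation D1 := (disc (0 : Cplx R)%R 1 : set (plane R)).
Local Notation theta := (theta p alpha).
Local Notation beta := (beta p alpha).

(* Taylor coefficients of 1 / (1 - bz). *)
Definition geom (b : R) (k : nat) : Cplx R := b%:C%C ^+ k.

Lemma modulus_geom b k : 0 <= b -> modulus (geom b k) = b ^+ k.
Proof. by move=> b0; rewrite /geom modulusX modulus_real ger0_norm. Qed.

Lemma abs_conv_geom b : 0 <= b <= 1 -> abs_conv (geom b).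
Proof.
move=> /andP[b0 b1] r /andP[r0 r1].
apply: (@series_le_cvg _ _ (fun k => r ^+ k)).
- by move=> k; rewrite mulr_ge0 ?modulus_ge0 ?exprn_ge0.
- by move=> k; rewrite exprn_ge0.
- by move=> k; rewrite modulus_geom// ler_piMl ?exprn_ge0// exprn_ile1.
- have := @is_cvg_geometric_series R 1 r; rewrite ger0_norm// => /(_ r1).
  by rewrite /geometric; under eq_fun do rewrite mul1r.
Qed.

Lemma geom_derivative_le b z : 0 <= b <= 1 -> modulus z < 1 ->
  modulus (ps (dcoef (geom b)) z) <= 2 * (modulus (1 - b%:C%C * z) ^+ 2)^-1.
Proof.
move=> b01 z1; case/andP: (b01) => b0 b1.
have hd := abs_conv_dcoef (abs_conv_geom b01).
apply: (modulus_lim_le (cvg_ps hd z1)).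
have r1 : 0 <= modulus z < 1 by rewrite modulus_ge0.
have wz : modulus (b%:C%C * z) <= modulus z.
  by rewrite modulusM modulus_real ger0_norm// ler_piMl ?modulus_ge0.
have w1 : 0 < modulus (1 - b%:C%C * z).
  apply: lt_le_trans (modulusB _ _); rewrite modulus1 subr_gt0.
  exact: le_lt_trans z1.
apply: filterS (near_odd_exp_le1 r1) => N hN.
rewrite ler_pdivlMr ?exprn_gt0//.
have -> : power_series (dcoef (geom b)) z N =
    b%:C%C * \sum_(0 <= n < N) n.+1%:R * (b%:C%C * z) ^+ n.
  rewrite /power_series seriesEnat/= mulr_sumr; apply: eq_bigr => n _.
  by rewrite /dcoef /geom exprMn exprS; ring.
rewrite modulusM -mulrA modulus_real ger0_norm//.
apply: le_trans (derivative_geometric_le wz (ltW z1) hN).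
by rewrite ler_piMl// mulr_ge0 ?exprn_ge0 ?modulus_ge0.
Qed.

(** With 1 - b at level n, the derivative of 1 / (1 - bz) is bounded by the kernel of [hardy_kernel]
    at the single index j = n, so one sum over m remains. *)
Lemma geom_energy_le : exists2 K : R, 0 < K & forall b n,
  0 <= b < 1 -> hp n.+1 < 1 - b ->
  (energy p alpha (ps (dcoef (geom b))) D1 <= (K * (hp n `^ (beta - 2)) `^ p)%:E)%E.
Proof.
have p0 : 0 < p by rewrite (lt_trans _ p1).
have a1 : -1 < alpha by have := p1; have := alpha_gt; lra.
have [CW CW0 hCW] := weight_near1_le a1.
have t01 := theta01 p1 alpha_gt alpha_le; case/andP: (t01) => t0 t1.
exists (8 `^ p * CW * (2 / (1 - theta))).
  by rewrite !mulr_gt0 ?powR_gt0 ?invr_gt0 ?subr_gt0.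
move=> b n /andP[b0 b1] hn.
have b01 : 0 <= b <= 1 by rewrite b0 ltW.
have hd := abs_conv_dcoef (abs_conv_geom b01).
pose B := hp n `^ (beta - 2).
have B0 : 0 <= B by exact: powR_ge0.
pose k m := 8 * Num.min (hp n ^- 2) (hp m ^- 2) : R.
have k0 m : 0 <= Num.min (hp n ^- 2) (hp m ^- 2) :> R.
  by rewrite le_min !invr_ge0 !exprn_ge0 ?hp_ge0.
apply: le_trans (energy_dyadic_le p1 hd hCW (k := fun m => (k m)%:E) _ _) _.
- by move=> m; rewrite lee_fin mulr_ge0.
- move=> m w; rewrite disc0E => Dw hw; rewrite lee_fin.
  apply: le_trans (geom_derivative_le b01 Dw) _.
  have := @kernel_level_le _ n m b (toC w) _ (ltW Dw) hn hw.
  by rewrite b0 b1 => /(_ isT); rewrite /k; lra.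
apply: (@le_trans _ _ (\sum_(0 <= m <oo) (8 `^ p * CW * B `^ p)%:E * (theta ^+ dist m n)%:E)%E).
  apply: lee_nneseries => m _.
    move=> _; rewrite mule_ge0 ?poweR_ge0// lee_fin mulr_ge0 ?powR_ge0//; exact: ltW.
  rewrite poweR_EFin -!EFinM lee_fin -(beta_p alpha p1) /k powRM// powRrM.
  rewrite [leLHS](_ : _ = 8 `^ p * CW * ((hp m `^ beta * Num.min (hp n ^- 2) (hp m ^- 2)) `^ p)); last first.
    by rewrite powRM ?powR_ge0//; ring.
  rewrite -[leRHS]mulrA ler_wpM2l ?mulr_ge0 ?powR_ge0 ?(ltW CW0)//.
  (* [hardy_kernel] divided by hp n, which turns the exponent beta - 1 into beta - 2. *)
  have e : hp m `^ beta * Num.min (hp n ^- 2) (hp m ^- 2) <= B * theta ^+ dist m n.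
    have hk := hardy_kernel p alpha m n.
    have hn0 := hp_gt0 R n.
    rewrite -(ler_pM2l hn0) mulrCA (le_trans hk)// distC mulrA mulrC ler_wpM2r ?exprn_ge0//.
    rewrite /B -{2}(powRr1 (ltW hn0)) -powRD; last by rewrite (gt_eqF hn0) implybT.
    by rewrite le_eqVlt; apply/orP; left; apply/eqP; congr (_ `^ _); ring.
  apply: le_trans (powR_le (ltW p0) _ e) _; first by rewrite mulr_ge0 ?powR_ge0.
  rewrite powRM ?exprn_ge0// ler_wpM2l ?powR_ge0//.
  have h01 : 0 < theta ^+ dist m n <= 1.
    by rewrite exprn_gt0 ?theta_gt0// exprn_ile1// ltW.
  by rewrite -[leRHS]powRr1 ?exprn_ge0//; apply: (ger_powR h01); exact: ltW.
rewrite nneseriesZl; last by move=> m _; rewrite lee_fin exprn_ge0.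
have -> : (8 `^ p * CW * (2 / (1 - theta)) * B `^ p)%:E =
    ((8 `^ p * CW * B `^ p)%:E * (2 / (1 - theta))%:E)%E by rewrite -EFinM; congr EFin; ring.
apply: lee_wpmul2l; first by rewrite lee_fin !mulr_ge0 ?powR_ge0 ?(ltW CW0).
exact: dist_kernel_sum.
Qed.

Lemma geom_norm_le : exists2 K : R, 0 < K & forall b n,
  0 <= b < 1 -> hp n.+1 < 1 - b ->
  dirichlet_space p alpha (ps (geom b)) /\
  (dirichlet_norm p alpha (ps (geom b)) <= (K * hp n `^ (beta - 2))%:E)%E.
Proof.
have [K K0 hK] := geom_energy_le.
exists (1 + (kappa alpha * K) `^ p^-1); first by rewrite ltr_wpDr ?powR_ge0.
move=> b n b01 hn; have hE := hK b n b01 hn.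
case/andP: b01 => b0 b1.
have b01 : 0 <= b <= 1 by rewrite b0 ltW.
have tb := taylor_ps (abs_conv_geom b01).
split; first by apply: (dirichlet_spaceP tb); exact: le_lt_trans hE (ltry _).
apply: (dirichlet_norm_le p1 alpha_gt tb (ltW K0) _ _ hE); first exact: powR_ge0.
rewrite ps0 modulus_geom// expr0.
(* The value at 0 is 1, and the bound has the negative exponent beta - 2 of a base at most 1. *)
rewrite -[leLHS](@powRr0 _ (hp n)).
have h01 : 0 < (hp n : R) <= 1 by rewrite hp_gt0 hp_le1.
apply: (ger_powR h01); have := beta_lt2 p1 alpha_le; lra.
Qed.

End GeometricTest.

(** * Lower bounds for the Hankel coefficients of the test functions *)

Section Necessity.
Variable R : realType.
Variables p alpha : R.
Hypothesis p1 : 1 < p.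
Hypothesis alpha_gt : p - 2 < alpha.
Hypothesis alpha_le : alpha <= p - 1.
Variable mu : {finite_measure set (measurableTypeR R) -> \bar R}.
Local Notation E := (`[0%R, 1%R[%classic : set (measurableTypeR R)).
Local Notation beta := (beta p alpha).

Definition tail (b : R) : R := fine (mu `[b, 1[%classic).

Lemma tail_fin b : mu `[b, 1[%classic \is a fin_num.
Proof. by rewrite fin_num_measure//; exact: measurable_itv. Qed.

Lemma tail_ge0 b : 0 <= tail b.
Proof. exact: fine_ge0. Qed.

Lemma moment_ge b n : 0 <= b -> b ^+ n * tail b <= moment mu n.
Proof.
move=> b0; rewrite -lee_fin momentE EFinM fineK ?tail_fin//.
have -> : ((b ^+ n)%:E * mu `[b, 1%R[%classic = \int[mu]_(t in `[b, 1%R[) (b ^+ n)%:E)%E.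
  by rewrite integral_cst//; exact: measurable_itv.
have sub : (`[b, 1[%classic : set (measurableTypeR R)) `<=` E.
  by move=> t; rewrite /= !in_itv/= => /andP[bt ->]; rewrite (le_trans b0).
have mp : measurable_fun E (fun t : measurableTypeR R => (t ^+ n)%:E).
  by apply/measurable_EFinP; exact: measurable_pow.
apply: (@le_trans _ _ (\int[mu]_(t in `[b, 1%R[) (t ^+ n)%:E)%E).
  apply: ge0_le_integral.
  - exact: measurable_itv.
  - by move=> t _; rewrite lee_fin exprn_ge0.
  - exact: measurable_cst.
  - by apply: measurable_funS mp; [exact: measurable_E|exact: sub].
  - move=> t; rewrite /= in_itv/= => /andP[bt _]; rewrite lee_fin.
    by rewrite lerXn2r ?nnegrE// (le_trans b0).
apply: ge0_subset_integral => //.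
by move=> t; rewrite /= in_itv/= => /andP[t0 _]; rewrite lee_fin exprn_ge0.
Qed.

Lemma Re_lim_ge (u : nat -> Cplx R) (l : Cplx R) x K : u @ \oo --> l ->
  (forall N, (K <= N)%N -> x <= complex.Re (u N)) -> x <= complex.Re l.
Proof.
move=> ul h.
have c : complex.Re (u N) @[N --> \oo] --> complex.Re l by exact: cvg_Re.
rewrite -(cvg_lim _ c)//; apply: limr_ge; first by apply/cvg_ex; eexists; exact: c.
by near=> N; apply: h; near: N; exact: nbhs_infty_ge.
Unshelve. all: by end_near.
Qed.

(** Squaring moves down one level, since (1 - h / 2)^2 >= 1 - h; the base case is (1/2)^2. *)
Lemma exp_half_dyadic n (b : R) : 1 - hp n.+1 <= b -> 4^-1 <= b ^+ (2 ^ n.+1).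
Proof.
elim: n b => [|n IH] b hb.
  rewrite expn1; apply: le_trans (_ : (2^-1) ^+ 2 <= _); first by rewrite expr2; lra.
  move: hb; rewrite /hp expr1 => hb; have h : 2^-1 <= b by lra.
  by rewrite lerXn2r ?nnegrE ?(le_trans _ h).
have h0 := hp_gt0 R n.+2; have h1 := hp_le1 R n.+1.
have b0 : 0 <= b by apply: le_trans hb; rewrite subr_ge0 hp_le1.
have : 1 - hp n.+1 <= b ^+ 2.
  apply: le_trans (_ : (1 - hp n.+2) ^+ 2 <= _).
    by rewrite [hp n.+2]hpS; have := sqr_ge0 (hp n.+1 : R); rewrite !expr2; lra.
  by rewrite lerXn2r ?nnegrE// subr_ge0 hp_le1.
by move=> /IH; rewrite -exprM -expnS.
Qed.

(** All terms are nonnegative. The moment of order n + k is at least b^(n + k) [tail b], and the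
    coefficient b^k doubles the power of b in k. *)
Lemma hankel_coef_geom_ge b n N : 0 <= b < 1 ->
  (forall m, cvgn (hankel_series mu (geom b) m)) ->
  b ^+ n * tail b * \sum_(0 <= k < N) b ^+ k.*2 <=
    complex.Re (hankel_coef mu (geom b) n).
Proof.
move=> /andP[b0 b1] cv.
have c : hankel_series mu (geom b) n @ \oo --> hankel_coef mu (geom b) n by exact: cv.
apply: (Re_lim_ge (K := N) c) => M NM.
have -> : complex.Re (hankel_series mu (geom b) n M) =
    \sum_(0 <= k < M) moment mu (n + k) * b ^+ k.
  rewrite /hankel_series seriesEnat/= raddf_sum/=; apply: eq_bigr => k _.
  by rewrite /geom -rmorphXn -rmorphM.
rewrite (big_cat_nat (leq0n N) NM)/= -[leLHS]addr0 lerD//; last first.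
  by apply: sumr_ge0 => k _; rewrite mulr_ge0 ?moment_ge0 ?exprn_ge0.
rewrite mulr_sumr; apply: ler_sum => k _.
apply: le_trans (ler_wpM2r _ (moment_ge (n + k) b0)); last by rewrite exprn_ge0.
by rewrite -addnn !exprD le_eqVlt; apply/orP; left; apply/eqP; ring.
Qed.

Hypothesis bounded : hankel_bounded_on mu p alpha.
Hypothesis well_defined : hankel_well_defined_on mu p alpha.

Lemma hankel_bounded_carleson : carleson_measure mu.
Proof.
have [K K0 hK] := geom_norm_le p1 alpha_gt alpha_le.
have [M M0 hM] := bounded.
have p0 : 0 < p by rewrite (lt_trans _ p1).
have k0 := kappa_gt0 p1 alpha_gt.
have beta1 := beta_gt1 p1 alpha_gt.
pose S := (kappa alpha)^-1 `^ p^-1.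
have S0 : 0 < S by rewrite powR_gt0 ?invr_gt0.
(* Factors: the constant of [ps_pointwise], 4^beta because (1 - b) / 2 >= hp n / 4, S for the
   passage from norm to energy, and the norm bounds M and K. *)
have [K4 K4E K40] : exists2 K4 : R, K4 = (4 + 6 `^ `|alpha|) * ((4 `^ beta) * (S * (M * K))) & 0 < K4.
  eexists; first reflexivity.
  have A0 : 0 < 4 + 6 `^ `|alpha| by rewrite ltr_wpDr ?powR_ge0.
  by rewrite (mulr_gt0 A0)// mulr_gt0 ?powR_gt0// (mulr_gt0 S0)// mulr_gt0.
have T0 : 0 <= fine (mu setT) by exact: fine_ge0.
(* 1024 is 512 from the lower bound for g'(b) times 2 from hp n <= 2 (1 - b). The total mass covers
   b < 1/2, where 2 (1 - b) >= 1. *)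
exists (1024 * K4 + 2 * fine (mu setT)); first lra.
move=> b /andP[b0 b1].
rewrite -[leLHS](fineK (tail_fin b)) -/(tail b) lee_fin.
have [bh|bh] := ltP b 2^-1.
  have h : tail b <= fine (mu setT).
    rewrite fine_le ?tail_fin ?fin_num_measure//.
    by apply: le_measure; rewrite ?inE//; exact: measurable_itv.
  apply: (le_trans h).
  have h1 : 0 <= K4 * (1 - b) by apply: mulr_ge0; lra.
  have : 0 <= fine (mu setT) * (2 * (1 - b) - 1) by apply: mulr_ge0; lra.
  lra.
have b01 : 0 < (1 - b) * 1 <= 1 by apply/andP; split; lra.
rewrite mulr1 in b01.
(* As b >= 1/2, the level of 1 - b can be chosen at least 1, in the successor form that
   [exp_half_dyadic] requires. *)
have [n' /andP[hn1 hn2]] : exists n, hp n.+2 < 1 - b <= hp n.+1.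
  have b2 : 0 < 2 * (1 - b) <= 1 by apply/andP; split; lra.
  have [k /andP[h1 h2]] := dyadic_level b2; exists k.
  by rewrite [hp k.+2]hpS [hp k.+1 in X in _ && X]hpS ltr_pdivrMr// ler_pdivlMr// ![_ * 2]mulrC h1.
set n := n'.+1 in hn1 hn2.
have bb : 0 <= b < 1 by rewrite b0.
have bb1 : 0 <= b <= 1 by rewrite b0 ltW.
have [fs fn] := hK b n bb hn1.
have tb := taylor_ps (abs_conv_geom bb1).
have [cv1 cv2 _] := well_defined fs tb.
have [gs gn] := hM _ _ fs tb.
pose g := hankel_coef mu (geom b).
have tg : taylor_disc (hankel_op mu (geom b)) g by move=> z z1; exact: cv2.
have hg := taylor_abs_conv tg; have hd := abs_conv_dcoef hg.
pose e := M * (K * hp n `^ (beta - 2)).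
have hpn := hp_gt0 R n.
have e0 : 0 < e by rewrite !mulr_gt0 ?powR_gt0.
have ge : (dirichlet_norm p alpha (hankel_op mu (geom b)) <= e%:E)%E.
  by apply: (le_trans gn); rewrite /e EFinM lee_wpmul2l// lee_fin ltW.
have [_ gE] := dirichlet_norm_ge p1 alpha_gt tg (ltW e0) ge.
have gE' : (energy p alpha (ps (dcoef g)) (disc 0%R 1) <= ((S * e) `^ p)%:E)%E.
  apply: le_trans gE _; rewrite lee_fin powRM ?(ltW S0) ?(ltW e0)//.
  by rewrite /S -powRrM mulVf ?gt_eqF// powRr1// invr_ge0 ltW.
have mb : modulus (b%:C%C : Cplx R) = b by rewrite modulus_real ger0_norm.
have mb1 : modulus (b%:C%C : Cplx R) < 1 by rewrite mb.
have up := ps_pointwise p1 hd (mulr_gt0 S0 e0) gE' mb1.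
have up2 : modulus (ps (dcoef g) b%:C%C) <= K4 * (hp n ^+ 2)^-1.
  apply: le_trans up _; rewrite mb K4E -[leRHS]mulrA ler_wpM2l ?addr_ge0 ?powR_ge0//.
  have hq : hp n / 4 <= (1 - b) / 2 by move: hn1; rewrite hpS; lra.
  apply: (@le_trans _ _ ((hp n / 4) `^ (- beta) * (S * e))).
    apply: (ler_wpM2r (ltW (mulr_gt0 S0 e0))).
    by apply: powR_leN => //; lra.
  rewrite powRM ?(ltW hpn)// ?invr_ge0//.
  have -> : 4^-1 `^ (- beta) = 4 `^ beta :> R.
    by rewrite -[4^-1]powR_inv1// -powRrM; congr (_ `^ _); ring.
  have -> : (hp n ^+ 2)^-1 = hp n `^ (- beta) * hp n `^ (beta - 2) :> R.
    rewrite -powRD; last by rewrite (gt_eqF hpn) implybT.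
    have -> : - beta + (beta - 2) = - 2%:R by ring.
    by rewrite powR_invn ?ltW.
  by rewrite /e le_eqVlt; apply/orP; left; apply/eqP; ring.
(* N is comparable to 1 / (1 - b): up to index N the powers b^j stay above 1/4 and b^(2j) above
   1/16, whence 64 = 4 times 16 below. *)
pose N := (2 ^ n)%N.
have NE : N%:R = (hp n)^-1 :> R by rewrite /N natrX /hp exprVn invrK.
have q4 : 4^-1 <= b ^+ N.
  by apply: exp_half_dyadic; lra.
have pw j : (j <= N)%N -> 4^-1 <= b ^+ j.
  by move=> jN; apply: le_trans q4 _; rewrite ler_wiXn2l// ltW.
have pw2 j : (j <= N)%N -> 16^-1 <= b ^+ j.*2.
  move=> /pw h; rewrite -addnn exprD.
  have -> : 16^-1 = 4^-1 * 4^-1 :> R by lra.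
  by apply: ler_pM.
have t0 := tail_ge0 b.
have gn_ge j : (j < N)%N -> 64^-1 * tail b * N%:R <= complex.Re (g j.+1).
  move=> jN; apply: le_trans (hankel_coef_geom_ge j.+1 N bb cv1).
  have h1 : 16^-1 * N%:R <= \sum_(0 <= k < N) b ^+ k.*2.
    have -> : 16^-1 * N%:R = \sum_(0 <= k < N) 16^-1 :> R by rewrite sumr_const_nat subn0 mulr_natr.
    by apply: ler_sum_nat => k /andP[_ kN]; exact/pw2/ltnW.
  apply: (@le_trans _ _ ((4^-1 * tail b) * (16^-1 * N%:R))); first by lra.
  by apply: ler_pM; rewrite ?mulr_ge0// ler_wpM2r// pw.
have g_ge0 j : 0 <= complex.Re (g j).
  by apply: le_trans (hankel_coef_geom_ge j 0 bb cv1); rewrite big_nil mulr0.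
(* One factor N comes from each coefficient, N^2 / 2 from the sum of the j + 1, and 1/4 from b^j, so
   512 = 64 times 4 times 2. *)
have lo : 512^-1 * (tail b * N%:R ^+ 3) <= complex.Re (ps (dcoef g) b%:C%C).
  apply: (Re_lim_ge (K := N) (cvg_ps hd mb1)) => L NL.
  have -> : complex.Re (power_series (dcoef g) b%:C%C L) =
      \sum_(0 <= j < L) j.+1%:R * complex.Re (g j.+1) * b ^+ j.
    rewrite /power_series seriesEnat/= raddf_sum/=; apply: eq_bigr => j _.
    rewrite /dcoef -rmorphXn -(rmorph_nat (real_complex R)) /=.
    by case: (g j.+1) => x y /=; rewrite !(mul0r, mulr0, subr0).
  rewrite (big_cat_nat (leq0n N) NL)/= -[leLHS]addr0 lerD//; last first.
    by apply: sumr_ge0 => j _; rewrite !mulr_ge0 ?exprn_ge0.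
  apply: (@le_trans _ _ (\sum_(0 <= j < N) j.+1%:R * (256^-1 * tail b * N%:R))).
    rewrite -mulr_suml; apply: le_trans (ler_wpM2r _ (sum_succ_ge R N)); last by rewrite !mulr_ge0.
    by rewrite !exprS expr0; lra.
  apply: ler_sum_nat => j /andP[_ jN]; rewrite -[leRHS]mulrA ler_wpM2l//.
  have -> : 256^-1 * tail b * N%:R = 64^-1 * tail b * N%:R * 4^-1 by lra.
  by apply: ler_pM; rewrite ?mulr_ge0 ?gn_ge ?pw// ltnW.
have fin : 512^-1 * (tail b * N%:R ^+ 3) <= K4 * (hp n ^+ 2)^-1.
  have r := Re_le_modulus (ps (dcoef g) b%:C%C).
  exact: le_trans lo (le_trans (ler_norm _) (le_trans r up2)).
have {fin} := ler_wpM2r (exprn_ge0 3 (ltW hpn)) fin; rewrite NE.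
have hn0 : hp n != 0 :> R by rewrite gt_eqF.
have -> : 512^-1 * (tail b * (hp n)^-1 ^+ 3) * hp n ^+ 3 = 512^-1 * tail b by field.
have -> : K4 / hp n ^+ 2 * hp n ^+ 3 = K4 * hp n by field.
move=> fin; have : K4 * hp n <= K4 * (2 * (1 - b)).
  by rewrite ler_wpM2l ?(ltW K40)//; move: hn1; rewrite hpS; lra.
have : 0 <= 2 * fine (mu setT) * (1 - b) by rewrite !mulr_ge0 ?subr_ge0 ?(ltW b1).
by move: fin; lra.
Qed.

End Necessity.

Theorem theorem5 (R : realType) (p alpha : R)
  (mu : {finite_measure set (measurableTypeR R) -> \bar R}) :
  1 < p -> p - 2 < alpha -> alpha <= p - 1 ->
  (* mu is carried by [0, 1[ *)
  mu (~` [set` `[0, 1[]) = 0%E ->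
  (hankel_well_defined_on mu p alpha /\ hankel_bounded_on mu p alpha)
  <-> carleson_measure mu.
Proof.
move=> p1 alpha_gt alpha_le _; split.
  by move=> [wd bd]; exact: (hankel_bounded_carleson p1 alpha_gt alpha_le bd wd).
by move=> cm; exact: (carleson_hankel_bounded p1 alpha_gt alpha_le cm).
Qed.
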